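(* Let $0<|q|<1$, let $r\ge 1$, and let $a$, $b$, $c_1,\dots,c_r$, $x_1,\dots,x_r$ be indeterminates (generic complex parameters, so that no denominator below vanishes). Put $C:=c_1\cdots c_r$ and $|\mathbf n|:=n_1+\dots+n_r$ for $\mathbf n\in\mathbb Z^r$. For $\mathbf n,\mathbf k,\mathbf l\in\mathbb Z^r$ define \begin{multline*} f_{\mathbf n\mathbf k}= \frac{(aq/C,Cq/a)_{\infty}}{(aq,q/a)_{\infty}} \prod_{i,j=1}^r\frac{(qc_jx_i/x_j,qx_i/c_ix_j)_{\infty}} {(qc_jx_i/c_ix_j,qx_i/x_j)_{\infty}} \prod_{i=1}^r\frac{(ax_iq/b,bq/ax_i,bc_iq/Cx_i,Cx_iq/bc_i)_{\infty}} {(ax_iq/bc_i,bc_iq/ax_i,Cx_iq/b,bq/Cx_i)_{\infty}}\\\times \prod_{1\le i<j\le r}\frac {c_iq^{n_i}/x_i-c_jq^{n_j}/x_j}{c_i/x_i-c_j/x_j} \prod_{i=1}^r\frac{1-bc_iq^{n_i+|\mathbf n|}/ax_i}{1-bc_i/ax_i}\, (a/C)_{|\mathbf k|-|\mathbf n|} \prod_{i,j=1}^r\frac 1{(qc_jx_i/x_j)_{n_j+k_i}} \prod_{i=1}^r\frac{(bc_i/Cx_i)_{n_i+|\mathbf k|}} {(ax_iq/b)_{k_i-|\mathbf n|}} \end{multline*} and \begin{multline*} g_{\mathbf k \mathbf l}= \frac{(1-aq^{2|\mathbf k|})}{(1-a)} \prod_{1\le i<j\le r}\frac {x_iq^{k_i}-x_jq^{k_j}}{x_i-x_j}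 \prod_{i=1}^r\frac{1-bq^{|\mathbf k|-k_i}/Cx_i}{1-b/Cx_i}\, \frac 1{(aq/C)_{|\mathbf k|-|\mathbf l|}} \prod_{i,j=1}^r(c_jx_i/x_j)_{k_i+l_j} \prod_{i=1}^r\frac{(ax_i/b)_{k_i-|\mathbf l|}} {(bc_iq/Cx_i)_{|\mathbf k|+l_i}} \, q^{|\mathbf k|-r|\mathbf l|}. \end{multline*} Then $(f_{\mathbf n\mathbf k})_{\mathbf n,\mathbf k\in\mathbb Z^r}$ and $(g_{\mathbf k\mathbf l})_{\mathbf k,\mathbf l\in\mathbb Z^r}$ are inverses of each other, i.e. for all $\mathbf n,\mathbf l\in\mathbb Z^r$, \[ \sum_{\mathbf k\in\mathbb Z^r}f_{\mathbf n\mathbf k}g_{\mathbf k\mathbf l}=\delta_{\mathbf n\mathbf l} \qquad\text{and}\qquad \sum_{\mathbf k\in\mathbb Z^r}g_{\mathbf n\mathbf k}f_{\mathbf k\mathbf l}=\delta_{\mathbf n\mathbf l}. \]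
   Context: For $0<|q|<1$ the $q$-shifted factorial is $(a)_\infty:=\prod_{j\ge0}(1-aq^j)$ and, for every integer $k$ (positive, zero or negative), $(a)_k:=(a)_\infty/(aq^k)_\infty$; also $(a_1,\dots,a_m)_k:=(a_1)_k\cdots(a_m)_k$ for $k$ an integer or $\infty$. $\delta_{\mathbf n\mathbf l}$ is the Kronecker delta on $\mathbb Z^r$. *)

(* Defs.v *)
From HB Require Import structures.
From mathcomp Require Import all_boot all_order all_algebra.
From mathcomp Require Import complex.
From mathcomp Require Import all_classical all_reals all_analysis.
Import Order.TTheory GRing.Theory Num.Theory.

Set Implicit Arguments.
Unset Strict Implicit.
Unset Printing Implicit Defensive.

Local Open Scope classical_set_scope.
Local Open Scope ring_scope.

Section QDefs.
Variable R : realType.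

Definition qpoch_inf (q a : R[i]) : R[i] :=
  lim ((fun n : nat => (\prod_(j < n) (1 - a * q ^+ j) : R[i]^o)) @ \oo).

Definition qpoch (q a : R[i]) (k : int) : R[i] :=
  qpoch_inf q a / qpoch_inf q (a * q ^ k).

Definition not_qpow (q z : R[i]) : Prop := forall m : int, z != q ^ m.

Definition zvec (r : nat) := {ffun 'I_r -> int}.

Definition zabs (r : nat) (n : zvec r) : int := \sum_(i < r) n i.

Definition box_sum (r : nat) (F : zvec r -> R[i]) (N : nat) : R[i] :=
  \sum_(v : {ffun 'I_r -> 'I_(N.*2.+1)})
     F [ffun i => (nat_of_ord (v i))%:Z - N%:Z].

Definition abs_summable (r : nat) (F : zvec r -> R[i]) : Prop :=
  exists M : R[i], forall s : seq (zvec r), uniq s ->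
    \sum_(k <- s) `|F k| <= M.

(* sum_{k in Z^r} F k = S  (absolutely convergent; value = limit of box sums,
   which for an absolutely summable family is its unconditional sum) *)
Definition zsum_eq (r : nat) (F : zvec r -> R[i]) (S : R[i]) : Prop :=
  abs_summable F /\
  ((fun N : nat => (box_sum F N : R[i]^o)) @ \oo --> (S : R[i]^o)).

Definition kdelta (r : nat) (n l : zvec r) : R[i] := if n == l then 1 else 0.

Variables (r : nat) (q a b : R[i]) (c x : 'I_r -> R[i]).

Local Notation qi := (qpoch_inf q).
Local Notation qp := (qpoch q).

Definition Cprod : R[i] := \prod_(i < r) c i.

Definition fcoef (n k : zvec r) : R[i] :=
  let C := Cprod in
  (qi (a * q / C) * qi (C * q / a)) / (qi (a * q) * qi (q / a))
  * (\prod_(i < r) \prod_(j < r)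
       ((qi (q * c j * x i / x j) * qi (q * x i / (c i * x j)))
        / (qi (q * c j * x i / (c i * x j)) * qi (q * x i / x j))))
  * (\prod_(i < r)
       ((qi (a * x i * q / b) * qi (b * q / (a * x i))
         * qi (b * c i * q / (C * x i)) * qi (C * x i * q / (b * c i)))
        / (qi (a * x i * q / (b * c i)) * qi (b * c i * q / (a * x i))
           * qi (C * x i * q / b) * qi (b * q / (C * x i)))))
  * (\prod_(i < r) \prod_(j < r | (i < j)%N)
       ((c i * q ^ (n i) / x i - c j * q ^ (n j) / x j)
        / (c i / x i - c j / x j)))
  * (\prod_(i < r)
       ((1 - b * c i * q ^ (n i + zabs n) / (a * x i))
        / (1 - b * c i / (a * x i))))
  * qp (a / C) (zabs k - zabs n)
  * (\prod_(i < r) \prod_(j < r) (qp (q * c j * x i / x j) (n j + k i))^-1)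
  * (\prod_(i < r)
       (qp (b * c i / (C * x i)) (n i + zabs k)
        / qp (a * x i * q / b) (k i - zabs n))).

Definition gcoef (k l : zvec r) : R[i] :=
  let C := Cprod in
  (1 - a * q ^ (2 * zabs k)) / (1 - a)
  * (\prod_(i < r) \prod_(j < r | (i < j)%N)
       ((x i * q ^ (k i) - x j * q ^ (k j)) / (x i - x j)))
  * (\prod_(i < r)
       ((1 - b * q ^ (zabs k - k i) / (C * x i)) / (1 - b / (C * x i))))
  * (qp (a * q / C) (zabs k - zabs l))^-1
  * (\prod_(i < r) \prod_(j < r) qp (c j * x i / x j) (k i + l j))
  * (\prod_(i < r)
       (qp (a * x i / b) (k i - zabs l)
        / qp (b * c i * q / (C * x i)) (zabs k + l i)))
  * q ^ (zabs k - (r%:Z) * zabs l).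

End QDefs.

(* Main.v *)
Require Import Defs.
From HB Require Import structures.
From mathcomp Require Import all_boot all_order all_algebra all_fingroup.
From mathcomp Require Import complex.
From mathcomp Require Import all_classical all_reals all_analysis.
From mathcomp Require Import ring zify.
Import Order.TTheory GRing.Theory Num.Theory numFieldNormedType.Exports.

(** Put X_0 = b/C, X_i = x_i and W_0 = a/b, W_i = c_i/x_i, and set y_i = X_i q^(k_i),
    y_0 = X_0 q^|k|, w_j = W_j q^(n_j), w_0 = W_0 q^(-|n|).  Up to a constant,
    f_{nk} g_{kl} is then (1 - a q^(2|k|)) times the Vandermonde product of the y_i, times
    a product of one rational function of each y_i.

    For n = l this is (1 - prod y prod w) Delta(y) Delta(w) / prod (1 - y_i w_j), a
    determinant with one column of ones and the entries 1/(1 - y_i w_j) - 1/(1 - y_i w_0)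
    elsewhere.  Expanding along the ones leaves r free rows, so the sum over Z^r is the
    determinant of the bilateral sums of the entries; these are values of a q-analogue of
    the Weierstrass zeta function, and the determinant is a product of theta functions by
    the same partial fraction argument that proves the rational identity.  The partial
    fractions of theta quotients are limits of finite ones.

    For n <> l, let p_w(t) = prod (1 - t w_j) and p_v be the polynomials attached to n
    and l.  They have the same constant and top coefficients, so (1 - prod y prod w)
    Delta(y) is the determinant of the values at the y_i of p_w and t, ..., t^r, where one
    power of t may be replaced by p_v - p_w.  The rational weights turn these two columns
    into a sequence and its difference, and every 2 x 2 minor telescopes to zero.  In the
    product g f the roles of y and w are exchanged. *)

Set Implicit Arguments.
Unset Strict Implicit.
Unset Printing Implicit Defensive.

Local Open Scope classical_set_scope.
Local Open Scope ring_scope.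

(** * Alternating products and partial fractions *)

(** The obstacle is convergence: the column of ones, and likewise the weighted column of values of
    p_w, is bounded but not summable. Passing to the vectors (-|k|, k_1, ..., k_r) of sum zero
    removes it. Any coordinate of such a vector may be eliminated, so each term of the determinant
    is summed with the row of its non-summable entry eliminated. Since y_0 carries q^|k| and not
    q^(-|k|), row 0 is traversed backwards. For n = l the value must not depend on n: replacing W_j
    by w_j changes the zeta values by integers that depend on the column only, and the column of
    ones absorbs them. For n <> l the boundary terms cancel because the exponents relating the roots
    of p_v and p_w add up to 0: the ratio of the two limits of a row is then the same constant for
    all rows. In g f the factor 1 - a q^(2|n|) does not involve the summation index; the determinant
    supplies 1 - a q^(|n|+|l|) instead, a non-zero constant that is divided out. *)

Lemma prod_exprz (F : fieldType) (I : finType) (z : F) (f : I -> int) :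
  z != 0 -> \prod_i z ^ f i = z ^ (\sum_i f i).
Proof.
move=> z0; apply: (big_ind2 (fun x y => x = z ^ y)) => // x u y v -> ->.
by rewrite expfzDr.
Qed.

Section AlternatingProduct.
Variables (F : fieldType) (s : F -> F -> F).

Definition altprod n (x : 'I_n -> F) : F :=
  \prod_(i < n) \prod_(j < n | (i < j)%N) s (x i) (x j).

(** Moving [x i] to the front reverses the [i] pairs in which it came second; each contributes a
    sign. *)
Lemma altprod_lift n (x : 'I_n.+1 -> F) (i : 'I_n.+1) :
  (forall j k, s (x k) (x j) = - s (x j) (x k)) ->
  altprod x = (-1) ^+ i * \prod_(j < n) s (x i) (x (lift i j))
              * altprod (fun j => x (lift i j)).
Proof.
move=> sN; rewrite /altprod (bigD1_ord i) //=.
have -> : \prod_(j < n.+1 | (i < j)%N) s (x i) (x j)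
    = \prod_(j < n | (i < lift i j)%N) s (x i) (x (lift i j)).
  by rewrite big_mkcond (bigD1_ord i) //= ltnn mul1r -big_mkcond.
have -> : \prod_(j < n) \prod_(k < n.+1 | (lift i j < k)%N) s (x (lift i j)) (x k)
   = \prod_(j < n | ~~ (i < lift i j)%N) - s (x i) (x (lift i j))
     * \prod_(j < n) \prod_(k < n | (j < k)%N) s (x (lift i j)) (x (lift i k)).
  rewrite (big_mkcond (fun j : 'I_n => ~~ (i < lift i j)%N)) -big_split /=.
  apply: eq_bigr => j _; rewrite big_mkcond (bigD1_ord i) //= -big_mkcond /=.
  congr (_ * _); last first.
    by apply: eq_bigl => k; rewrite !ltnNge leq_bump2.
  rewrite -leqNgt ltn_neqAle (eq_sym (bump i j)) neq_bump /=.
  by case: ifP => // _; rewrite sN.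
rewrite mulrA; congr (_ * _).
rewrite prodrN mulrA mulrC mulrA mulrC; congr (_ * _).
  congr (_ ^+ _).
  rewrite -[RHS](card_ord i).
  have ni : (i <= n)%N by rewrite -ltnS.
  rewrite -(fintype.card_image (f := widen_ord ni)); last first.
    by move=> u v /(congr1 val) /= /val_inj.
  apply: eq_card => j; rewrite unfold_in -leqNgt /= /bump.
  apply/idP/fintype.imageP => [H|[k _ ->]] /=.
    have ji : (j < i)%N.
      by rewrite ltnNge; apply/negP => ij; rewrite ij add1n leqNgt ltnS ij in H.
    by exists (Ordinal ji) => //; apply: val_inj.
  by rewrite (leqNgt i) ltn_ord add0n ltnW.
by rewrite mulrC [RHS](bigID (fun j : 'I_n => i < lift i j)%N).
Qed.

End AlternatingProduct.

Section PartialFractions.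
Variables (F : fieldType) (I J : finType) (d : I -> F) (e : J -> F).

(** With the denominators cleared, the difference of the two sides is a polynomial of degree at most
    [#|I|] that vanishes at 0 and at the [#|I|] distinct points [(d i)^-1]. Subtracting 1 from each
    simple fraction makes it vanish at [t = 0], where the left-hand side is 1. *)
Lemma partial_fractions t :
  #|J| = #|I| -> injective d -> (forall i, d i != 0) ->
  (forall i, d i * t != 1) ->
  \prod_j (1 - e j * t) / \prod_i (1 - d i * t) =
  1 + \sum_i (\prod_j (1 - e j / d i) / \prod_(k | k != i) (1 - d k / d i))
             * ((1 - d i * t)^-1 - 1).
Proof.
move=> cIJ dI d0 dt.
pose c i := \prod_j (1 - e j / d i) / \prod_(k | k != i) (1 - d k / d i).
pose P : {poly F} := \prod_j (1 - e j *: 'X) - \prod_i (1 - d i *: 'X)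
   - \sum_i (c i * d i) *: ('X * \prod_(k | k != i) (1 - d k *: 'X)).
have hE (a u : F) : (1 - a *: 'X).[u] = 1 - a * u.
  by rewrite !hornerE.
have szl (a : F) : (size (1 - a *: 'X : {poly F})%R <= 2)%N.
  rewrite (leq_trans (size_polyD _ _)) // geq_max size_poly1 /=.
  by rewrite size_polyN (leq_trans (size_scale_leq _ _)) ?size_polyX.
have szp (K : finType) (A : pred K) (g : K -> F) :
    (size (\prod_(k | A k) (1 - g k *: 'X : {poly F}))%R <= #|A|.+1)%N.
  rewrite (leq_trans (size_poly_prod_leq _ _)) // leq_subLR addnS ltnS.
  rewrite addnn -mul2n mulnC -sum_nat_const; apply: leq_sum => k _; exact: szl.
have P0 : P = 0.
  apply: (@roots_geq_poly_eq0 _ P (0 :: [seq (d i)^-1 | i <- enum I])).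
  - apply/allP => u; rewrite inE => /orP [/eqP -> | /mapP [i _ ->]].
      rewrite rootE /P !hornerD !hornerN !horner_prod horner_sum.
      rewrite [\sum_(i <- _) _]big1 => [|i _]; last by rewrite hornerZ hornerM hornerX mul0r mulr0.
      by rewrite !big1 ?subrr ?subr0 // => i _; rewrite hE mulr0 subr0.
    rewrite rootE /P !hornerD !hornerN !horner_prod horner_sum.
    rewrite [in X in _ - X - _](bigD1 i) //= hE divff // subrr mul0r subr0.
    rewrite (bigD1 i) //= [X in _ - (_ + X)]big1 => [|k ki]; last first.
      rewrite !hornerE horner_prod (bigD1 i) /= 1?eq_sym // hE divff // subrr.
      by rewrite mul0r !mulr0.
    rewrite addr0 !hornerE horner_prod /c.
    rewrite (eq_bigr (fun j => 1 - e j / d i)) => [|j _]; last by rewrite hE.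
    have -> : \prod_(k | k != i) (1 - d k *: 'X).[(d i)^-1] = \prod_(k | k != i) (1 - d k / d i)
      by apply: eq_bigr => j _; rewrite hE.
    rewrite /= -(mulrA _ (d i)) divff // mulr1 divfK ?subrr //.
    apply/prodf_neq0 => k ki; rewrite subr_eq0 eq_sym.
    apply: contra_neq ki => H; apply: dI.
    by rewrite -[LHS](divfK (d0 i)) H mul1r.
  - rewrite /= map_inj_uniq ?enum_uniq ?andbT; last first.
      by move=> i j /invr_inj /dI.
    apply/mapP => -[i _ /eqP]; rewrite eq_sym invr_eq0; exact/negP.
  - rewrite /= size_map -cardE.
    rewrite (leq_trans (size_polyD _ _)) // geq_max; apply/andP; split.
      rewrite (leq_trans (size_polyD _ _)) // geq_max size_polyN -{1}cIJ.
      by rewrite !szp.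
    rewrite size_polyN (leq_trans (size_sum _ _ _)) //.
    apply/bigmax_leqP => i _; rewrite (leq_trans (size_scale_leq _ _)) //.
    rewrite (leq_trans (size_polyMleq _ _)) // size_polyX add2n /= ltnS.
    rewrite (leq_trans (szp _ _ _)) //.
    rewrite (cardD1 i I) inE add1n ltnS; apply: subset_leq_card.
    by apply/fintype.subsetP => k; rewrite !inE andbT.
have := congr1 (fun p : {poly F} => p.[t]) P0.
rewrite /P !hornerD !hornerN !horner_prod horner_sum horner0 => /eqP.
rewrite subr_eq0 subr_eq => /eqP.
have -> : \prod_j (1 - e j *: 'X).[t] = \prod_j (1 - e j * t).
  by apply: eq_bigr => j _; rewrite hE.
have -> : \prod_i (1 - d i *: 'X).[t] = \prod_i (1 - d i * t).
  by apply: eq_bigr => j _; rewrite hE.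
move=> ->.
have D1 i : 1 - d i * t != 0 by rewrite subr_eq0 eq_sym.
have D0 : \prod_i (1 - d i * t) != 0 by apply/prodf_neq0.
rewrite mulrDl divff // addrC; congr (_ + _).
rewrite mulr_suml; apply: eq_bigr => i _.
rewrite hornerZ hornerM hornerX horner_prod -/(c i).
have -> : \prod_(k | k != i) (1 - d k *: 'X).[t] = \prod_(k | k != i) (1 - d k * t).
  by apply: eq_bigr => j _; rewrite hE.
have D2 : \prod_(k | k != i) (1 - d k * t) != 0 by apply/prodf_neq0.
by rewrite [\prod_i0 _](bigD1 i) //=; field; rewrite D2 D1.
Qed.

End PartialFractions.

(** * A Cauchy-type determinant *)

Section CauchyDeterminant.
Variables (F : fieldType) (th : F -> F) (generic : F -> Prop) (h : F -> F -> F).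

(** Equal to [u - v] for [th A = 1 - A]. The reflection rule for [th A^-1] makes it antisymmetric,
    so [altprod skew] is a Vandermonde product, rational or elliptic. *)
Definition skew (u v : F) := u * th (v / u).

Definition diffmx r (x w : 'I_r.+1 -> F) : 'M[F]_r.+1 :=
  \matrix_(i, j) (if j == ord0 then 1 else h (x i * w j) (x i * w ord0)).

(** Lets a constant written with [x] first serve the sums in which the [w] label the rows. *)
Lemma cauchy_product_sym r (x w : 'I_r.+1 -> F) :
  th (\prod_i x i * \prod_j w j) * altprod skew x * altprod skew w
    / \prod_i \prod_j th (x i * w j)
  = th (\prod_i w i * \prod_j x j) * altprod skew w * altprod skew x
    / \prod_i \prod_j th (w i * x j).
Proof.
have -> : \prod_i \prod_j th (w i * x j) = \prod_i \prod_j th (x i * w j).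
  rewrite exchange_big; apply: eq_bigr => i _; apply: eq_bigr => j _.
  by rewrite mulrC.
by rewrite [\prod_i w i * _]mulrC; congr (_ / _); exact: mulrAC.
Qed.

(* The balancing condition [\prod b = \prod x] is what makes a theta quotient
   q-periodic in [t]; for [th A = 1 - A] it is superfluous. *)
Definition has_partial_fractions :=
  forall n (x b : 'I_n -> F) (t t0 : F),
    (forall i, x i != 0) -> (forall i, b i != 0) ->
    \prod_i b i = \prod_i x i ->
    (forall i j, i != j -> generic (x i / x j)) ->
    t != 0 -> t0 != 0 ->
    (forall i, generic (x i * t)) -> (forall i, generic (x i * t0)) ->
    \prod_j th (b j * t) / \prod_i th (x i * t)
    - \prod_j th (b j * t0) / \prod_i th (x i * t0)
    = \sum_i (\prod_j th (b j / x i) / \prod_(k | k != i) th (x k / x i))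
             * h (x i * t) (x i * t0).

Hypotheses (th1 : th 1 = 0)
  (thV : forall A, A != 0 -> th A^-1 = - (A^-1 * th A))
  (th_neq0 : forall A, generic A -> th A != 0)
  (pf : has_partial_fractions).

Lemma skewN u v : u != 0 -> v != 0 -> skew v u = - skew u v.
Proof.
move=> u0 v0; rewrite /skew -[u / v]invf_div thV ?mulf_neq0 ?invr_eq0 //.
by rewrite invf_div mulrN; field.
Qed.

Lemma prodSn_max n (f : 'I_n.+1 -> F) :
  \prod_i f i = f ord_max * \prod_j f (lift ord_max j).
Proof. exact: (bigD1_ord ord_max). Qed.

(* Induction on the size: expanding the determinant along its last column gives
   the partial fraction expansion of the right-hand side in the last [w]. *)
Lemma det_diffmx r (x w : 'I_r.+1 -> F) :
  (forall i, x i != 0) -> (forall i, w i != 0) ->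
  (forall i j, i != j -> generic (x i / x j)) ->
  (forall i j, generic (x i * w j)) ->
  \det (diffmx x w) = th (\prod_i x i * \prod_j w j)
    * altprod skew x * altprod skew w / \prod_i \prod_j th (x i * w j).
Proof.
elim: r x w => [|r IH] x w x0 w0 gx gxw.
  have a1 (f : 'I_1 -> F) : altprod skew f = 1.
    by rewrite /altprod big_ord1 big_mkcond big_ord1.
  by rewrite det_mx11 mxE eqxx !big_ord1 !a1 !mulr1 divff // th_neq0.
pose w' (j : 'I_r.+1) := w (lift ord_max j).
have w'0 j : w' j != 0 by exact: w0.
pose t := w ord_max.
(* Numerator parameters of the quotient to be expanded in [t]: the inverses of the other [w], and
   the one further value [B] that the balancing condition forces. *)
pose B := \prod_i x i * \prod_j w' j.
pose b j := oapp (fun j' => (w' j')^-1) B (unlift ord_max j).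
have B0 : B != 0 by rewrite mulf_neq0 //; apply/prodf_neq0.
have Pw0 : \prod_j w' j != 0 by apply/prodf_neq0.
have b0 j : b j != 0.
  by rewrite /b; case: unlift => //= k; rewrite invr_eq0.
have bE (f : F -> F) : \prod_j f (b j) = f B * \prod_j f (w' j)^-1.
  rewrite prodSn_max /b unlift_none /=; congr (_ * _).
  by apply: eq_bigr => j _; rewrite liftK.
have bx : \prod_i b i = \prod_i x i.
  by rewrite (bE id) prodfV /B mulfK.
have := pf x0 b0 bx gx (w0 ord_max) (w0 ord0) (gxw^~ ord_max) (gxw^~ ord0).
have lift00 : lift ord_max ord0 = ord0 :> 'I_r.+2 by apply: val_inj.
(* The quotient vanishes at [t0 = w ord0], since [(w ord0)^-1] is among the [b j]. *)
have -> : \prod_j th (b j * w ord0) = 0.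
  rewrite (bE (fun u => th (u * w ord0))) (bigD1 ord0) //= /w' lift00.
  by rewrite mulVf // th1 mul0r mulr0.
rewrite mul0r subr0 -/t (bE (fun u => th (u * t))) => pfE.
rewrite (expand_det_col _ ord_max).
set P := \prod_i \prod_j th (x i * w j).
pose P' := \prod_i \prod_j th (x i * w' j).
have PE : P = \prod_i th (x i * t) * P'.
  by rewrite /P -big_split; apply: eq_bigr => i _; rewrite prodSn_max.
pose Z := altprod skew x * altprod skew w' * \prod_j w' j / P'.
have th0 i j : th (x i * w j) != 0 by exact: th_neq0.
have th0' i j : th (x i * w' j) != 0 by exact: th0.
have P'0 : P' != 0 by apply/prodf_neq0 => i _; apply/prodf_neq0.
have Pt0 : \prod_i th (x i * t) != 0 by apply/prodf_neq0 => i _; exact: th0.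
have aw : altprod skew w = \prod_j w' j * \prod_j th (t / w' j) * altprod skew w'.
  rewrite (@altprod_lift _ _ _ _ ord_max) => [|j k]; last exact: skewN.
  congr (_ * _); rewrite -big_split -[in (-1) ^+ _](card_ord r.+1) -prodrN.
  by apply: eq_bigr => j _; rewrite -/t -/(w' j) -skewN //; exact: w0.
transitivity (th (B * t) * \prod_j th ((w' j)^-1 * t) / \prod_i th (x i * t) * Z);
  last first.
  have -> : \prod_i x i * \prod_j w j = B * t.
    by rewrite /B (prodSn_max w) -/t mulrA mulrAC.
  have -> : \prod_j th ((w' j)^-1 * t) = \prod_j th (t / w' j).
    by apply: eq_bigr => j _; rewrite mulrC.
  by rewrite aw PE /Z; field; rewrite P'0 Pt0.
rewrite pfE mulr_suml; apply: eq_bigr => i _.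
rewrite mxE (negPf (_ : ord_max != ord0)) // -/t.
rewrite [RHS]mulrAC [RHS]mulrC; congr (_ * _).
have -> : cofactor (diffmx x w) i ord_max
   = (-1) ^+ (i + r.+1) * \det (diffmx (fun k => x (lift i k)) w').
  rewrite /cofactor; congr (_ * \det _); apply/matrixP => k j.
  rewrite !mxE -[RHS]/(if j == ord0 then _ else h (x _ * w' j) (x _ * w' ord0)).
  by rewrite -lift00 (inj_eq lift_inj).
rewrite IH => [|k|k|k j kj|k j];
  [|exact: x0|exact: w'0|apply: gx; rewrite (inj_eq lift_inj) //|exact: gxw].
rewrite (bE (fun u => th (u / x i))).
have -> : B / x i = \prod_k x (lift i k) * \prod_j w' j.
  by rewrite /B (bigD1_ord i) //=; field.
have -> : \prod_(k | k != i) th (x k / x i) = \prod_k th (x (lift i k) / x i).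
  rewrite big_mkcond (bigD1_ord i) //= eqxx mul1r; apply: eq_bigr => k _.
  by rewrite eq_sym neq_lift.
have -> : \prod_j th ((w' j)^-1 / x i)
   = (-1) ^+ r.+1 * (x i ^+ r.+1 * \prod_j w' j)^-1 * \prod_j th (x i * w' j).
  transitivity (\prod_j - ((x i * w' j)^-1 * th (x i * w' j))).
    by apply: eq_bigr => j _; rewrite -thV ?mulf_neq0 // invfM mulrC.
  rewrite prodrN card_ord -mulrA big_split prodfV big_split /=.
  by rewrite big_const_ord iter_mulr_1.
rewrite /Z (@altprod_lift _ _ _ x i) => [|j k]; last exact: skewN.
have -> : \prod_j skew (x i) (x (lift i j))
   = x i ^+ r.+1 * \prod_k th (x (lift i k) / x i).
  by rewrite big_split big_const_ord iter_mulr_1.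
have -> : P' = \prod_j th (x i * w' j) * \prod_k \prod_j th (x (lift i k) * w' j).
  by rewrite /P' (bigD1_ord i).
have n1 : \prod_j th (x i * w' j) != 0 by apply/prodf_neq0.
have n2 : \prod_k \prod_j th (x (lift i k) * w' j) != 0.
  by apply/prodf_neq0 => k _; apply/prodf_neq0.
have n3 : \prod_k th (x (lift i k) / x i) != 0.
  by apply/prodf_neq0 => k _; apply/th_neq0/gx; rewrite eq_sym neq_lift.
rewrite exprD; field; rewrite ?n1 ?n2 ?n3 ?Pw0 ?expf_neq0 //.
Qed.

End CauchyDeterminant.

(** * The rational case and determinants with a polynomial column *)

Section RationalCase.
Variable F : fieldType.

Lemma rational_partial_fractions :
  has_partial_fractions (fun A : F => 1 - A) (fun A => A != 1)
    (fun A B => (1 - A)^-1 - (1 - B)^-1).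
Proof.
move=> n x b t t0 x0 b0 bx gx _ _ gt gt0.
have xI : injective x.
  move=> i j xij; apply/eqP; apply: contraT => /gx.
  by rewrite xij divff // eqxx.
rewrite (partial_fractions b _ xI x0 gt) // (partial_fractions b _ xI x0 gt0) //.
rewrite opprD addrACA subrr add0r -sumrB; apply: eq_bigr => i _.
by rewrite -mulrBr; congr (_ * _); ring.
Qed.

Lemma det_diffmx_rational r (x w : 'I_r.+1 -> F) :
  (forall i, x i != 0) -> (forall i, w i != 0) ->
  (forall i j, i != j -> x i != x j) -> (forall i j, x i * w j != 1) ->
  \det (diffmx (fun A B => (1 - A)^-1 - (1 - B)^-1) x w)
  = (1 - \prod_i x i * \prod_j w j)
    * altprod (fun u v => u - v) x * altprod (fun u v => u - v) w
    / \prod_i \prod_j (1 - x i * w j).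
Proof.
move=> x0 w0 xI xw.
rewrite (det_diffmx (th := fun A => 1 - A) (generic := fun A => A != 1)) //.
- have skE (y : 'I_r.+1 -> F) : (forall i, y i != 0) ->
    altprod (skew (fun A => 1 - A)) y = altprod (fun u v => u - v) y.
    move=> y0; apply: eq_bigr => i _; apply: eq_bigr => j _.
    by rewrite /skew mulrBr mulr1 mulrC divfK.
  by rewrite !skE.
- by rewrite subrr.
- by move=> A A0; rewrite mulrBr mulVf // mulr1 opprB.
- by move=> A A1; rewrite subr_eq0 eq_sym.
- exact: rational_partial_fractions.
- move=> i j ij; apply: contra_neq (xI _ _ ij) => H.
  by rewrite -[LHS](divfK (x0 j)) H mul1r.
Qed.

Lemma cofactor_col0 r (M N : 'M[F]_r.+1) i :
  (forall i j, j != ord0 -> M i j = N i j) ->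
  cofactor M i ord0 = cofactor N i ord0.
Proof.
by move=> H; congr (_ * \det _); apply/matrixP => k j; rewrite !mxE H.
Qed.

(** Both sides are linear in [P]. The power [t^0] gives the Vandermonde determinant, the powers
    [t, ..., t^r] repeat a column, and [t^(r+1)] is reduced to [t^0] through the monic polynomial
    whose roots are the nodes. *)
Lemma det_poly_col r (p : 'I_r.+1 -> F) (P : {poly F}) :
  (size P <= r.+2)%N ->
  \det (\matrix_(i, j) if j == ord0 :> 'I_r.+1 then P.[p i] else p i ^+ j)
  = (P`_0 + (-1) ^+ r * P`_r.+1 * \prod_i p i) * \det (\matrix_(i < r.+1, j < r.+1) p i ^+ j).
Proof.
pose M (P : {poly F}) :=
  \matrix_(i, j) if j == ord0 :> 'I_r.+1 then P.[p i] else p i ^+ j.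
pose g k := \sum_i p i ^+ k * cofactor (M 0) i ord0.
have ME Q : \det (M Q) = \sum_i Q.[p i] * cofactor (M 0) i ord0.
  rewrite (expand_det_col _ ord0); apply: eq_bigr => i _; rewrite mxE eqxx.
  by congr (_ * _); apply: cofactor_col0 => k j /negPf j0; rewrite !mxE j0.
have MXn k : \det (M 'X^k) = g k.
  by rewrite ME; apply: eq_bigr => i _; rewrite hornerXn.
have g0 : g 0%N = \det (\matrix_(i < r.+1, j < r.+1) p i ^+ j).
  rewrite -MXn; congr (\det _); apply/matrixP => i j; rewrite !mxE hornerXn.
  by case: eqP => // ->.
have gS (k : 'I_r) : g k.+1 = 0.
  rewrite -MXn -det_tr.
  have lk : lift ord0 k != ord0 by rewrite eq_sym neq_lift.
  apply: (determinant_alternate (i1 := ord0) (i2 := lift ord0 k)) => [|i].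
    by rewrite eq_sym.
  by rewrite !mxE eqxx (negPf lk) hornerXn.
have MP (Q : {poly F}) : (size Q <= r.+2)%N ->
   \det (M Q) = Q`_0 * g 0%N + Q`_r.+1 * g r.+1.
  move=> sQ; rewrite ME.
  transitivity (\sum_(k < r.+2) Q`_k * g k).
    rewrite (eq_bigr (fun i => \sum_(k < r.+2)
        Q`_k * (p i ^+ k * cofactor (M 0) i ord0))) => [|i _].
      by rewrite exchange_big; apply: eq_bigr => k _; rewrite mulr_sumr.
    rewrite (horner_coef_wide _ sQ) mulr_suml; apply: eq_bigr => k _.
    by rewrite -mulrA.
  rewrite big_ord_recl big_ord_recr /= big1 ?add0r // => k _.
  by rewrite gS mulr0.
move=> sP; rewrite -/(M P) (MP _ sP) -g0.
have := MP (\prod_i ('X - (p i)%:P)).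
have sz : size (\prod_i ('X - (p i)%:P)) = r.+2.
  by rewrite size_prod_XsubC; rewrite -[index_enum _]enumT size_enum_ord.
rewrite sz leqnn ME big1 => [|i _]; last first.
  by rewrite horner_prod (bigD1 i) //= hornerXsubC subrr !mul0r.
move=> /(_ isT).
have := monicP (monic_prod_XsubC (index_enum 'I_r.+1) xpredT p).
rewrite /lead_coef sz /= => ->.
rewrite -horner_coef0 horner_prod.
rewrite (eq_bigr (fun i => - p i)) => [|i _]; last by rewrite hornerXsubC sub0r.
rewrite prodrN card_ord exprS => /eqP; rewrite eq_sym addrC addr_eq0 mul1r => /eqP ->.
ring.
Qed.

Lemma altprod_vandermonde r (p : 'I_r.+1 -> F) :
  altprod (fun u v => u - v) p = (\prod_(i < r.+1) \prod_(j < r.+1 | (i < j)%N) -1)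
    * \det (\matrix_(i < r.+1, j < r.+1) p i ^+ j).
Proof.
have -> : \matrix_(i < r.+1, j < r.+1) p i ^+ j = (Vandermonde r.+1 (\row_i p i))^T.
  by apply/matrixP => i j; rewrite !mxE.
rewrite det_tr det_Vandermonde -big_split; apply: eq_bigr => i _.
rewrite -big_split; apply: eq_bigr => j _.
by rewrite /= !mxE mulN1r opprB.
Qed.

End RationalCase.

(** * Unconditional sums *)

Section Families.
Variable K : numFieldType.
Implicit Types (T U : choiceType).

(** The limit along the finite subsets ordered by inclusion. Unlike a limit of box sums it is
    invariant under reindexing and can be regrouped into fibres. *)
Definition has_sum T (F : T -> K) (S : K) := forall e, 0 < e ->
  exists A : seq T, forall B, uniq B -> {subset A <= B} ->
    `|S - \sum_(t <- B) F t| < e.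

Definition norm_bounded T (F : T -> K) := exists M, forall s, uniq s ->
  \sum_(t <- s) `|F t| <= M.

Lemma has_sum_ext T (F G : T -> K) S : F =1 G -> has_sum F S -> has_sum G S.
Proof. by move=> /funext ->. Qed.

Lemma has_sum_unique T (F : T -> K) S S' : has_sum F S -> has_sum F S' -> S = S'.
Proof.
move=> h h'; apply/eqP; rewrite -subr_eq0; apply: contraT.
rewrite -normr_gt0; set e := `|S - S'| => e0.
have e2 : 0 < e / 2 by rewrite divr_gt0.
have [A hA] := h _ e2; have [A' hA'] := h' _ e2.
pose B := undup (A ++ A').
have uB : uniq B by exact: undup_uniq.
have := hA B uB; have := hA' B uB.
have [] : {subset A <= B} /\ {subset A' <= B}.
  by split=> t tA; rewrite mem_undup mem_cat tA ?orbT.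
move=> s1 s2 /(_ s2) H2 /(_ s1) H1.
suff : e < e by rewrite ltxx.
rewrite {1}/e [ltRHS]splitr.
have -> : S - S' = (S - \sum_(t <- B) F t) - (S' - \sum_(t <- B) F t) by ring.
by rewrite (le_lt_trans (ler_normB _ _)) // ltrD.
Qed.

Lemma has_sumD T (F G : T -> K) S S' :
  has_sum F S -> has_sum G S' -> has_sum (fun t => F t + G t) (S + S').
Proof.
move=> h h' e e0; have e2 : 0 < e / 2 by rewrite divr_gt0.
have [A hA] := h _ e2; have [A' hA'] := h' _ e2.
exists (A ++ A') => B uB sB.
rewrite big_split opprD addrACA [e]splitr (le_lt_trans (ler_normD _ _)) // ltrD //.
  by apply: hA => // t tA; apply: sB; rewrite mem_cat tA.
by apply: hA' => // t tA; apply: sB; rewrite mem_cat tA orbT.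
Qed.

Lemma has_sum0 T : has_sum (fun _ : T => 0) 0.
Proof. by move=> e e0; exists [::] => B _ _; rewrite big1 // subr0 normr0. Qed.

Lemma has_sumZ T a (F : T -> K) S :
  has_sum F S -> has_sum (fun t => a * F t) (a * S).
Proof.
have [->|a0] := eqVneq a 0.
  by move=> _; rewrite mul0r; apply: has_sum_ext (@has_sum0 T) => t; rewrite mul0r.
move=> h e e0; have e2 : 0 < e / `|a| by rewrite divr_gt0 // normr_gt0.
have [A hA] := h _ e2; exists A => B uB sB.
by rewrite -mulr_sumr -mulrBr normrM mulrC -ltr_pdivlMr ?normr_gt0 // hA.
Qed.

Lemma has_sum_sum T (I : finType) (F : I -> T -> K) (S : I -> K) :
  (forall i, has_sum (F i) (S i)) ->
  has_sum (fun t => \sum_i F i t) (\sum_i S i).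
Proof.
move=> h; elim: (index_enum I) => [|i s IH].
  by rewrite big_nil; apply: has_sum_ext (@has_sum0 T) => t; rewrite big_nil.
rewrite big_cons; apply: has_sum_ext (has_sumD (h i) IH) => t.
by rewrite big_cons.
Qed.

Lemma has_sumB T (F G : T -> K) S S' :
  has_sum F S -> has_sum G S' -> has_sum (fun t => F t - G t) (S - S').
Proof.
move=> h /(has_sumZ (-1)) h'; rewrite -mulN1r.
by apply: has_sum_ext (has_sumD h h') => t; rewrite mulN1r.
Qed.

Lemma has_sum_exhaust T (F : T -> K) S (A : nat -> seq T) :
  has_sum F S -> (forall N, uniq (A N)) ->
  (forall t, \forall N \near \oo, t \in A N) ->
  (fun N => \sum_(t <- A N) F t) @ \oo --> S.
Proof.
move=> h uA cA; apply/cvgrPdist_lt => e e0.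
have [B hB] := h _ e0.
suff : \forall N \near \oo, {subset B <= A N}.
  by apply: filterS => N; exact: hB.
elim: B {hB} => [|t B IH]; first by apply: nearW.
by apply: filterS2 (cA t) IH => N tN sN u; rewrite inE => /orP[/eqP ->|/sN].
Qed.

(** Given finitely many fibres [V], the finite set witnessing the total is enlarged inside these
    fibres until each fibre sum is approximated as well; if [V] covers the image of [A], the sum
    over the enlarged set is still close to [S]. *)
Lemma has_sum_fiber T U (p : T -> U) (F : T -> K) (G : U -> K) S :
  has_sum F S ->
  (forall u, has_sum (fun t => if p t == u then F t else 0) (G u)) ->
  has_sum G S.
Proof.
move=> h hG e e0; have e2 : 0 < e / 2 by rewrite divr_gt0.
(* The successor in the tolerance chosen next keeps the divisor non-zero when [V] is empty. *)
have [A hA] := h _ e2; exists (undup (map p A)) => V uV sV.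
have e3 : 0 < e / 2 / (size V).+1%:R by rewrite divr_gt0 // ltr0n.
pose A' u := projT1 (cid (hG u _ e3)).
have hA' u := projT2 (cid (hG u _ e3)).
pose B := [seq t <- undup (A ++ flatten (map A' V)) | p t \in V].
have uB : uniq B by rewrite filter_uniq ?undup_uniq.
have sAB : {subset A <= B}.
  move=> t tA; rewrite mem_filter mem_undup mem_cat tA andbT.
  by apply: sV; rewrite mem_undup map_f.
have E : \sum_(t <- B) F t = \sum_(u <- V) \sum_(t <- B) (if p t == u then F t else 0).
  rewrite exchange_big; apply: eq_big_seq => t; rewrite mem_filter => /andP[ptV _].
  rewrite (big_rem _ ptV) /= eqxx big_seq big1 ?addr0 // => u.
  by rewrite mem_rem_uniq // inE eq_sym => /andP[/negPf ->].
have sA'B u : u \in V -> `|G u - \sum_(t <- B) (if p t == u then F t else 0)| < e / 2 / (size V).+1%:R.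
  move=> uVV.
  pose B' := undup (B ++ A' u).
  have := hA' u B' (undup_uniq _).
  suff -> : \sum_(t <- B') (if p t == u then F t else 0) = \sum_(t <- B) (if p t == u then F t else 0).
    by apply=> t tA; rewrite mem_undup mem_cat tA orbT.
  rewrite -!big_mkcond -[LHS]big_filter -[RHS]big_filter; apply: perm_big.
  apply: uniq_perm; rewrite ?filter_uniq ?undup_uniq // => t.
  rewrite !mem_filter !mem_undup mem_cat !mem_filter !mem_undup !mem_cat.
  case: eqP => //= ->; rewrite uVV /=.
  case: (boolP (t \in A' u)) => tA; rewrite ?orbF // ?orbT.
  apply/esym/orP; right; apply/flattenP; exists (A' u) => //.
  exact: map_f.
have -> : S - \sum_(u <- V) G u = (S - \sum_(t <- B) F t)
    - \sum_(u <- V) (G u - \sum_(t <- B) (if p t == u then F t else 0)).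
  by rewrite sumrB -E; ring.
rewrite [e]splitr (le_lt_trans (ler_normB _ _)) // ltr_leD ?hA //.
rewrite (le_trans (ler_norm_sum _ _ _)) // big_seq.
rewrite (le_trans (ler_sum _ (fun u uV => ltW (sA'B u uV)))) //.
rewrite -big_seq big_const_seq count_predT iter_addr_0.
have key (d : K) n : 0 <= d -> d / n.+1%:R *+ n <= d.
  move=> d0; rewrite -mulr_natr -mulrA ler_piMr // mulrC ler_pdivrMr ?ltr0n //.
  by rewrite mul1r ler_nat.
exact: key (ltW e2).
Qed.

Lemma partial_inverse T U (f : U -> T) : injective f ->
  exists g, pcancel f g /\ ocancel g f.
Proof.
move=> fI.
exists (fun t => match pselect (exists u, f u = t) with
        | left H => Some (projT1 (cid H)) | right _ => None end); split.
  move=> u; case: pselect => [H|[]]; last by exists u.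
  by congr Some; apply: fI; exact: (projT2 (cid H)).
by move=> t; case: pselect => //= H; exact: (projT2 (cid H)).
Qed.

Section Reindex.
Variables (T U : choiceType) (f : U -> T) (F : T -> K).
Hypotheses (fI : injective f) (supp : forall t, F t != 0 -> exists u, f u = t).

Lemma sum_pmap (R' : zmodType) (H : T -> R') g s : pcancel f g -> ocancel g f ->
  (forall t, H t != 0 -> F t != 0) ->
  \sum_(t <- s) H t = \sum_(u <- pmap g s) H (f u).
Proof.
move=> fK gK HF; elim: s => [|t s IH]; first by rewrite !big_nil.
rewrite big_cons IH /=; case E: (g t) => [u|] /=.
  by rewrite big_cons; have := gK t; rewrite E /= => ->.
case: (eqVneq (H t) 0) => [->|]; first by rewrite add0r.
by move=> /HF /supp[u ut]; rewrite -ut fK in E.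
Qed.

Lemma has_sum_inj S : has_sum (F \o f) S <-> has_sum F S.
Proof.
have [g [fK gK]] := partial_inverse fI.
have gu s : uniq s -> uniq (pmap g s) by exact: pmap_uniq.
have memg u s : (u \in pmap g s) = (f u \in s).
  rewrite mem_pmap; apply/mapP/idP => [[t ts E]|us]; last by exists (f u).
  by have := gK t; rewrite -E /= => ->.
split=> h e e0; have [A hA] := h _ e0.
  exists (map f A) => B uB sB; rewrite (sum_pmap _ fK gK) //.
  by apply: hA; [exact: gu|move=> u uA; rewrite memg sB // map_f].
exists (pmap g A) => B uB sB.
pose B' := undup (map f B ++ A).
have := hA B' (undup_uniq _); rewrite (sum_pmap _ fK gK) //.
have -> : \sum_(u <- pmap g B') F (f u) = \sum_(t <- B) (F \o f) t.
  apply: perm_big; apply: uniq_perm => // [|u]; first by rewrite gu ?undup_uniq.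
  rewrite memg mem_undup mem_cat mem_map //.
  case: (boolP (u \in B)) => //= uB'; apply: contraNF uB' => uA.
  by apply: sB; rewrite memg.
by apply=> t tA; rewrite mem_undup mem_cat tA orbT.
Qed.

Lemma norm_bounded_inj : norm_bounded (F \o f) <-> norm_bounded F.
Proof.
have [g [fK gK]] := partial_inverse fI.
split=> -[M hM]; exists M => s us.
  rewrite (sum_pmap (H := fun t => `|F t|) _ fK gK) => [|t]; last by rewrite normr_eq0.
  by apply: hM; exact: pmap_uniq.
by rewrite -(big_map f xpredT (fun t => `|F t|)); apply: hM; rewrite map_inj_uniq.
Qed.

End Reindex.

Lemma norm_bounded_comp T U (f : U -> T) (F : T -> K) :
  injective f -> norm_bounded F -> norm_bounded (F \o f).
Proof.
move=> fI [M hM]; exists M => s us.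
by rewrite -(big_map f xpredT (fun t => `|F t|)); apply: hM; rewrite map_inj_uniq.
Qed.

Lemma norm_bounded_ge0 T (F : T -> K) : norm_bounded F ->
  exists2 M, 0 <= M & forall s, uniq s -> \sum_(t <- s) `|F t| <= M.
Proof. by move=> [M hM]; exists M => //; have := hM [::] isT; rewrite big_nil. Qed.

Lemma norm_bounded_le T (F G : T -> K) B :
  (forall t, `|F t| <= B * `|G t|) -> norm_bounded G -> norm_bounded F.
Proof.
move=> FG /norm_bounded_ge0[M M0 hM].
have [[t _]|nT] := pselect (exists t : T, True); last first.
  by exists 0 => -[|t s] _; [rewrite big_nil | case: nT; exists t].
exists (`|B| * M) => s us.
rewrite (@le_trans _ _ (\sum_(t <- s) `|B| * `|G t|)) //.
  apply: ler_sum => u _; rewrite (le_trans (FG u)) //.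
  rewrite -[in leRHS](normr_id (G u)) -normrM real_ler_norm //.
  exact/ger0_real/(le_trans _ (FG u)).
by rewrite -mulr_sumr ler_wpM2l // hM.
Qed.

Lemma norm_boundedD T (F G : T -> K) :
  norm_bounded F -> norm_bounded G -> norm_bounded (fun t => F t + G t).
Proof.
move=> [M hM] [N hN]; exists (M + N) => s us.
rewrite (@le_trans _ _ (\sum_(t <- s) (`|F t| + `|G t|))) //.
  by apply: ler_sum => u _; exact: ler_normD.
by rewrite big_split lerD ?hM ?hN.
Qed.

Lemma norm_boundedZ T a (F : T -> K) :
  norm_bounded F -> norm_bounded (fun t => a * F t).
Proof. by apply: norm_bounded_le => t; rewrite normrM. Qed.

Lemma norm_bounded_sum T (I : finType) (F : I -> T -> K) :
  (forall i, norm_bounded (F i)) -> norm_bounded (fun t => \sum_i F i t).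
Proof.
move=> h; elim: (index_enum I) => [|i s [M IH]].
  by exists 0 => s _; rewrite big1 // => t _; rewrite big_nil normr0.
have [N hN] := norm_boundedD (h i) (ex_intro _ M IH).
exists N => s' us'; rewrite (le_trans _ (hN s' us')) //.
by apply: ler_sum => t _; rewrite big_cons.
Qed.

End Families.

(** The form of completeness on which the convergence arguments rest. Taken as a property of the
    field, it lets them run over an arbitrary [numFieldType]. *)
Definition summation_complete (K : numFieldType) :=
  forall (T : choiceType) (F : T -> K), norm_bounded F -> exists S, has_sum F S.

(** * Completeness of the real and complex numbers for unconditional sums *)

Section ComplexComplete.
Variable R : realType.

(** A non-negative family is summed by the supremum of its finite sums; the general case is the
    difference of [|F| + F] and [|F|]. *)
Lemma real_summation_complete : summation_complete R.
Proof.
suff h (T : choiceType) (F : T -> R) : (forall t, 0 <= F t) -> norm_bounded F -> exists S, has_sum F S.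
  move=> T F bF.
  have [||S hS] := h T (fun t => `|F t| + F t).
  - by move=> t; rewrite -{2}[F t]opprK subr_ge0 -normrN ler_norm.
  - apply: norm_boundedD => //; apply: (norm_bounded_le (B := 1)) bF => t.
    by rewrite normr_id mul1r.
  have [||S' hS'] := h T (fun t => `|F t|) => //.
    by apply: (norm_bounded_le (B := 1)) bF => t; rewrite normr_id mul1r.
  exists (S - S'); apply: has_sum_ext (has_sumB hS hS') => t.
  by rewrite addrAC subrr add0r.
move=> F0 [M hM].
pose E := [set \sum_(t <- s) F t | s in [set s : seq T | uniq s]].
have supE : has_sup E.
  split; first by exists (\sum_(t <- [::]) F t), [::].
  exists M => _ [s us <-]; rewrite (le_trans _ (hM s us)) //.
  by apply: ler_sum => t _; exact: ler_norm.
exists (sup E) => e e0; have [_ [A uA <-] hA] := sup_adherent e0 supE.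
exists A => B uB sAB.
have leB : \sum_(t <- B) F t <= sup E by apply: ub_le_sup; [case: supE|exists B].
rewrite ger0_norm ?subr_ge0 // ltrBlDr addrC -ltrBlDr (lt_le_trans hA) //.
have -> : \sum_(t <- A) F t = \sum_(t <- [seq t <- B | t \in A]) F t.
  apply: perm_big; apply: uniq_perm; rewrite ?filter_uniq // => t.
  by rewrite mem_filter; apply/idP/andP => [tA|[]//]; split=> //; exact: sAB.
by rewrite big_filter [leRHS](bigID (mem A)) /= lerDl sumr_ge0.
Qed.

Lemma has_sum_real_complex (T : choiceType) (F : T -> R) S :
  has_sum F S -> has_sum (fun t => (F t)%:C%C : R[i]) S%:C%C.
Proof.
move=> h e e0.
have eE : e = (complex.Re e)%:C%C.
  by move: e0; rewrite ltcE /= => /andP[/eqP i0 _]; case: e i0 => a b /= ->.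
have [|A hA] := h (complex.Re e); first by rewrite -ltcR -eE.
exists A => B uB sB; rewrite eE -rmorph_sum -rmorphB /=.
by rewrite normc_def /= expr0n /= addr0 sqrtr_sqr ltcR hA.
Qed.

Lemma complex_summation_complete : summation_complete R[i].
Proof.
move=> T F [M hM].
have key (f : R[i] -> R) : (forall z, `|f z|%:C%C <= `|z|) ->
    exists S, has_sum (fun t => f (F t)) S.
  move=> fle; apply: real_summation_complete; exists (complex.Re M) => s us.
  have H : (\sum_(t <- s) `|f (F t)|)%:C%C <= M.
    rewrite rmorph_sum /= (le_trans _ (hM s us)) //.
    by apply: ler_sum => t _; exact: fle.
  by move: H; rewrite lecE /= => /andP[].
have [S hS] := key (@complex.Re R) (@normc_ge_Re R).
have [|S' hS'] := key (@complex.Im R).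
  move=> z; rewrite normc_def lecR -sqrtr_sqr ler_wsqrtr // lerDr sqr_ge0 //.
exists (S%:C%C + 'i%C * S'%:C%C).
apply: has_sum_ext (has_sumD (has_sum_real_complex hS)
   (has_sumZ 'i%C (has_sum_real_complex hS'))) => t.
by rewrite -complexE.
Qed.

Lemma cvg_expr0 (q : R[i]) : `|q| < 1 -> (fun n => q ^+ n : R[i]^o) @ \oo --> (0 : R[i]^o).
Proof.
move=> q1; apply/cvgrPdist_lt => e e0.
have eE : e = (complex.Re e)%:C%C.
  by move: e0; rewrite ltcE /= => /andP[/eqP i0 _]; case: e i0 => a b /= ->.
have [p p0 pE] : exists2 p : R, 0 <= p & `|q| = p%:C%C.
  by rewrite normc_def; eexists; last reflexivity; exact: sqrtr_ge0.
have p1 : `|p| < 1 by rewrite ger0_norm // -ltcR -pE.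
have re0 : 0 < complex.Re e by rewrite -ltcR -eE.
have /cvgrPdist_lt/(_ _ re0) := cvg_expr p1.
apply: filterS => n; rewrite !sub0r !normrN !normrX pE (ger0_norm p0) => H.
by rewrite -rmorphXn eE ltcR.
Qed.

End ComplexComplete.

(** * Dominated convergence, telescoping series and products of series *)

Section CompleteFamilies.
Variable K : numFieldType.
Hypothesis cK : summation_complete K.

Lemma norm_bounded_tail (T : choiceType) (F : T -> K) e :
  norm_bounded F -> 0 < e -> exists A : seq T, forall B, uniq B ->
    (forall t, t \in B -> t \notin A) -> \sum_(t <- B) `|F t| < e.
Proof.
move=> bF e0; have [|S hS] := cK (F := fun t => `|F t|).
  by apply: (norm_bounded_le (B := 1)) bF => t; rewrite normr_id mul1r.
have e2 : 0 < e / 2 by rewrite divr_gt0.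
have [A hA] := hS _ e2; exists (undup A) => B uB dB.
have h1 : `|S - \sum_(t <- undup A) `|F t| | < e / 2.
  by apply: hA => [|t]; rewrite ?undup_uniq ?mem_undup.
have h2 : `|S - \sum_(t <- undup A ++ B) `|F t| | < e / 2.
  apply: hA => [|t tA]; last by rewrite mem_cat mem_undup tA.
  rewrite cat_uniq undup_uniq uB andbT /=; apply/hasPn => t; exact: dB.
rewrite big_cat /= in h2.
rewrite -[ltLHS]ger0_norm ?sumr_ge0 // [e]splitr.
set a := \sum_(t <- undup A) _ in h1 h2; set b := \sum_(t <- B) _ in h2 *.
have -> : b = (S - a) - (S - (a + b)) by ring.
by rewrite (le_lt_trans (ler_normB _ _)) // ltrD.
Qed.

(** Dominated convergence for weighted sums. Outside a finite set [C] that carries almost all of the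
    mass of [F] the weights are merely bounded; on [C] they converge. *)
Lemma tannery (T : choiceType) (F : T -> K) S (A : nat -> seq T) (r : nat -> T -> K) (rho B : K) :
  norm_bounded F -> has_sum F S -> (forall N, uniq (A N)) ->
  (forall t, \forall N \near \oo, t \in A N) ->
  (forall N t, t \in A N -> `|r N t| <= B) ->
  (forall t, r ^~ t @ \oo --> rho) ->
  (fun N => \sum_(t <- A N) r N t * F t) @ \oo --> rho * S.
Proof.
move=> bF hF uA cA rB rr.
have S1 : (fun N => rho * \sum_(t <- A N) F t) @ \oo --> rho * S.
  apply: cvgM; [exact: cvg_cst | exact: (has_sum_exhaust hF uA cA)].
suff S2 : (fun N => \sum_(t <- A N) (r N t - rho) * F t) @ \oo --> 0.
  rewrite -[rho * S]add0r; apply: (cvg_trans _ (cvgD S2 S1)).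
  apply: near_eq_cvg; apply: nearW => N /=.
  rewrite !fctE mulr_sumr -big_split; apply: eq_bigr => t _ /=; ring.
apply/cvgrPdist_lt => e e0.
pose B' := `|B| + `|rho| + 1.
have B'0 : 0 < B' by rewrite ltr_wpDl ?addr_ge0.
have [C hC] := norm_bounded_tail bF (divr_gt0 (divr_gt0 e0 (ltr0n _ 2)) B'0).
have hs : (fun N => \sum_(t <- undup C) `|r N t - rho| * `|F t|) @ \oo
    --> \sum_(t <- undup C) 0 * `|F t|.
  apply: (cvg_big (@add_continuous K)) => t _.
  apply: cvgM; last exact: cvg_cst.
  rewrite -(normr0 K) -(subrr rho); apply: cvg_norm; apply: cvgB; first exact: rr.
  exact: cvg_cst.
have /cvgrPdist_lt/(_ _ (divr_gt0 e0 (ltr0n _ 2))) := hs.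
apply: filterS => N; rewrite big1 => [|t _]; last by rewrite mul0r.
rewrite !sub0r !normrN => H.
rewrite (le_lt_trans (ler_norm_sum _ _ _)) // (bigID (mem (undup C))) /= [e]splitr.
rewrite ler_ltD //.
  apply: ltW; apply: le_lt_trans H; rewrite ger0_norm; last first.
    by apply: sumr_ge0 => t _; rewrite mulr_ge0.
  rewrite -big_filter; under eq_bigr => t _ do rewrite normrM.
  rewrite [leRHS](bigID (mem (A N))) /= -[X in _ <= X + _]big_filter.
  rewrite [X in _ <= X + _](perm_big [seq t <- A N | t \in undup C]).
    by rewrite lerDl sumr_ge0 // => t _; rewrite mulr_ge0.
  apply: uniq_perm; rewrite ?filter_uniq ?undup_uniq // => t.
  by rewrite !mem_filter andbC.
rewrite -big_filter.
apply: (@le_lt_trans _ _ (\sum_(t <- [seq t <- A N | t \notin undup C]) B' * `|F t|)).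
  rewrite big_seq [leRHS]big_seq; apply: ler_sum => t; rewrite mem_filter => /andP[_ tA].
  rewrite normrM ler_wpM2r // (le_trans (ler_normB _ _)) // /B' -addrA lerD //.
    rewrite (le_trans (rB _ _ tA)) // real_ler_norm //.
    exact/ger0_real/(le_trans _ (rB _ _ tA)).
  by rewrite lerDl.
rewrite -mulr_sumr mulrC -ltr_pdivlMr //; apply: hC; first by rewrite filter_uniq.
by move=> t; rewrite mem_filter mem_undup => /andP[].
Qed.

Definition zbox N : seq int := [seq i%:Z - N%:Z | i <- iota 0 N.*2.+1].

Lemma mem_zbox N t : (t \in zbox N) = (`|t|%N <= N)%N.
Proof.
apply/mapP/idP => [[j]|tN]; first by rewrite mem_iota => ? ->; lia.
by exists (`|(t + N%:Z)%R|%N); [rewrite mem_iota; lia | lia].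
Qed.

Lemma zbox_uniq N : uniq (zbox N).
Proof. by rewrite map_inj_uniq ?iota_uniq // => i j /addIr []. Qed.

Lemma zbox_near t : \forall N \near \oo, t \in zbox N.
Proof. by exists `|t|%N => // N /= tN; rewrite mem_zbox. Qed.

Lemma zbox_sum (f : int -> K) N :
  \sum_(t <- zbox N) f t = \sum_(i < N.*2.+1) f (i%:Z - N%:Z).
Proof. by rewrite big_map -[in RHS](big_mkord xpredT (fun i => f (i%:Z - N%:Z))) /index_iota subn0. Qed.

(** The sum exists by absolute boundedness, so it may be computed along the intervals from -N to N,
    where it equals [T (N + 1) - T (- N)]. *)
Lemma has_sum_telescope (T : int -> K) (Lp Ln : K) :
  norm_bounded (fun t => T (t + 1) - T t) ->
  T n%:Z @[n --> \oo] --> Lp -> T (- n%:Z) @[n --> \oo] --> Ln ->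
  has_sum (fun t => T (t + 1) - T t) (Lp - Ln).
Proof.
move=> bT Tp Tn; have [S hS] := cK bT.
suff <- : S = Lp - Ln by [].
apply: (cvg_unique _ (has_sum_exhaust hS zbox_uniq zbox_near)) => //=.
have := Tp; rewrite -cvg_shiftS => Tp'; apply: (cvg_trans _ (cvgB Tp' Tn)).
apply: near_eq_cvg; apply: nearW => N /=.
rewrite zbox_sum (eq_bigr (fun i : 'I_N.*2.+1 => (fun j => T (j%:Z - N%:Z)) i.+1
   - (fun j => T (j%:Z - N%:Z)) i)) => [|i _]; last first.
  by congr (T _ - _); lia.
rewrite -(big_mkord xpredT (fun i => (fun j => T (j%:Z - N%:Z)) i.+1
   - (fun j => T (j%:Z - N%:Z)) i)) telescope_sumr //.
by congr (T _ - T _); lia.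
Qed.

Section Cube.
Variable I : finType.

Definition cube N : seq {ffun I -> int} :=
  [seq [ffun i => (v i : nat)%:Z - N%:Z] | v : {ffun I -> 'I_N.*2.+1}].

Lemma mem_cube N k : (k \in cube N) = [forall i, `|k i|%N <= N]%N.
Proof.
rewrite /cube; apply/mapP/forallP => [[v _ ->] i|kN].
  rewrite ffunE; case: (v i) => m /= mN; lia.
have H i : (`|(k i + N%:Z)%R|%N < N.*2.+1)%N by have := kN i; lia.
exists [ffun i => Ordinal (H i)]; rewrite ?mem_enum //; apply/ffunP => i; rewrite !ffunE /=.
by move: (k i) (kN i) => z zN; lia.
Qed.

Lemma cube_uniq N : uniq (cube N).
Proof.
rewrite map_inj_uniq ?enum_uniq // => u v /ffunP uv; apply/ffunP => i.
by apply: val_inj; have := uv i; rewrite !ffunE => /addIr [].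
Qed.

Lemma cube_near k : \forall N \near \oo, k \in cube N.
Proof.
exists (\max_i `|k i|%N) => // N /= kN; rewrite mem_cube; apply/forallP => i.
by rewrite (leq_trans _ kN) // (leq_bigmax i).
Qed.

Lemma cube_sum (F : {ffun I -> int} -> K) N :
  \sum_(k <- cube N) F k
  = \sum_(v : {ffun I -> 'I_N.*2.+1}) F [ffun i => (v i : nat)%:Z - N%:Z].
Proof. by rewrite big_image. Qed.

Lemma cube_sum_prod (h : I -> int -> K) N :
  \sum_(k <- cube N) \prod_i h i (k i) = \prod_i \sum_(t <- zbox N) h i t.
Proof.
under [RHS]eq_bigr do rewrite zbox_sum.
rewrite cube_sum bigA_distr_bigA; apply: eq_bigr => v _.
by apply: eq_bigr => i _; rewrite ffunE.
Qed.

Lemma norm_bounded_prod (h : I -> int -> K) :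
  (forall i, norm_bounded (h i)) ->
  norm_bounded (fun k : {ffun I -> int} => \prod_i h i (k i)).
Proof.
move=> bh; pose M i := projT1 (cid (bh i)).
have hM i := projT2 (cid (bh i)).
exists (\prod_i M i) => s us.
have [N sN] : exists N, {subset s <= cube N}.
  suff [N _ /(_ N (leqnn N)) hN] : \forall N \near \oo, {subset s <= cube N} by exists N.
  elim: s {us} => [|t s IH]; first by apply: nearW.
  apply: filterS2 (cube_near t) IH => N tN sN u.
  by rewrite inE => /orP[/eqP ->|/sN].
apply: (@le_trans _ _ (\sum_(k <- cube N) \prod_i `|h i (k i)|)).
  rewrite [leRHS](bigID (mem s)) /= -[X in _ <= X + _]big_filter.
  rewrite [X in _ <= X + _](perm_big s); last first.
    apply: uniq_perm; rewrite ?filter_uniq ?cube_uniq // => t.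
    by rewrite mem_filter; apply/andP/idP => [[]//|ts]; split=> //; exact: sN.
  under eq_bigr do rewrite normr_prod.
  by rewrite lerDl sumr_ge0 // => k _; exact: prodr_ge0.
rewrite (cube_sum_prod (fun i t => `|h i t|)); apply: ler_prod => i _.
by rewrite sumr_ge0 //= hM // zbox_uniq.
Qed.

(** Over a cube the sum of products is the product of interval sums; the product family is
    absolutely bounded, so its sum is the limit along the cubes. *)
Lemma has_sum_prod (h : I -> int -> K) (S : I -> K) :
  (forall i, norm_bounded (h i)) -> (forall i, has_sum (h i) (S i)) ->
  has_sum (fun k : {ffun I -> int} => \prod_i h i (k i)) (\prod_i S i).
Proof.
move=> bh hh; have [S' hS'] := cK (norm_bounded_prod bh).
suff <- : S' = \prod_i S i by [].
apply: (cvg_unique _ (has_sum_exhaust hS' cube_uniq cube_near)) => //=.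
under eq_cvg do rewrite cube_sum_prod.
apply: (cvg_big (@mul_continuous K)) => i _.
exact: has_sum_exhaust (hh i) zbox_uniq zbox_near.
Qed.

End Cube.

End CompleteFamilies.

Lemma zsum_of_has_sum (R : realType) r (F : zvec r -> R[i]) S :
  norm_bounded F -> has_sum F S -> zsum_eq F S.
Proof.
move=> bF hF; split=> //.
have := has_sum_exhaust hF (@cube_uniq _) (@cube_near _).
by under eq_cvg do rewrite cube_sum.
Qed.

(** * Determinants summed over the zero-sum lattice *)

Lemma near_int_shift (P : int -> Prop) (c : int) :
  (\forall n \near \oo, P n%:Z) -> \forall n \near \oo, P (n%:Z + c).
Proof.
move=> [N _ hN]; exists (N + `|c|)%N => // n /= nN.
have -> : n%:Z + c = `|(n%:Z + c)%R|%N%:Z by lia.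
by apply: hN => /=; lia.
Qed.

Lemma cvg_int_shift (K : numFieldType) (f : int -> K) (l : K) (c : int) :
  f n%:Z @[n --> \oo] --> l -> f (n%:Z + c) @[n --> \oo] --> l.
Proof.
move=> /cvgrPdist_lt h; apply/cvgrPdist_lt => e e0.
exact: (near_int_shift (P := fun t => `|l - f t| < e)) (h _ e0).
Qed.

Section ZeroSumLattice.
Variables (K : numFieldType) (r : nat).

(* Any [r] of the [r.+1] coordinates parametrize the vectors of sum zero, so a
   summand not involving row [i0] decouples once [i0] is the eliminated one. *)
Definition extend (i0 : 'I_r.+1) (m : {ffun 'I_r -> int}) : {ffun 'I_r.+1 -> int} :=
  [ffun i => if unlift i0 i is Some j then m j else - \sum_j m j].

Lemma extend_at i0 m : extend i0 m i0 = - \sum_j m j.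
Proof. by rewrite ffunE unlift_none. Qed.

Lemma extend_lift i0 m j : extend i0 m (lift i0 j) = m j.
Proof. by rewrite ffunE liftK. Qed.

Lemma extend_inj i0 : injective (extend i0).
Proof. by move=> m n E; apply/ffunP => j; rewrite -!(extend_lift i0) E. Qed.

Lemma sum_extend i0 m : \sum_i extend i0 m i = 0.
Proof.
rewrite (bigD1_ord i0) //= extend_at.
by under eq_bigr do rewrite extend_lift; rewrite addNr.
Qed.

Lemma extend_surj i0 (v : {ffun 'I_r.+1 -> int}) :
  \sum_i v i = 0 -> exists m, extend i0 m = v.
Proof.
move=> v0; exists [ffun j => v (lift i0 j)]; apply/ffunP => i.
case: (unliftP i0 i) => [j ->|->]; first by rewrite extend_lift ffunE.
rewrite extend_at; under eq_bigr do rewrite ffunE.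
by move: v0; rewrite (bigD1_ord i0) //= => /eqP; rewrite addr_eq0 => /eqP ->.
Qed.

(** Extension by zero to all of Z^(r+1). Every [extend i0] is a bijection onto the vectors of sum
    zero, hence sums do not depend on the eliminated coordinate. *)
Definition on_zero_sum (G : {ffun 'I_r.+1 -> int} -> K) (v : {ffun 'I_r.+1 -> int}) :=
  if \sum_i v i == 0 then G v else 0.

Lemma on_zero_sumE i0 G : on_zero_sum G \o extend i0 = G \o extend i0.
Proof. by apply/funext => m; rewrite /on_zero_sum /= sum_extend eqxx. Qed.

Lemma on_zero_sum_supp i0 G v : on_zero_sum G v != 0 -> exists m, extend i0 m = v.
Proof.
by rewrite /on_zero_sum; case: ifP => [/eqP v0 _|]; [exact: extend_surj | rewrite eqxx].
Qed.

Lemma has_sum_extend i0 i1 (G : {ffun 'I_r.+1 -> int} -> K) S :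
  has_sum (G \o extend i0) S -> has_sum (G \o extend i1) S.
Proof.
rewrite -(on_zero_sumE i0) -(on_zero_sumE i1) => h.
apply: (iffRL (has_sum_inj (@extend_inj i1) (@on_zero_sum_supp i1 G) S)).
exact: (iffLR (has_sum_inj (@extend_inj i0) (@on_zero_sum_supp i0 G) S)).
Qed.

Lemma norm_bounded_extend i0 i1 (G : {ffun 'I_r.+1 -> int} -> K) :
  norm_bounded (G \o extend i0) -> norm_bounded (G \o extend i1).
Proof.
rewrite -(on_zero_sumE i0) -(on_zero_sumE i1) => h.
apply: (iffRL (norm_bounded_inj (@extend_inj i1) (@on_zero_sum_supp i1 G))).
exact: (iffLR (norm_bounded_inj (@extend_inj i0) (@on_zero_sum_supp i0 G))).
Qed.

Hypothesis cK : summation_complete K.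

Section Determinant.
Variables (u : 'I_r.+1 -> 'I_r.+1 -> int -> K) (B : K).
Hypotheses (u_bounded : forall i t, `|u i ord0 t| <= B)
  (u_summable : forall i j, j != ord0 -> norm_bounded (u i j)).

Definition det_term (s : 'S_r.+1) (v : {ffun 'I_r.+1 -> int}) : K :=
  \prod_i u i (s i) (v i).

Definition det_at (v : {ffun 'I_r.+1 -> int}) : K := \det (\matrix_(i, j) u i j (v i)).

Lemma det_atE v : det_at v = \sum_(s : 'S_r.+1) (-1) ^+ s * det_term s v.
Proof.
by apply: eq_bigr => s _; congr (_ * _); apply: eq_bigr => i _; rewrite mxE.
Qed.

Lemma det_term_extend (s : 'S_r.+1) i0 m : det_term s (extend i0 m)
  = u i0 (s i0) (- \sum_j m j) * \prod_j u (lift i0 j) (s (lift i0 j)) (m j).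
Proof.
rewrite /det_term (bigD1_ord i0) //= extend_at; congr (_ * _).
by apply: eq_bigr => j _; rewrite extend_lift.
Qed.

Lemma det_col_neq0 (s : 'S_r.+1) i0 j : s i0 = ord0 -> s (lift i0 j) != ord0.
Proof. by move=> <-; rewrite (inj_eq perm_inj) eq_sym neq_lift. Qed.

(** A permutation picks exactly one entry of column 0, the merely bounded one. With its row [i0]
    eliminated, the other [r] factors depend on independent coordinates and are summable. *)
Lemma det_term_bounded s i : norm_bounded (det_term s \o extend i).
Proof.
pose i0 := (s^-1)%g ord0; have si0 : s i0 = ord0 by rewrite permKV.
have bp := norm_bounded_prod (fun j => u_summable (lift i0 j) (det_col_neq0 j si0)).
apply: (@norm_bounded_extend i0); apply: (norm_bounded_le (B := B)) bp => m.
by rewrite /= det_term_extend si0 normrM ler_wpM2r.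
Qed.

Lemma det_at_bounded i : norm_bounded (det_at \o extend i).
Proof.
have := norm_bounded_sum (fun s : 'S_r.+1 =>
  norm_boundedZ ((-1) ^+ s) (det_term_bounded s i)).
apply: (norm_bounded_le (B := 1)) => m /=; rewrite mul1r det_atE.
exact: lexx.
Qed.

Lemma has_sum_det_col1 (H : 'I_r.+1 -> 'I_r.+1 -> K) i :
  (forall k t, u k ord0 t = 1) ->
  (forall k j, j != ord0 -> has_sum (u k j) (H k j)) ->
  has_sum (det_at \o extend i) (\det (\matrix_(k, j) if j == ord0 then 1 else H k j)).
Proof.
move=> u1 hu.
apply: (@has_sum_ext _ _ (fun m => \sum_(s : 'S_r.+1) (-1) ^+ s * det_term s (extend i m))).
  by move=> m; rewrite -det_atE.
apply: has_sum_sum => s; apply: has_sumZ.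
pose i0 := (s^-1)%g ord0; have si0 : s i0 = ord0 by rewrite permKV.
apply: (@has_sum_extend i0).
rewrite (bigD1_ord i0) //= mxE si0 eqxx mul1r.
have E : \prod_j (\matrix_(k, j) (if j == ord0 then 1 else H k j)) (lift i0 j) (s (lift i0 j))
    = \prod_j H (lift i0 j) (s (lift i0 j)).
  by apply: eq_bigr => j _; rewrite mxE (negPf (det_col_neq0 _ si0)).
rewrite E.
have bu j := u_summable (lift i0 j) (det_col_neq0 j si0).
apply: has_sum_ext (has_sum_prod cK bu (fun j => hu _ _ (det_col_neq0 j si0))) => m.
by rewrite /= det_term_extend si0 u1 mul1r.
Qed.

Section Telescoping.
Variables (j0 : 'I_r.+1) (Lp Ln : 'I_r.+1 -> K).
Hypotheses (j0_neq0 : j0 != ord0)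
  (u_diff : forall i t, u i j0 t = u i ord0 (t + 1) - u i ord0 t)
  (u_lim : forall i, u i ord0 n%:Z @[n --> \oo] --> Lp i)
  (u_limN : forall i, u i ord0 (- n%:Z) @[n --> \oo] --> Ln i)
  (L_comm : forall i k, Lp i * Ln k = Lp k * Ln i).

(** For two rows whose exponents have the fixed sum [s], the 2 x 2 minor is the difference of the
    sequence [T], and the limits of [T] at the two ends agree by [L_comm]. *)
Lemma telescope_pair i0 i1 (s : int) :
  has_sum (fun t => u i0 ord0 (s - t) * u i1 j0 t - u i0 j0 (s - t) * u i1 ord0 t) 0.
Proof.
pose T t := u i0 ord0 (s - t + 1) * u i1 ord0 t.
have TE t : T (t + 1) - T t
    = u i0 ord0 (s - t) * u i1 j0 t - u i0 j0 (s - t) * u i1 ord0 t.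
  rewrite /T !u_diff (_ : s - (t + 1) + 1 = s - t); last by ring.
  ring.
apply: (has_sum_ext TE).
have -> : 0 = Ln i0 * Lp i1 - Lp i0 * Ln i1 by rewrite mulrC L_comm subrr.
apply: (has_sum_telescope cK).
- rewrite (funext TE); apply: norm_boundedD.
    apply: (norm_bounded_le (B := B)) (u_summable i1 j0_neq0) => t.
    by rewrite normrM ler_wpM2r.
  have sI : injective (fun t : int => s - t) by move=> x y /addrI /oppr_inj.
  have := norm_bounded_comp sI (u_summable i0 j0_neq0).
  apply: (norm_bounded_le (B := B)) => t.
  by rewrite normrN normrM mulrC ler_wpM2r.
- apply: cvgM => //.
  have h := @cvg_int_shift K (fun t => u i0 ord0 (- t)) _ (- (s + 1)) (@u_limN i0).
  apply: cvg_trans h; apply: near_eq_cvg; apply: nearW => n.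
  by congr (u i0 ord0 _); ring.
- apply: cvgM => //.
  have h := @cvg_int_shift K _ _ (s + 1) (@u_lim i0).
  apply: cvg_trans h; apply: near_eq_cvg; apply: nearW => n.
  by congr (u i0 ord0 _); ring.
Qed.

(* Moving one unit from coordinate [i0] to coordinate [i1] changes the difference
   of the two terms into a telescoping sum whose limits at both ends agree. *)
Lemma det_term_swap (s : 'S_r.+1) S S' i :
  has_sum (det_term s \o extend i) S ->
  has_sum (det_term (s * tperm ord0 j0)%g \o extend i) S' -> S = S'.
Proof.
pose i0 := (s^-1)%g ord0; have si0 : s i0 = ord0 by rewrite permKV.
pose i1 := (s^-1)%g j0; have si1 : s i1 = j0 by rewrite permKV.
have i01 : i0 != i1 by rewrite -(inj_eq (@perm_inj _ s)) si0 si1 eq_sym.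
case: (unliftP i0 i1) => [j1 i1E|E]; last by rewrite E eqxx in i01.
move=> /(@has_sum_extend _ i0) h /(@has_sum_extend _ i0) h'.
have {h h'} hD := has_sumB h h'.
apply/eqP; rewrite -subr_eq0; apply/eqP.
(* The fibres of [p] are the lines on which only the coordinates [i1] and, through the zero sum,
   [i0] vary; [telescope_pair] sums each of them. *)
pose p (m : {ffun 'I_r -> int}) : {ffun 'I_r -> int} :=
  [ffun j => if j == j1 then 0 else m j].
apply: (has_sum_unique (has_sum_fiber (p := p) (G := fun=> 0) hD _)); last first.
  exact: has_sum0.
move=> w.
(* [p] puts 0 at [j1], so the fibre over any other [w] is empty. *)
have [w0|w0] := eqVneq (w j1) 0; last first.
  apply: has_sum_ext (@has_sum0 _ _) => m; case: eqP => // pm.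
  by rewrite -pm ffunE eqxx eqxx in w0.
pose f t : {ffun 'I_r -> int} := [ffun j => if j == j1 then t else w j].
have fI : injective f by move=> t t' /ffunP /(_ j1); rewrite !ffunE eqxx.
apply/(has_sum_inj (f := f) fI).
  move=> m; case: ifP => [/eqP pm _|]; last by rewrite eqxx.
  exists (m j1); apply/ffunP => j; rewrite ffunE -pm ffunE.
  by case: eqP => // ->.
pose A := \prod_(j | j != j1) u (lift i0 j) (s (lift i0 j)) (w j).
pose c := - \sum_(j | j != j1) w j.
rewrite -(mulr0 A); apply: has_sum_ext (has_sumZ A (telescope_pair i0 i1 c)) => t /=.
have -> : p (f t) = w.
  by apply/ffunP => j; rewrite !ffunE; case: eqP => // ->.
rewrite eqxx !det_term_extend !permM si0 tpermL.
have -> : - \sum_j f t j = c - t.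
  rewrite (bigD1 j1) //= ffunE eqxx opprD addrC; congr (- _ - _).
  by apply: eq_bigr => j /negPf jj; rewrite ffunE jj.
rewrite (bigD1 j1) //= [X in _ = _ - _ * X](bigD1 j1) //= permM -i1E si1 tpermR.
rewrite ffunE eqxx.
have -> : \prod_(j | j != j1) u (lift i0 j) (s (lift i0 j)) (f t j) = A.
  by apply: eq_bigr => j /negPf jj; rewrite ffunE jj.
have -> : \prod_(j | j != j1) u (lift i0 j) ((s * tperm ord0 j0)%g (lift i0 j)) (f t j) = A.
  apply: eq_bigr => j jj; rewrite ffunE (negPf jj) permM tpermD //.
    by rewrite -si0 (inj_eq perm_inj) neq_lift.
  by rewrite -si1 (inj_eq perm_inj) i1E (inj_eq lift_inj) eq_sym.
ring.
Qed.

(** Exchanging the columns [ord0] and [j0] changes the sign of a permutation but, by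
    [det_term_swap], not the sum of its term; the total is its own negative. *)
Lemma has_sum_det_telescope i : has_sum (det_at \o extend i) 0.
Proof.
pose S s := projT1 (cid (cK (det_term_bounded s i))).
have hS s := projT2 (cid (cK (det_term_bounded s i))) : has_sum _ (S s).
have h : has_sum (det_at \o extend i) (\sum_(s : 'S_r.+1) (-1) ^+ s * S s).
  apply: (@has_sum_ext _ _ (fun m => \sum_(s : 'S_r.+1) (-1) ^+ s * det_term s (extend i m))).
    by move=> m; rewrite /= det_atE.
  by apply: has_sum_sum => s; apply: has_sumZ; exact: hS.
suff S0 : \sum_(s : 'S_r.+1) (-1) ^+ s * S s = 0 by rewrite S0 in h.
set Z := LHS; suff : Z = - Z by move/eqP; rewrite -addr_eq0 -mulr2n mulrn_eq0 => /eqP.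
rewrite {1}/Z (reindex_inj (mulIg (tperm ord0 j0))) -sumrN; apply: eq_bigr => s _.
rewrite odd_permM odd_tperm eq_sym j0_neq0 signr_addb mulrN1 mulNr.
by congr (- (_ * _)); apply/esym/det_term_swap; exact: hS.
Qed.

End Telescoping.
End Determinant.
End ZeroSumLattice.

(** * Infinite q-shifted factorials *)

Section Bounded.
Variable K : numFieldType.

Definition bounded_family (T : Type) (u : T -> K) := exists B, forall t, `|u t| <= B.

Lemma bounded_familyM (T : Type) (u v : T -> K) :
  bounded_family u -> bounded_family v -> bounded_family (fun t => u t * v t).
Proof.
by move=> [B hB] [C hC]; exists (B * C) => t; rewrite normrM ler_pM.
Qed.

Lemma bounded_familyD (T : Type) (u v : T -> K) :
  bounded_family u -> bounded_family v -> bounded_family (fun t => u t + v t).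
Proof.
move=> [B hB] [C hC]; exists (B + C) => t.
by rewrite (le_trans (ler_normD _ _)) // lerD.
Qed.

Lemma bounded_family_cst (T : Type) c : bounded_family (fun _ : T => c).
Proof. by exists `|c|. Qed.

Lemma bounded_family_prod (T : Type) (I : finType) (P : pred I) (u : I -> T -> K) :
  (forall i, P i -> bounded_family (u i)) -> bounded_family (fun t => \prod_(i | P i) u i t).
Proof.
move=> h; elim: (index_enum I) => [|i s [C hC]].
  by exists 1 => t; rewrite big_nil normr1.
case Pi: (P i); last by exists C => t; rewrite big_cons Pi.
have [B hB] := bounded_familyM (h i Pi) (ex_intro _ C hC).
by exists B => t; rewrite big_cons Pi.
Qed.

Lemma bounded_family_comp (T U : Type) (f : U -> T) (u : T -> K) :
  bounded_family u -> bounded_family (u \o f).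
Proof. by move=> [B hB]; exists B => t; exact: hB. Qed.

Lemma cvg_bounded_family (u : nat -> K) (l : K) :
  u @ \oo --> l -> bounded_family u.
Proof.
move=> /cvgrPdist_lt /(_ _ ltr01) [N _ hN].
exists (`|l| + 1 + \sum_(i < N) `|u i|) => n.
have [nN|Nn] := ltnP n N.
  rewrite (bigD1 (Ordinal nN)) //= addrCA lerDl.
  by rewrite !addr_ge0 // sumr_ge0.
rewrite (@le_trans _ _ (`|l| + 1)) //; last by rewrite lerDl sumr_ge0.
have -> : u n = l - (l - u n) by ring.
by rewrite (le_trans (ler_normB _ _)) // lerD // ltW // hN.
Qed.

Lemma cvg_bounded_int (u : int -> K) (l l' : K) :
  u n%:Z @[n --> \oo] --> l -> u (- n%:Z) @[n --> \oo] --> l' -> bounded_family u.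
Proof.
move=> /cvg_bounded_family[B hB] /cvg_bounded_family[C hC].
have B0 : 0 <= B := le_trans (normr_ge0 _) (hB 0%N).
have C0 : 0 <= C := le_trans (normr_ge0 _) (hC 0%N).
exists (B + C) => -[n|n]; first by rewrite (le_trans (hB n)) // lerDl.
by rewrite NegzE (le_trans (hC n.+1)) // lerDr.
Qed.

End Bounded.

Section QPochhammer.
Variables (K : numFieldType) (q : K).
Hypotheses (cK : summation_complete K) (q0 : q != 0) (q1 : `|q| < 1)
  (qX : q ^+ n @[n --> \oo] --> (0 : K)).

Definition pochhammer (a : K) n := \prod_(j < n) (1 - a * q ^+ j).

Definition pochhammer_inf (a : K) : K := lim (pochhammer a @ \oo).

Lemma pochD a m n : pochhammer a (m + n) = pochhammer a m * pochhammer (a * q ^+ m) n.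
Proof.
rewrite /pochhammer big_split_ord; congr (_ * _); apply: eq_bigr => j _ /=.
by rewrite exprD mulrA.
Qed.

Lemma pochS a n : pochhammer a n.+1 = pochhammer a n * (1 - a * q ^+ n).
Proof. by rewrite /pochhammer big_ord_recr. Qed.

Let q1' : 0 < 1 - `|q|. Proof. by rewrite subr_gt0. Qed.

Lemma geometric_le n : \sum_(j < n) `|q| ^+ j <= (1 - `|q|)^-1.
Proof.
rewrite -[leRHS]mul1r ler_pdivlMr // mulrC -opprB mulNr -subrX1 opprB.
by rewrite gerBl exprn_ge0.
Qed.

Lemma norm_bounded_geometric : norm_bounded (fun n : nat => q ^+ n).
Proof.
exists (1 - `|q|)^-1 => s us.
pose N := (\max_(n <- s) n).+1.
rewrite (le_trans _ (geometric_le N)) //.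
under eq_bigr => n _ do rewrite normrX.
rewrite -(big_mkord xpredT (fun n => `|q| ^+ n)) [leRHS](bigID (mem s)) /= -[X in _ <= X + _]big_filter.
rewrite [X in _ <= X + _](perm_big s).
  by rewrite lerDl sumr_ge0 // => n _; exact: exprn_ge0.
apply: uniq_perm; rewrite ?filter_uniq ?iota_uniq // => n.
rewrite mem_filter mem_index_iota; apply/andP/idP => [[]//|ns]; split=> //.
by rewrite ltnS; apply: leq_bigmax_seq.
Qed.

(** The sharper estimate [|(a)_n - 1| <= 2 \sum |a| |q|^j] is proved by induction, as it keeps
    [|(a)_n| <= 2]; the bound 1/4 makes its right-hand side at most 1/2. *)
Lemma poch_small a n : `|a| / (1 - `|q|) <= 4%:R^-1 -> `|pochhammer a n - 1| <= 2^-1.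
Proof.
move=> asmall.
have Sle m : 2 * (\sum_(j < m) `|a| * `|q| ^+ j) <= 2^-1.
  have -> : 2^-1 = 2 * 4%:R^-1 :> K by field.
  rewrite ler_wpM2l // (le_trans _ asmall) // -mulr_sumr ler_wpM2l //.
  exact: geometric_le.
apply: (le_trans _ (Sle n)).
elim: n => [|n IH]; first by rewrite /pochhammer !big_ord0 subrr normr0 mulr0.
rewrite big_ord_recr mulrDr /=.
have -> : pochhammer a n.+1 - 1 = (pochhammer a n - 1) - pochhammer a n * (a * q ^+ n).
  by rewrite pochS; ring.
rewrite (le_trans (ler_normB _ _)) // lerD // !normrM normrX ler_wpM2r ?mulr_ge0 ?exprn_ge0 //.
have -> : pochhammer a n = (pochhammer a n - 1) + 1 by ring.
rewrite (le_trans (ler_normD _ _)) // normr1 -[2]/(1 + 1) lerD //.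
by rewrite (le_trans IH) // (le_trans (Sle n)) // invf_le1 // ler1n.
Qed.

Lemma eventually_small a : exists N, `|a * q ^+ N| / (1 - `|q|) <= 4%:R^-1.
Proof.
have e0 : 0 < 4%:R^-1 * (1 - `|q|) / (`|a| + 1).
  by rewrite divr_gt0 ?mulr_gt0 ?invr_gt0 ?ltr0n // ltr_wpDl.
have /cvgrPdist_lt /(_ _ e0) [N _ /(_ N (leqnn N))] := qX.
rewrite /= sub0r normrN => H; exists N; rewrite ler_pdivrMr // normrM.
apply: (@le_trans _ _ ((`|a| + 1) * `|q ^+ N|)).
  by rewrite ler_wpM2r // lerDl.
by rewrite mulrC -ler_pdivlMr ?ltW // ltr_wpDl.
Qed.

(** The partial products are the partial sums of [1 - \sum_n (a)_n a q^n], dominated by a geometric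
    series. By [poch_small] they stay within 1/2 of 1, so the limit is not 0. *)
Lemma poch_cvg_small a : `|a| / (1 - `|q|) <= 4%:R^-1 ->
  exists2 l, pochhammer a @ \oo --> l & l != 0.
Proof.
move=> asmall.
have bP : norm_bounded (fun n => pochhammer a n * (a * q ^+ n)).
  apply: (norm_bounded_le (B := 2 * `|a|)) norm_bounded_geometric => n.
  rewrite !normrM mulrA ler_wpM2r // ler_wpM2r //.
  have -> : pochhammer a n = (pochhammer a n - 1) + 1 by ring.
  rewrite (le_trans (ler_normD _ _)) // normr1 -[2]/(1 + 1) lerD //.
  by rewrite (le_trans (poch_small n asmall)) // invf_le1 // ler1n.
have [S hS] := cK bP.
have Pc : pochhammer a @ \oo --> 1 - S.
  have iota_near t : \forall N \near \oo, t \in iota 0 N.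
    by exists t.+1 => // N /= tN; rewrite mem_iota.
  have h := has_sum_exhaust hS (iota_uniq 0) iota_near.
  apply: (cvg_trans _ (cvgB (@cvg_cst _ (1 : K) _ _ _) h)).
  apply: near_eq_cvg; apply: nearW => n; rewrite !fctE.
  elim: n => [|n IH]; first by rewrite big_nil /pochhammer big_ord0 subr0.
  by rewrite pochS -addn1 iotaD big_cat big_seq1 opprD addrA IH; ring.
exists (1 - S) => //; apply/eqP => S1; rewrite S1 in Pc.
have /cvgrPdist_lt /(_ _ (_ : 0 < 2^-1)) [|N _ /(_ N (leqnn N))] := Pc.
  by rewrite invr_gt0.
rewrite /= sub0r normrN => H.
have := poch_small N asmall.
have -> : pochhammer a N - 1 = - (1 - pochhammer a N) by ring.
rewrite normrN => H'; have := ler_normD (1 - pochhammer a N) (pochhammer a N).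
rewrite subrK normr1 => H2; suff : 1 < 1 :> K by rewrite ltxx.
apply: (le_lt_trans H2); have {2}-> : 1 = 2^-1 + 2^-1 :> K by field.
by rewrite ler_ltD.
Qed.

Lemma poch_cvg_ex a : exists2 l, pochhammer a @ \oo --> l &
  ((forall n, a * q ^+ n != 1) -> l != 0).
Proof.
have [N /poch_cvg_small[l hl l0]] := eventually_small a.
exists (pochhammer a N * l).
  rewrite -(cvg_shiftn N).
  apply: (cvg_trans _ (cvgM (@cvg_cst _ (pochhammer a N : K) _ _ _) hl)).
  by apply: near_eq_cvg; apply: nearW => n; rewrite /= addnC pochD.
move=> an; rewrite mulf_neq0 //; apply/prodf_neq0 => j _.
by rewrite subr_eq0 eq_sym.
Qed.

Lemma poch_cvg a : pochhammer a @ \oo --> pochhammer_inf a.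
Proof.
have [l hl _] := poch_cvg_ex a.
by rewrite /pochhammer_inf (cvg_lim _ hl).
Qed.

Arguments poch_cvg a : clear implicits.

Lemma poch_inf_neq0 a : (forall n, a * q ^+ n != 1) -> pochhammer_inf a != 0.
Proof.
have [l hl h] := poch_cvg_ex a.
by rewrite /pochhammer_inf (cvg_lim _ hl).
Qed.

Lemma poch_infS a : pochhammer_inf a = (1 - a) * pochhammer_inf (a * q).
Proof.
apply: cvg_lim => //; rewrite -(cvg_shiftn 1).
apply: (cvg_trans _ (cvgM (@cvg_cst _ (1 - a : K) _ _ _) (poch_cvg (a * q)))).
apply: near_eq_cvg; apply: nearW => n; rewrite /= addn1 -add1n pochD.
by rewrite /pochhammer big_ord1 expr0 expr1 mulr1.
Qed.

Lemma poch_bounded a : bounded_family (pochhammer a).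
Proof. exact: cvg_bounded_family (poch_cvg a). Qed.

Lemma poch_inv_bounded a : (forall n, a * q ^+ n != 1) ->
  bounded_family (fun n => (pochhammer a n)^-1).
Proof.
move=> an; by have [B hB] := cvg_bounded_family (cvgV (poch_inf_neq0 an) (poch_cvg a)); exists B.
Qed.

(** [not_qpow] over an arbitrary field; the two agree at [R[i]]. *)
Definition avoids_qpowers (z : K) := forall m : int, z != q ^ m.

Lemma qpowz_neq0 (m : int) : q ^ m != 0. Proof. exact: expfz_neq0. Qed.

Lemma nonqpowerM z m : avoids_qpowers z -> avoids_qpowers (z * q ^ m).
Proof.
move=> h k; apply: contra_neq (h (k - m)) => E.
by rewrite expfzDr // -E -invr_expz mulfK // qpowz_neq0.
Qed.

Lemma nonqpowerV z : avoids_qpowers z -> avoids_qpowers z^-1.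
Proof.
by move=> h k; apply: contra_neq (h (- k)) => E; rewrite -invr_expz -E invrK.
Qed.

Lemma nonqpower_neq1 z : avoids_qpowers z -> z != 1.
Proof. by move=> /(_ 0); rewrite expr0z. Qed.

Lemma nonqpower_shift z m : avoids_qpowers z -> z * q ^ m != 1.
Proof. by move=> h; apply/nonqpower_neq1/nonqpowerM. Qed.

Lemma poch_inf_neq0_generic z : avoids_qpowers z -> pochhammer_inf z != 0.
Proof. by move=> h; apply: poch_inf_neq0 => n; exact: (nonqpower_shift n%:Z h). Qed.

Lemma norm_q_neq1 n : q ^+ n.+1 != 1.
Proof.
apply/eqP => E; have : `|q| ^+ n.+1 < 1 by rewrite exprn_ilt1.
by rewrite -normrX E normr1 ltxx.
Qed.

Lemma poch_inf_q_neq0 : pochhammer_inf q != 0.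
Proof. by apply: poch_inf_neq0 => n; rewrite -exprS norm_q_neq1. Qed.

End QPochhammer.

(** * Bilateral series along a q-orbit and the q-zeta function *)

Section Orbit.
Variables (K : numFieldType) (q : K).
Hypotheses (cK : summation_complete K) (q0 : q != 0) (q1 : `|q| < 1)
  (qX : q ^+ n @[n --> \oo] --> (0 : K)).
Local Notation nonqpower := (avoids_qpowers q).
Local Notation poch := (pochhammer q).
Local Notation poch_inf := (pochhammer_inf q).

Lemma orbit_neq0 A (k : int) : nonqpower A -> 1 - A * q ^ k != 0.
Proof. by move=> hA; rewrite subr_eq0 eq_sym; apply: nonqpower_shift. Qed.

Lemma inv_orbit_cvg A : (1 - A * q ^ n%:Z)^-1 @[n --> \oo] --> (1 : K).
Proof.
rewrite -[X in _ --> X]invr1; apply: cvgV; first exact: oner_neq0.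
rewrite -[X in _ --> X]subr0 -[X in _ --> _ - X](mulr0 A).
by apply: cvgB; [exact: cvg_cst | apply: cvgM => //; exact: cvg_cst].
Qed.

Lemma inv_orbit_cvgN A : A != 0 -> nonqpower A ->
  (1 - A * q ^ (- n%:Z))^-1 @[n --> \oo] --> (0 : K).
Proof.
move=> A0 hA.
have h : q ^+ n * (q ^+ n - A)^-1 @[n --> \oo] --> (0 : K).
  rewrite -(mul0r (0 - A)^-1); apply: cvgM => //.
  by apply: cvgV; [rewrite sub0r oppr_eq0 | apply: cvgB => //; exact: cvg_cst].
apply: cvg_trans h; apply: near_eq_cvg; apply: nearW => n.
rewrite -invr_expz -exprnP.
have n0 : q ^+ n != 0 by exact: expf_neq0.
have d0 : q ^+ n - A != 0 by rewrite subr_eq0 eq_sym; exact: (hA n%:Z).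
by field; rewrite n0 d0.
Qed.

Lemma inv_orbit_bounded A : A != 0 -> nonqpower A ->
  bounded_family (fun k : int => (1 - A * q ^ k)^-1).
Proof.
by move=> A0 hA; exact: cvg_bounded_int (@inv_orbit_cvg A) (inv_orbit_cvgN A0 hA).
Qed.

Lemma orbit_ratio_bounded A : A != 0 -> nonqpower A ->
  bounded_family (fun k : int => q ^ k / (1 - A * q ^ k)).
Proof.
move=> A0 hA.
have := bounded_familyM (bounded_family_cst int A^-1)
   (bounded_familyD (inv_orbit_bounded A0 hA) (bounded_family_cst int (-1))).
move=> [B hB]; exists B => k; rewrite (le_trans _ (hB k)) //.
suff -> : q ^ k / (1 - A * q ^ k) = A^-1 * ((1 - A * q ^ k)^-1 - 1) by [].
by have := orbit_neq0 k hA => d0; field; rewrite d0 A0.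
Qed.

Lemma norm_bounded_qabs : norm_bounded (fun t : int => q ^+ `|t|%N).
Proof.
have g := norm_bounded_geometric q1.
pose F1 (t : int) := if 0 <= t then q ^+ `|t|%N else 0.
pose F2 (t : int) := if 0 <= t then 0 else q ^+ `|t|%N.
have b1 : norm_bounded F1.
  have b : norm_bounded (F1 \o Posz) by [].
  apply: (iffLR (norm_bounded_inj _ _) b) => [n m []//|[n|n]]; first by exists n.
  by rewrite /F1 /= eqxx.
have b2 : norm_bounded F2.
  have b : norm_bounded (F2 \o Negz).
    by apply: (norm_bounded_le (B := `|q|)) g => n; rewrite /F2 /= exprS normrM.
  apply: (iffLR (norm_bounded_inj _ _) b) => [n m []//|[n|n]]; last by exists n.
  by rewrite /F2 /= eqxx.
have := norm_boundedD b1 b2; apply: (norm_bounded_le (B := 1)) => t.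
by rewrite mul1r /F1 /F2; case: ifP => _; rewrite ?addr0 ?add0r.
Qed.

(** For [k >= 0] the numerator decays; for [k < 0] each denominator absorbs one power [q^k], which
    leaves [q^|k|] times bounded factors. *)
Lemma orbit_summable A B : A != 0 -> B != 0 -> nonqpower A -> nonqpower B ->
  norm_bounded (fun k : int => q ^ k / ((1 - A * q ^ k) * (1 - B * q ^ k))).
Proof.
move=> A0 B0 hA hB.
have [C hC] := bounded_familyM (inv_orbit_bounded A0 hA) (inv_orbit_bounded B0 hB).
have [D hD] := bounded_familyM (orbit_ratio_bounded A0 hA) (orbit_ratio_bounded B0 hB).
have C0 : 0 <= C := le_trans (normr_ge0 _) (hC 0).
have D0 : 0 <= D := le_trans (normr_ge0 _) (hD 0).
apply: (norm_bounded_le (B := C + D)) norm_bounded_qabs => -[n|n].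
  rewrite normrM mulrC ler_wpM2r // invfM (le_trans (hC n)) // lerDl //.
have -> : q ^ Negz n / ((1 - A * q ^ Negz n) * (1 - B * q ^ Negz n))
   = (q ^ Negz n / (1 - A * q ^ Negz n)) * (q ^ Negz n / (1 - B * q ^ Negz n))
     * q ^+ `|Negz n|%N.
  have d0 := orbit_neq0 (Negz n) hA; have d1 := orbit_neq0 (Negz n) hB.
  have -> : q ^+ `|Negz n| = (q ^ Negz n)^-1 by rewrite invr_expz NegzE opprK.
  by field; rewrite d0 d1 qpowz_neq0.
by rewrite normrM ler_wpM2r // (le_trans (hD _)) // lerDr.
Qed.

(** Neither fraction alone is summable, since each tends to 1 as [k] goes to plus infinity; only the
    difference is. *)
Definition hterm A B (k : int) := (1 - A * q ^ k)^-1 - (1 - B * q ^ k)^-1.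

(* [xget 0] returns [0] on a non-summable family; [qzetaP] covers the cases that arise. *)
Definition qzeta A B : K := xget 0 [set S | has_sum (hterm A B) S].

Lemma hterm_bounded A B : A != 0 -> B != 0 -> nonqpower A -> nonqpower B ->
  norm_bounded (hterm A B).
Proof.
move=> A0 B0 hA hB; have := norm_boundedZ (A - B) (orbit_summable A0 B0 hA hB).
apply: (norm_bounded_le (B := 1)) => k; rewrite mul1r.
suff -> : hterm A B k = (A - B) * (q ^ k / ((1 - A * q ^ k) * (1 - B * q ^ k))) by [].
rewrite /hterm; have d0 := orbit_neq0 k hA; have d1 := orbit_neq0 k hB.
by field; rewrite d0 d1.
Qed.

Lemma qzetaP A B : A != 0 -> B != 0 -> nonqpower A -> nonqpower B ->
  has_sum (hterm A B) (qzeta A B).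
Proof.
move=> A0 B0 hA hB; have [S hS] := cK (hterm_bounded A0 B0 hA hB).
by rewrite /qzeta; case: xgetP => [S' _ //|/(_ S)].
Qed.

Lemma qzeta_shift1 A : A != 0 -> nonqpower A -> qzeta (A * q) A = 1.
Proof.
move=> A0 hA; have Aq0 : A * q != 0 by rewrite mulf_neq0.
have hAq : nonqpower (A * q) := nonqpowerM q0 1 hA.
apply: (has_sum_unique (qzetaP Aq0 A0 hAq hA)); rewrite -[1]subr0.
have E k : (1 - A * q ^ (k + 1))^-1 - (1 - A * q ^ k)^-1 = hterm (A * q) A k.
  by rewrite /hterm expfzDr // expr1z; congr (_^-1 - _); ring.
apply: (has_sum_ext E); apply: (has_sum_telescope cK (T := fun k => (1 - A * q ^ k)^-1)).
- rewrite (funext E); exact: hterm_bounded.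
- exact: inv_orbit_cvg.
- exact: inv_orbit_cvgN.
Qed.

Lemma qzetaD A B C : A != 0 -> B != 0 -> C != 0 ->
  nonqpower A -> nonqpower B -> nonqpower C -> qzeta A B + qzeta B C = qzeta A C.
Proof.
move=> A0 B0 C0 hA hB hC; apply: has_sum_unique (qzetaP A0 C0 hA hC).
apply: has_sum_ext (has_sumD (qzetaP A0 B0 hA hB) (qzetaP B0 C0 hB hC)) => k.
by rewrite /hterm; ring.
Qed.

(** Quasi-periodicity: one step from [A] to [A * q] telescopes, with limits 1 and 0 at the two ends,
    hence adds 1. *)
Lemma qzeta_shift A (m : int) : A != 0 -> nonqpower A -> qzeta (A * q ^ m) A = m%:~R.
Proof.
move=> A0 hA.
have Am0 k : A * q ^ k != 0 by rewrite mulf_neq0 // qpowz_neq0.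
have hAm k : nonqpower (A * q ^ k) by exact: nonqpowerM.
have S1 k : qzeta (A * q ^ (k + 1)) (A * q ^ k) = 1.
  by rewrite expfzDr // expr1z mulrA qzeta_shift1.
have S k : qzeta (A * q ^ (k + 1)) A = qzeta (A * q ^ k) A + 1.
  by rewrite -(qzetaD (Am0 (k + 1)) (Am0 k)) // S1 addrC.
have P0 : qzeta (A * q ^ 0) A = 0.
  rewrite expr0z mulr1; apply: (has_sum_unique (qzetaP A0 A0 hA hA)).
  by apply: has_sum_ext (@has_sum0 _ _) => k; rewrite /hterm subrr.
elim/int_rect: m => [|n IH|n IH]; first exact: P0.
  by rewrite -addn1 PoszD S IH intrD.
have := S (- n.+1%:Z); rewrite (_ : - n.+1%:Z + 1 = - n%:Z); last by lia.
rewrite IH => E; apply: (addIr 1); rewrite -E.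
by rewrite (_ : - n%:Z = - n.+1%:Z + 1) ?intrD //; lia.
Qed.

End Orbit.

(** * Partial fractions for theta quotients *)

Section ThetaPartialFractions.
Variables (K : numFieldType) (q : K).
Hypotheses (cK : summation_complete K) (q0 : q != 0) (q1 : `|q| < 1)
  (qX : q ^+ n @[n --> \oo] --> (0 : K)).
Local Notation nonqpower := (avoids_qpowers q).
Local Notation poch := (pochhammer q).
Local Notation poch_inf := (pochhammer_inf q).
Local Notation qzeta := (qzeta q).
Local Notation hterm := (hterm q).

(** The modified theta function, divided by [(q)_oo^2] so that [theta A / (1 - A)] tends to 1 at
    [A = 1]; its partial fractions then have the rational coefficients with [1 - A] replaced by
    [theta A]. *)
Definition theta (A : K) := poch_inf A * poch_inf (q / A) / poch_inf q ^+ 2.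

Lemma theta1 : theta 1 = 0.
Proof. by rewrite /theta (poch_infS cK q1 qX 1) subrr !mul0r. Qed.

Lemma thetaE A : A != 0 ->
  theta A = (1 - A) * poch_inf (q * A) * poch_inf (q / A) / poch_inf q ^+ 2.
Proof. by move=> A0; rewrite /theta (poch_infS cK q1 qX A) (mulrC A). Qed.

Lemma thetaV A : A != 0 -> theta A^-1 = - (A^-1 * theta A).
Proof.
move=> A0; rewrite !thetaE ?invr_eq0 // invrK.
by field; rewrite A0 (poch_inf_q_neq0 cK q1 qX).
Qed.

Lemma theta_neq0 A : nonqpower A -> theta A != 0.
Proof.
move=> hA; rewrite /theta !mulf_neq0 ?invr_eq0 ?expf_neq0 ?(poch_inf_q_neq0 cK q1 qX) //;
  apply: (poch_inf_neq0_generic cK q0 q1 qX) => //.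
rewrite mulrC; exact: (nonqpowerM q0 1 (nonqpowerV hA)).
Qed.

(* The monomials split off the factors with negative exponent; by the balancing
   condition they cancel in all quotients below. *)
Definition gauss M := \prod_(m < M) (- (q ^+ m.+1)^-1).

Lemma gauss_neq0 M : gauss M != 0.
Proof. by apply/prodf_neq0 => m _; rewrite oppr_eq0 invr_eq0 expf_neq0. Qed.

Lemma prod_shift (f : int -> K) L M : (M <= L)%N ->
  \prod_(j < L) f (j%:Z - M%:Z)
  = (\prod_(m < M) f (- m.+1%:Z)) * \prod_(j < L - M) f j%:Z.
Proof.
move=> ML; rewrite -(subnKC ML) addKn big_split_ord; congr (_ * _).
  rewrite (reindex_inj rev_ord_inj); apply: eq_bigr => m _ /=.
  by congr (f _); have := ltn_ord m; lia.
by apply: eq_bigr => j _ /=; congr (f _); lia.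
Qed.

Lemma prod_neg A M : A != 0 ->
  \prod_(m < M) (1 - A * q ^ (- m.+1%:Z)) = poch (q / A) M * (A ^+ M * gauss M).
Proof.
move=> A0; rewrite -[in A ^+ M](card_ord M) -prodr_const /poch /gauss -!big_split.
apply: eq_bigr => m _ /=; rewrite -invr_expz -exprnP exprS.
have m0 : q ^+ m != 0 by exact: expf_neq0.
by field; rewrite A0 m0 q0.
Qed.

(** The window of exponents from [- M] to [L - M - 1] is cut at 0: what results is a truncated theta
    product times a monomial in [A]. *)
Lemma prod_theta A L M : A != 0 -> (M <= L)%N ->
  \prod_(j < L) (1 - A * q ^ (j%:Z - M%:Z))
  = poch A (L - M) * poch (q / A) M * (A ^+ M * gauss M).
Proof.
move=> A0 ML; rewrite (prod_shift (fun k => 1 - A * q ^ k) ML) prod_neg //.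
by rewrite mulrC mulrA.
Qed.

Lemma prod_theta1 L (M : 'I_L) :
  \prod_(j < L | j != M) (1 - q ^ (j%:Z - M%:Z))
  = poch q (L - M.+1) * poch q M * gauss M.
Proof.
rewrite big_mkcond.
pose f (k : int) := if k == 0 then 1 else 1 - q ^ k.
rewrite (eq_bigr (fun j : 'I_L => f (j%:Z - M%:Z))) => [|j _]; last first.
  by rewrite /f subr_eq0 eqz_nat -val_eqE; case: eqP.
rewrite (prod_shift f (ltnW (ltn_ord M))) -(subnSK (ltn_ord M)) big_ord_recl /=.
have -> : \prod_(m < M) f (- m.+1%:Z) = poch q M * gauss M.
  have := prod_neg M (oner_neq0 K); rewrite divr1 expr1n mul1r => <-.
  by apply: eq_bigr => m _; rewrite /f mul1r.
rewrite /f /= mul1r mulrC mulrA; congr (_ * _ * _).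
by apply: eq_bigr => j _; rewrite /= -exprS.
Qed.

Lemma qpow_eq1 (m : int) : q ^ m = 1 -> m = 0.
Proof.
case: m => [[//|n]|n] E.
  by have := norm_q_neq1 q1 n; rewrite exprnP E eqxx.
by have := norm_q_neq1 q1 n; rewrite -invr_eq1 -[(q ^+ _)^-1]/(q ^ Negz n) E eqxx.
Qed.

Lemma qpow_inj (m n : int) : q ^ m = q ^ n -> m = n.
Proof.
move=> E; apply/eqP; rewrite -subr_eq0; apply/eqP/qpow_eq1.
by rewrite expfzDr // E -invr_expz divff // qpowz_neq0.
Qed.

Section Finite.
Variables (n : nat) (x b : 'I_n -> K).
Hypotheses (x0 : forall i, x i != 0) (b0 : forall i, b i != 0)
  (bx : \prod_i b i = \prod_i x i)
  (gx : forall i j, i != j -> nonqpower (x i / x j)).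

Definition ftheta A l m := poch A l * poch (q / A) m.

(** Coefficient belonging to the node [x i * q ^ (j - N)], for [m = j], [l = N.*2 - j], and
    [l' = l - 1] because the factor that vanishes there is left out. The lengths are separate
    arguments, so that bounds and limits can be taken in each of them. *)
Definition fcoef_theta i l l' m :=
  \prod_j ftheta (b j / x i) l m
  / (\prod_(k | k != i) ftheta (x k / x i) l m * (poch q l' * poch q m)).

Definition fquot N t := \prod_j ftheta (b j * t) N N / \prod_i ftheta (x i * t) N N.

Lemma monomials_eq t M : t != 0 ->
  \prod_j ((b j * t) ^+ M * gauss M) = \prod_i ((x i * t) ^+ M * gauss M).
Proof. by move=> t0; rewrite !big_split !prodrXl !big_split /= bx. Qed.

Lemma ftheta_neq0 A l m : nonqpower A -> ftheta A l m != 0.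
Proof.
move=> hA; rewrite mulf_neq0 //; apply/prodf_neq0 => j _; rewrite subr_eq0 eq_sym.
  exact: (nonqpower_shift q0 j%:Z hA).
have := nonqpower_shift q0 j.+1%:Z (nonqpowerV hA).
by rewrite -exprnP exprS mulrA (mulrC q).
Qed.

(** Rational partial fractions with the nodes [x i * q ^ k], [- N <= k < N]. The monomials split off
    from numerator and denominator cancel by [bx]. *)
Lemma finite_theta_pf N t t0 : t != 0 -> t0 != 0 ->
  (forall i, nonqpower (x i * t)) -> (forall i, nonqpower (x i * t0)) ->
  fquot N t - fquot N t0 =
  \sum_i \sum_(j < N.*2) fcoef_theta i (N.*2 - j) (N.*2 - j.+1) j
     * hterm (x i * t) (x i * t0) (j%:Z - N%:Z).
Proof.
move=> t_neq0 t0_neq0 gt gt0.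
pose d (p : 'I_n * 'I_N.*2) := x p.1 * q ^ (p.2%:Z - N%:Z).
pose e (p : 'I_n * 'I_N.*2) := b p.1 * q ^ (p.2%:Z - N%:Z).
have d0 p : d p != 0 by rewrite mulf_neq0 // qpowz_neq0.
have dI : injective d.
  move=> [i j] [k l]; rewrite /d /= => E.
  have [ik|/gx/(_ (l%:Z - N%:Z - (j%:Z - N%:Z)))/eqP[]] := eqVneq i k.
    rewrite ik in E *; move/(mulfI (x0 k))/qpow_inj/addIr: E => [] E.
    by congr (_, _); exact: val_inj.
  have k0 := x0 k; have qn0 := qpowz_neq0 q0 (j%:Z - N%:Z).
  rewrite expfzDr // -(invr_expz q (j%:Z - N%:Z)).
  apply: (mulIf qn0); rewrite divfK //; apply: (mulIf k0).
  by rewrite mulrAC divfK // E mulrC.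
have dt u p : (forall i, nonqpower (x i * u)) -> d p * u != 1.
  by move=> gu; rewrite /d mulrAC; exact: nonqpower_shift.
have pq (f : 'I_n -> K) u : u != 0 -> (forall i, f i != 0) ->
   \prod_(p : 'I_n * 'I_N.*2) (1 - f p.1 * q ^ (p.2%:Z - N%:Z) * u)
   = \prod_i ftheta (f i * u) N N * \prod_i ((f i * u) ^+ N * gauss N).
  move=> u0 f0.
  rewrite -(pair_bigA _ (fun i (j : 'I_N.*2) => 1 - f i * q ^ (j%:Z - N%:Z) * u)) -big_split.
  apply: eq_bigr => i _ /=.
  have fu0 : f i * u != 0 by rewrite mulf_neq0.
  have := prod_theta fu0 (_ : (N <= N.*2)%N); rewrite -addnn addnK leq_addl => /(_ isT) <-.
  by apply: eq_bigr => j _; rewrite mulrAC.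
have fq u : u != 0 -> (forall i, nonqpower (x i * u)) ->
    \prod_p (1 - e p * u) / \prod_p (1 - d p * u) = fquot N u.
  move=> u0 gu; rewrite /d /e !pq // monomials_eq // /fquot.
  have m0 : \prod_i ((x i * u) ^+ N * gauss N) != 0.
    by apply/prodf_neq0 => i _; rewrite mulf_neq0 ?gauss_neq0 // expf_neq0 // mulf_neq0.
  have f0 : \prod_i ftheta (x i * u) N N != 0.
    by apply/prodf_neq0 => i _; exact: ftheta_neq0.
  by field; rewrite m0 f0.
rewrite -!fq // (partial_fractions e (erefl _) dI d0 (fun p => dt t p gt)).
rewrite (partial_fractions e (erefl _) dI d0 (fun p => dt t0 p gt0)).
rewrite opprD addrACA subrr add0r -sumrB.
rewrite (pair_bigA _ (fun i (j : 'I_N.*2) => fcoef_theta i (N.*2 - j) (N.*2 - j.+1) j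
     * hterm (x i * t) (x i * t0) (j%:Z - N%:Z))) /=.
apply: eq_bigr => -[i j] _; rewrite -mulrBr /=.
congr (_ * _); last by rewrite /hterm /d /= !(mulrAC (x i) t) !(mulrAC (x i) t0); ring.
have jN : (j <= N.*2)%N by exact: ltnW.
have qq (l : 'I_N.*2) : q ^ (l%:Z - N%:Z) / q ^ (j%:Z - N%:Z) = q ^ (l%:Z - j%:Z).
  by rewrite invr_expz -expfzDr //; congr (q ^ _); lia.
have ratio (f : 'I_n -> K) (p : 'I_n * 'I_N.*2) : f p.1 * q ^ (p.2%:Z - N%:Z) / d (i, j)
    = f p.1 / x i * q ^ (p.2%:Z - j%:Z).
  by rewrite /d /= invfM mulrACA qq.
have numE : \prod_p (1 - e p / d (i, j))
   = \prod_k ftheta (b k / x i) (N.*2 - j) j * \prod_k ((b k / x i) ^+ j * gauss j).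
  rewrite (eq_bigr (fun p : 'I_n * 'I_N.*2 => 1 - b p.1 / x i * q ^ (p.2%:Z - j%:Z))) => [|p _].
    rewrite -(pair_bigA _ (fun k (l : 'I_N.*2) => 1 - b k / x i * q ^ (l%:Z - j%:Z))) -big_split.
    by apply: eq_bigr => k _; rewrite /= prod_theta // mulf_neq0 ?invr_eq0.
  by rewrite /e ratio.
have denE : \prod_(p | p != (i, j)) (1 - d p / d (i, j))
   = \prod_(k | k != i) ftheta (x k / x i) (N.*2 - j) j * (poch q (N.*2 - j.+1) * poch q j)
     * \prod_k ((x k / x i) ^+ j * gauss j).
  rewrite big_mkcond (eq_bigr (fun p : 'I_n * 'I_N.*2 => if (p.1, p.2) != (i, j)
      then 1 - x p.1 / x i * q ^ (p.2%:Z - j%:Z) else 1)) => [|[k l] _]; last first.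
    by rewrite {1}/d ratio.
  rewrite -(pair_bigA _ (fun k (l : 'I_N.*2) => if (k, l) != (i, j)
      then 1 - x k / x i * q ^ (l%:Z - j%:Z) else 1)) (bigD1 i) //=.
  have -> : \prod_l (if (i, l) != (i, j) then 1 - x i / x i * q ^ (l%:Z - j%:Z) else 1)
      = poch q (N.*2 - j.+1) * poch q j * gauss j.
    rewrite -prod_theta1 [RHS]big_mkcond; apply: eq_bigr => l _.
    by rewrite xpair_eqE eqxx divff // mul1r.
  have -> : \prod_(k | k != i) \prod_l (if (k, l) != (i, j)
        then 1 - x k / x i * q ^ (l%:Z - j%:Z) else 1)
      = \prod_(k | k != i) (ftheta (x k / x i) (N.*2 - j) j * ((x k / x i) ^+ j * gauss j)).
    apply: eq_bigr => k ki; rewrite -prod_theta // ?mulf_neq0 ?invr_eq0 //.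
    by apply: eq_bigr => l _; rewrite xpair_eqE (negPf ki).
  rewrite big_split [X in _ = _ * X](bigD1 i) //= divff // expr1n mul1r.
  ring.
rewrite numE denE /fcoef_theta (monomials_eq (t := (x i)^-1)) ?invr_eq0 //.
have m0 : \prod_k ((x k / x i) ^+ j * gauss j) != 0.
  by apply/prodf_neq0 => k _; rewrite mulf_neq0 ?gauss_neq0 // expf_neq0 // mulf_neq0 ?invr_eq0.
have f0 : \prod_(k | k != i) ftheta (x k / x i) (N.*2 - j) j != 0.
  by apply/prodf_neq0 => k ki; apply/ftheta_neq0/gx.
have p0 l : poch q l != 0.
  by apply/prodf_neq0 => l' _; rewrite subr_eq0 eq_sym -exprS norm_q_neq1.
by field; rewrite m0 f0 !p0.
Qed.

Lemma poch_cvg_comp A (s : nat -> nat) :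
  (forall N0, \forall N \near \oo, (N0 <= s N)%N) ->
  poch A (s N) @[N --> \oo] --> poch_inf A.
Proof.
move=> hs; apply: (cvg_comp s (poch A) (G := \oo)); last exact: poch_cvg.
move=> P [N0 _ hN0]; apply: filterS (hs N0) => N; exact: hN0.
Qed.

Lemma ftheta_cvg A (s s' : nat -> nat) :
  (forall N0, \forall N \near \oo, (N0 <= s N)%N) ->
  (forall N0, \forall N \near \oo, (N0 <= s' N)%N) ->
  ftheta A (s N) (s' N) @[N --> \oo] --> poch_inf A * poch_inf (q / A).
Proof. by move=> hs hs'; apply: cvgM; exact: poch_cvg_comp. Qed.

Lemma inf_theta_neq0 A : nonqpower A -> poch_inf A * poch_inf (q / A) != 0.
Proof.
by move/theta_neq0; apply: contra_neq => E; rewrite /theta E mul0r.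
Qed.

Lemma fquot_cvg t : t != 0 -> (forall i, nonqpower (x i * t)) ->
  fquot N t @[N --> \oo] --> \prod_j theta (b j * t) / \prod_i theta (x i * t).
Proof.
move=> t0 gt.
have id_near N0 : \forall N \near \oo, (N0 <= N)%N by exists N0.
have E0 : poch_inf q ^+ 2 != 0 by rewrite expf_neq0 // (poch_inf_q_neq0 cK q1 qX).
have -> : \prod_j theta (b j * t) / \prod_i theta (x i * t)
   = \prod_j (poch_inf (b j * t) * poch_inf (q / (b j * t)))
     / \prod_j (poch_inf (x j * t) * poch_inf (q / (x j * t))).
  rewrite /theta !big_split /=.
  set E := \prod_(i < n) (poch_inf q ^+ 2)^-1.
  have E1 : E != 0 by apply/prodf_neq0 => i _; rewrite invr_eq0.
  have gi i := inf_theta_neq0 (gt i).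
  have X0 : \prod_i poch_inf (x i * t) != 0.
    by apply/prodf_neq0 => i _; have := gi i; rewrite mulf_eq0 negb_or => /andP[].
  have Y0 : \prod_i poch_inf (q / (x i * t)) != 0.
    by apply/prodf_neq0 => i _; have := gi i; rewrite mulf_eq0 negb_or => /andP[].
  by field; rewrite E1 X0 Y0.
apply: cvgM.
  by apply: (cvg_big (@mul_continuous K)) => j _; exact: ftheta_cvg.
apply: cvgV; first by apply/prodf_neq0 => i _; exact: inf_theta_neq0.
by apply: (cvg_big (@mul_continuous K)) => j _; exact: ftheta_cvg.
Qed.

Definition residue i := \prod_j theta (b j / x i) / \prod_(k | k != i) theta (x k / x i).

Lemma fcoef_cvg i (s s1 s2 : nat -> nat) :
  (forall N0, \forall N \near \oo, (N0 <= s N)%N) ->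
  (forall N0, \forall N \near \oo, (N0 <= s1 N)%N) ->
  (forall N0, \forall N \near \oo, (N0 <= s2 N)%N) ->
  fcoef_theta i (s N) (s1 N) (s2 N) @[N --> \oo] --> residue i.
Proof.
move=> hs hs1 hs2.
have E0 : poch_inf q != 0 by exact: (poch_inf_q_neq0 cK q1 qX).
have gk k : k != i -> poch_inf (x k / x i) * poch_inf (q / (x k / x i)) != 0.
  by move=> ki; apply/inf_theta_neq0/gx.
have -> : residue i = \prod_j (poch_inf (b j / x i) * poch_inf (q / (b j / x i)))
     / (\prod_(k | k != i) (poch_inf (x k / x i) * poch_inf (q / (x k / x i)))
        * (poch_inf q * poch_inf q)).
  rewrite /residue /theta.
  rewrite (eq_bigr (fun j => poch_inf (b j / x i) * poch_inf (q / (b j / x i))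
      * (poch_inf q ^+ 2)^-1)) // big_split /=.
  rewrite (bigD1 i (F := fun _ => (poch_inf q ^+ 2)^-1)) //=.
  rewrite [X in _ / X = _]big_split /=.
  set E := \prod_(k | k != i) (poch_inf q ^+ 2)^-1.
  have E1 : E != 0 by apply/prodf_neq0 => k _; rewrite invr_eq0 expf_neq0.
  set D := \prod_(k | k != i) _.
  have D0 : D != 0 by apply/prodf_neq0 => k ki; exact: gk.
  by field; rewrite E1 D0 E0.
apply: cvgM.
  by apply: (cvg_big (@mul_continuous K)) => j _; exact: ftheta_cvg.
apply: cvgV.
  by rewrite !mulf_neq0 //; apply/prodf_neq0 => k ki; exact: gk.
apply: cvgM; last by apply: cvgM; exact: poch_cvg_comp.
by apply: (cvg_big (@mul_continuous K)) => k ki; exact: ftheta_cvg.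
Qed.

(** A bound uniform in all truncation lengths: this is the domination that [tannery] asks for, as
    the lengths vary with the node. *)
Lemma fcoef_bounded i :
  bounded_family (fun p : nat * nat * nat => fcoef_theta i p.1.1 p.1.2 p.2).
Proof.
have pb A := poch_bounded cK q1 qX A.
have pib A (h : nonqpower A) := poch_inv_bounded cK q1 qX
  (fun j => nonqpower_shift q0 j%:Z h).
have pibq A (h : nonqpower A) : bounded_family (fun n => (poch (q / A) n)^-1).
  by apply: pib; rewrite mulrC; exact: (nonqpowerM q0 1 (nonqpowerV h)).
have pq : bounded_family (fun n => (poch q n)^-1).
  by apply: (poch_inv_bounded cK q1 qX) => j; rewrite -exprS norm_q_neq1.
have bn : bounded_family (fun p : nat * nat * nat => \prod_j ftheta (b j / x i) p.1.1 p.2).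
  apply: bounded_family_prod => j _; apply: bounded_familyM.
    exact: (bounded_family_comp (fun p : nat * nat * nat => p.1.1) (pb _)).
  exact: (bounded_family_comp (fun p : nat * nat * nat => p.2) (pb _)).
have bd : bounded_family (fun p : nat * nat * nat =>
    \prod_(k | k != i) (ftheta (x k / x i) p.1.1 p.2)^-1).
  apply: bounded_family_prod => k ki.
  have g := gx ki.
  have [B hB] := bounded_familyM (bounded_family_comp (fun p : nat * nat * nat => p.1.1) (pib _ g))
    (bounded_family_comp (fun p : nat * nat * nat => p.2) (pibq _ g)).
  by exists B => p; rewrite /ftheta invfM; exact: hB.
have be : bounded_family (fun p : nat * nat * nat => (poch q p.1.2)^-1 * (poch q p.2)^-1).
  apply: bounded_familyM.
    exact: (bounded_family_comp (fun p : nat * nat * nat => p.1.2) pq).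
  exact: (bounded_family_comp (fun p : nat * nat * nat => p.2) pq).
have [B hB] := bounded_familyM bn (bounded_familyM bd be).
by exists B => p; rewrite /fcoef_theta !invfM -prodfV; exact: hB.
Qed.

(** The limit of [finite_theta_pf]. At a fixed node all truncation lengths grow, so the coefficients
    tend to [residue i], the same along the whole q-orbit: balancing has removed the monomials,
    which would depend on the node. *)
Lemma theta_pf t t0 : t != 0 -> t0 != 0 ->
  (forall i, nonqpower (x i * t)) -> (forall i, nonqpower (x i * t0)) ->
  \prod_j theta (b j * t) / \prod_i theta (x i * t)
  - \prod_j theta (b j * t0) / \prod_i theta (x i * t0)
  = \sum_i residue i * qzeta (x i * t) (x i * t0).
Proof.
move=> t_neq0 t0_neq0 gt gt0.
pose A N : seq int := [seq j%:Z - N%:Z | j <- iota 0 N.*2].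
have uA N : uniq (A N) by rewrite map_inj_uniq ?iota_uniq // => i j /addIr [].
have nA k : \forall N \near \oo, k \in A N.
  exists `|k|.+1%N => // N /= kN; apply/mapP.
  by exists (`|(k + N%:Z)%R|%N); [rewrite mem_iota; lia | lia].
have L1 : fquot N t - fquot N t0 @[N --> \oo] -->
    \prod_j theta (b j * t) / \prod_i theta (x i * t)
    - \prod_j theta (b j * t0) / \prod_i theta (x i * t0).
  by apply: cvgB; exact: fquot_cvg.
apply: (cvg_unique _ L1) => //.
(* For [k] in [A N], [k + N] recovers the position [j] of the node in the window. *)
pose rr i N (k : int) :=
  fcoef_theta i (N.*2 - `|(k + N%:Z)%R|) (N.*2 - `|(k + N%:Z)%R|.+1) `|(k + N%:Z)%R|.
have L2 : \sum_i \sum_(k <- A N) rr i N k * hterm (x i * t) (x i * t0) k @[N --> \oo]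
    --> \sum_i residue i * qzeta (x i * t) (x i * t0).
  apply: (cvg_big (@add_continuous K)) => i _.
  have xt0 : x i * t != 0 by rewrite mulf_neq0.
  have xt1 : x i * t0 != 0 by rewrite mulf_neq0.
  have [B hB] := fcoef_bounded i.
  apply: (tannery cK (B := B) _ _ uA nA) => [||N k _|k].
  - exact: hterm_bounded.
  - exact: qzetaP.
  - exact: (hB (N.*2 - `|(k + N%:Z)%R|, N.*2 - `|(k + N%:Z)%R|.+1, `|(k + N%:Z)%R|)%N).
  - apply: fcoef_cvg => N0; exists (N0 + `|k|).+1 => // N /= H; lia.
apply: (cvg_trans _ L2); apply: near_eq_cvg; apply: nearW => N.
rewrite (finite_theta_pf N t_neq0 t0_neq0 gt gt0); apply: eq_bigr => i _.
rewrite big_map -[in iota 0 _](subn0 N.*2) -/(index_iota 0 N.*2) big_mkord.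
apply: eq_bigr => j _; rewrite /rr.
by have -> : `|(j%:Z - N%:Z + N%:Z)%R|%N = j by lia.
Qed.

End Finite.

Lemma theta_has_partial_fractions : has_partial_fractions theta nonqpower qzeta.
Proof. by move=> n x b t t0 x0 b0 bx gx; exact: theta_pf. Qed.

End ThetaPartialFractions.

(** * The two lattice sums *)

Section DeterminantColumns.
Variables (F : fieldType) (r : nat).

(** Adding multiples of the column of ones is right multiplication by the unitriangular matrix
    [U]. *)
Lemma det_add_ones (H : 'I_r.+1 -> 'I_r.+1 -> F) (c : 'I_r.+1 -> F) :
  \det (\matrix_(i, j) if j == ord0 then 1 else H i j + c j)
  = \det (\matrix_(i, j) if j == ord0 then 1 else H i j).
Proof.
pose U : 'M[F]_r.+1 := \matrix_(i, j) ((i == j)%:R + ((i == ord0) && (j != ord0))%:R * c j).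
have trU : is_trig_mx U^T.
  apply/is_trig_mxP => i j ij; rewrite !mxE.
  rewrite (_ : (j == i) = false); last by apply/negP => /eqP ji; rewrite ji ltnn in ij.
  rewrite (_ : (j == ord0) = false); last by apply/negP => /eqP ji; rewrite ji in ij.
  by rewrite mul0r addr0.
have detU : \det U = 1.
  rewrite -det_tr det_trig // big1 // => i _; rewrite !mxE eqxx.
  by case: eqP => //= _; rewrite mul0r addr0.
rewrite -[RHS]mulr1 -[X in _ = _ * X]detU -det_mulmx; congr (\det _); apply/matrixP => i j.
rewrite !mxE (bigD1 ord0) //= !mxE eqxx /= mul1r.
have [->|j0] := eqVneq j ord0.
  rewrite /= mul0r addr0 big1 ?addr0 // => k k0.
  by rewrite !mxE (negPf k0) /= mul0r addr0 mulr0.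
rewrite /= ?(negPf j0). rewrite add0r mul1r (bigD1 j) //= !mxE (negPf j0) eqxx /= mul0r addr0 mulr1.
rewrite big1 ?addr0 1?addrC // => k /andP[k0 kj].
by rewrite !mxE (negPf kj) (negPf k0) /= mul0r addr0 mulr0.
Qed.

Lemma det_scale_rows (M : 'M[F]_r.+1) (a : 'I_r.+1 -> F) :
  \det (\matrix_(i, j) (a i * M i j)) = \prod_i a i * \det M.
Proof.
have -> : \matrix_(i, j) (a i * M i j) = diag_mx (\row_i a i) *m M.
  by apply/matrixP => i j; rewrite mul_diag_mx !mxE.
by rewrite det_mulmx det_diag; congr (_ * _); apply: eq_bigr => i _; rewrite mxE.
Qed.

(** Cramer's rule: in the expansion along column [m], the adjugate identity keeps only the
    coefficient of the column that was replaced. *)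
Lemma det_replace_col (M N : 'M[F]_r.+1) (m : 'I_r.+1) (c : 'I_r.+1 -> F) :
  (forall i j, j != m -> N i j = M i j) ->
  (forall i, N i m = \sum_j c j * M i j) -> \det N = c m * \det M.
Proof.
move=> NM Nm; rewrite (expand_det_col _ m).
transitivity (\sum_i \sum_j c j * (cofactor M i m * M i j)).
  apply: eq_bigr => i _; rewrite Nm mulr_suml; apply: eq_bigr => j _.
  rewrite -mulrA [M i j * _]mulrC; congr (_ * (_ * _)).
  congr (_ * \det _); apply/matrixP => k l; rewrite !mxE NM //.
  by rewrite eq_sym neq_lift.
rewrite exchange_big /= (bigD1 m) //= [X in _ + X]big1 => [|j jm].
  rewrite addr0 -mulr_sumr; congr (_ * _).
  have := mul_adj_mx M => /matrixP /(_ m m); rewrite !mxE eqxx mulr1n => <-.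
  by apply: eq_bigr => i _; rewrite mxE.
rewrite -mulr_sumr; apply/eqP; rewrite mulf_eq0; apply/orP; right; apply/eqP.
have := mul_adj_mx M => /matrixP /(_ m j); rewrite !mxE eq_sym (negPf jm) mulr0n => E; rewrite -[RHS]E.
by apply: eq_bigr => i _; rewrite mxE.
Qed.

End DeterminantColumns.

Lemma cvg_seq_eq (K : numFieldType) (u v : nat -> K) (l l' : K) :
  u @ \oo --> l -> l = l' -> u =1 v -> v @ \oo --> l'.
Proof. by move=> h <- /funext <-. Qed.

Section Rows.
Variables (K : numFieldType) (q : K).
Hypotheses (cK : summation_complete K) (q0 : q != 0) (q1 : `|q| < 1)
  (qX : q ^+ n @[n --> \oo] --> (0 : K)).
Local Notation nonqpower := (avoids_qpowers q).
Local Notation poch_inf := (pochhammer_inf q).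
Local Notation qzeta := (qzeta q).
Local Notation hterm := (hterm q).
Local Notation theta := (theta q).
Local Notation vdm := (altprod (fun u v => u - v)).

(** The zero-sum vector of [k] has [-|k|] at index 0, whereas [y_0] carries [q^|k|]; a sign per row
    reconciles the two. *)
Definition flip (b : bool) (t : int) : int := if b then - t else t.

Lemma flip_inj b : injective (flip b).
Proof. by case: b => // s t /oppr_inj. Qed.

Lemma flipK b : involutive (flip b).
Proof. by case: b => // t; rewrite /flip opprK. Qed.

Lemma has_sum_flip (F : int -> K) S b : has_sum F S -> has_sum (F \o flip b) S.
Proof.
by move=> h; apply/(has_sum_inj (@flip_inj b)) => // t _; exists (flip b t); rewrite flipK.
Qed.

Lemma norm_bounded_flip (F : int -> K) b : norm_bounded F -> norm_bounded (F \o flip b).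
Proof. by move=> h; apply: norm_bounded_comp => //; exact: flip_inj. Qed.

(** * The case n = l *)

Section Diagonal.
Variables (r : nat) (X W : 'I_r.+1 -> K) (eps : 'I_r.+1 -> bool) (s : 'I_r.+1 -> int).
Hypotheses (X0 : forall i, X i != 0) (W0 : forall i, W i != 0)
  (gX : forall i j, i != j -> nonqpower (X i / X j))
  (gXW : forall i j, nonqpower (X i * W j)).

Let w j := W j * q ^ s j.
Let y (v : {ffun 'I_r.+1 -> int}) i := X i * q ^ flip (eps i) (v i).

(* Since [(1 - \prod y \prod w) * vdm y * vdm w / \prod (1 - y i * w j)] is a
   determinant with a column of ones, its sum over the lattice is the determinant
   of the sums. *)
Definition cauchy_term v : K :=
  (1 - \prod_i y v i * \prod_j w j) * vdm (y v) * vdm w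
  / \prod_i \prod_j (1 - y v i * w j).

Let u (i j : 'I_r.+1) t :=
  if j == ord0 then 1 else hterm (X i * w j) (X i * w ord0) (flip (eps i) t).

Let w0 j : w j != 0. Proof. by rewrite mulf_neq0 // qpowz_neq0. Qed.
Let Xw0 i j : X i * w j != 0. Proof. by rewrite mulf_neq0. Qed.
Let gXw i j : nonqpower (X i * w j).
Proof. by rewrite /w mulrA; exact: nonqpowerM. Qed.

Lemma cauchy_termE v : cauchy_term v = det_at u v.
Proof.
rewrite /cauchy_term -det_diffmx_rational //.
- congr (\det _); apply/matrixP => i j; rewrite !mxE /u; case: ifP => // _.
  by rewrite /hterm /y !(mulrAC (X i) (q ^ _)).
- by move=> i; rewrite mulf_neq0 // qpowz_neq0.
- move=> i j ij; apply/eqP => E.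
  have := gX ij (flip (eps j) (v j) - flip (eps i) (v i)).
  rewrite expfzDr // -invr_expz => /eqP; apply.
  have a0 := qpowz_neq0 q0 (flip (eps i) (v i)); have j0 := X0 j.
  apply: (mulIf a0); rewrite divfK //; apply: (mulIf j0).
  by rewrite mulrAC divfK // [LHS]E mulrC.
- by move=> i j; rewrite /y mulrAC; exact: nonqpower_shift.
Qed.

Let u_bounded i t : `|u i ord0 t| <= 1.
Proof. by rewrite /u eqxx normr1. Qed.

Let u_summable i j : j != ord0 -> norm_bounded (u i j).
Proof.
move=> /negPf j0; rewrite /u j0.
have := hterm_bounded q0 q1 qX (Xw0 i j) (Xw0 i ord0) (gXw i j) (gXw i ord0).
exact: norm_bounded_flip.
Qed.

Lemma cauchy_term_bounded : norm_bounded (cauchy_term \o extend ord0).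
Proof.
rewrite (_ : _ \o _ = det_at u \o extend ord0).
  exact: (det_at_bounded u_bounded u_summable).
by apply/funext => k; rewrite /= cauchy_termE.
Qed.

Lemma cauchy_term_sum : has_sum (cauchy_term \o extend ord0)
  (theta (\prod_i X i * \prod_j W j) * altprod (skew theta) X * altprod (skew theta) W
   / \prod_i \prod_j theta (X i * W j)).
Proof.
rewrite -(det_diffmx (generic := nonqpower) (h := qzeta)) //; last 4 first.
- exact: theta1.
- exact: thetaV.
- exact: theta_neq0.
- exact: theta_has_partial_fractions.
(* By quasi-periodicity column [j] changes by [s j - s ord0], independently of the row, so the
   shifts [s] do not affect the determinant. *)
have E : \det (diffmx qzeta X W) = \det (\matrix_(k, j)
    if j == ord0 then 1 else qzeta (X k * w j) (X k * w ord0)).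
  rewrite -(det_add_ones _ (fun j => (s j)%:~R - (s ord0)%:~R)); congr (\det _).
  apply/matrixP => i j; rewrite !mxE; case: ifP => // _.
  have XW0 k : X i * W k != 0 by rewrite mulf_neq0.
  have sh k : qzeta (X i * w k) (X i * W k) = (s k)%:~R.
    by rewrite /w mulrA (qzeta_shift cK).
  have D := qzetaD cK q0 q1 qX.
  rewrite -(D _ _ _ (Xw0 i j) (XW0 j) (Xw0 i ord0) (gXw i j) (gXW i j) (gXw i ord0)).
  rewrite -(D _ _ _ (XW0 j) (XW0 ord0) (Xw0 i ord0) (gXW i j) (gXW i ord0) (gXw i ord0)).
  have := D _ _ _ (XW0 ord0) (Xw0 i ord0) (XW0 ord0) (gXW i ord0) (gXw i ord0) (gXW i ord0).
  have -> : qzeta (X i * W ord0) (X i * W ord0) = 0.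
    apply/(addIr (qzeta (X i * W ord0) (X i * W ord0))).
    by rewrite D // add0r.
  rewrite !sh => /eqP; rewrite addr_eq0 => /eqP ->; ring.
rewrite E; apply: (has_sum_ext (F := det_at u \o extend ord0)).
  by move=> k; rewrite /= cauchy_termE.
apply: (has_sum_det_col1 cK u_summable) => [k t|k j /negPf j0].
  by rewrite /u eqxx.
rewrite /u j0; apply: (has_sum_flip (eps k)).
exact: qzetaP.
Qed.

End Diagonal.

(** * Quotients of shifted factorials along a q-orbit *)

Lemma poch_inf_step A (m : int) :
  poch_inf (A * q ^ m) = (1 - A * q ^ m) * poch_inf (A * q ^ (m + 1)).
Proof. by rewrite (poch_infS cK q1 qX) expfzDr // expr1z !mulrA. Qed.

Lemma poch_quotient_step A (m : int) : nonqpower A ->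
  poch_inf (A * q ^ (m + 1)) / poch_inf A
  = poch_inf (A * q ^ m) / poch_inf A * (1 - A * q ^ m)^-1.
Proof.
move=> hA; rewrite (poch_inf_step A m).
have d0 := orbit_neq0 q0 m hA.
have p0 := poch_inf_neq0_generic cK q0 q1 qX hA.
by field; rewrite d0 p0.
Qed.

(* Along a q-orbit the quotient behaves like [A ^ - m] at infinity; the constant
   does not depend on the orbit. *)
Definition quotient_limits (m : int) (c : K) := forall A, A != 0 -> nonqpower A ->
  (poch_inf (A * q ^ n%:Z * q ^ m) / poch_inf (A * q ^ n%:Z) @[n --> \oo] --> (1 : K))
  /\ ((A * q ^ (- n%:Z)) ^ m * (poch_inf (A * q ^ (- n%:Z) * q ^ m)
       / poch_inf (A * q ^ (- n%:Z))) @[n --> \oo] --> c).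

(** Raising [m] by one multiplies the quotient by [1 / (1 - A q^m)], which tends to 1 at one end of
    the orbit and, after multiplication by the orbit point, to [- q^-m] at the other. The induction
    runs in both directions. *)
Lemma quotient_limits_ex (m : int) : exists2 c, c != 0 & quotient_limits m c.
Proof.
have gen A (k : int) : nonqpower A -> nonqpower (A * q ^ k) by exact: nonqpowerM.
elim/int_rect: m => [|n [c c0 IH]|n [c c0 IH]].
- exists 1; rewrite ?oner_neq0 // => A A0 hA.
  have h : (fun _ : nat => 1 : K) @ \oo --> (1 : K) by exact: cvg_cst.
  split.
    apply: (cvg_seq_eq h erefl) => n.
    by rewrite expr0z mulr1 divff // (poch_inf_neq0_generic cK q0 q1 qX) //; exact: gen.
  apply: (cvg_seq_eq h erefl) => n.
  by rewrite !expr0z mulr1 mul1r divff // (poch_inf_neq0_generic cK q0 q1 qX) //; exact: gen.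
- pose m := n%:Z; have mE : n.+1%:Z = m + 1 by rewrite -addn1 PoszD.
  exists (c * (- (q ^ m)^-1)).
    by rewrite mulf_neq0 // oppr_eq0 invr_eq0 qpowz_neq0.
  rewrite mE => A A0 hA; have [h1 h2] := IH A A0 hA.
  have Am0 : A * q ^ m != 0 by rewrite mulf_neq0 // qpowz_neq0.
  split.
    apply: (cvg_seq_eq (cvgM h1 (@inv_orbit_cvg K q qX (A * q ^ m)))) => [|k].
      by rewrite mulr1.
    by rewrite /= (poch_quotient_step _ (gen A k%:Z hA)) (mulrAC A).
  (* With [z = A q^-k], this is [z / (1 - q^m z) = q^-m ((1 - q^m z)^-1 - 1)]. *)
  have hh : (q ^ m)^-1 * ((1 - A * q ^ m * q ^ (- k%:Z))^-1 - 1) @[k --> \oo]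
      --> (q ^ m)^-1 * (0 - 1).
    apply: cvgM; first exact: cvg_cst.
    by apply: cvgB; [apply: (inv_orbit_cvgN q0 qX Am0); exact: gen | exact: cvg_cst].
  rewrite sub0r mulrN1 in hh.
  apply: (cvg_seq_eq (cvgM h2 hh) erefl) => k.
  have hB := gen A (- k%:Z) hA.
  have B0 : A * q ^ (- k%:Z) != 0 by rewrite mulf_neq0 // qpowz_neq0.
  rewrite /= (poch_quotient_step _ hB) expfzDr // expr1z (mulrAC A (q ^ m)).
  have d0 := orbit_neq0 q0 m hB; have q00 := qpowz_neq0 q0 m.
  have p0 := poch_inf_neq0_generic cK q0 q1 qX hB.
  by field; rewrite d0 q00 p0.
pose m := - n.+1%:Z; have mE : - n%:Z = m + 1 by rewrite /m; lia.
exists (c * - q ^ m); first by rewrite mulf_neq0 // oppr_eq0 qpowz_neq0.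
rewrite -/m => A A0 hA; have := IH A A0 hA; rewrite mE => -[h1 h2].
have gA := gen A _ hA.
split.
  apply: (cvg_seq_eq (cvgM h1 (cvgV (oner_neq0 K) (@inv_orbit_cvg K q qX (A * q ^ m))))) => [|k].
    by rewrite invr1 mulr1.
  rewrite /= (poch_quotient_step _ (gA k%:Z)) (mulrAC A (q ^ m)) invrK.
  by rewrite divfK // orbit_neq0 //; exact: gA.
have hh : A^-1 * q ^+ k - q ^ m @[k --> \oo] --> A^-1 * 0 - q ^ m.
  apply: cvgB; last exact: cvg_cst.
  by apply: cvgM => //; exact: cvg_cst.
rewrite mulr0 sub0r in hh.
apply: (cvg_seq_eq (cvgM h2 hh) erefl) => k.
have hB := gA (- k%:Z).
have B0 : A * q ^ (- k%:Z) != 0 by rewrite mulf_neq0 // qpowz_neq0.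
rewrite /=; have -> : A^-1 * q ^+ k = (A * q ^ (- k%:Z))^-1.
  by rewrite invfM invr_expz opprK.
rewrite /= (poch_quotient_step _ hB) expfzDr // expr1z.
have d0 := orbit_neq0 q0 m hB; have q00 := qpowz_neq0 q0 m.
have p0 := poch_inf_neq0_generic cK q0 q1 qX hB.
move: (A * q ^ (- k%:Z)) B0 d0 p0 => B' B0 d0 p0.
by field; rewrite d0 B0 p0.
Qed.

(** The single factors behave like powers of the orbit point; as the exponents [m j] add up to 0,
    these powers cancel in the product. The constant [c] is chosen before [X], hence common to all
    rows. *)
Lemma balanced_quotient_limits n (b : 'I_n -> K) (m : 'I_n -> int) :
  (forall j, b j != 0) -> \sum_j m j = 0 ->
  exists2 c, c != 0 & forall X, X != 0 -> (forall j, nonqpower (X * b j)) ->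
  (\prod_j (poch_inf (X * q ^ k%:Z * (b j * q ^ m j)) / poch_inf (X * q ^ k%:Z * b j))
     @[k --> \oo] --> (1 : K))
  /\ (\prod_j (poch_inf (X * q ^ (- k%:Z) * (b j * q ^ m j)) / poch_inf (X * q ^ (- k%:Z) * b j))
     @[k --> \oo] --> c).
Proof.
move=> b0 m0.
pose c j := projT1 (cid2 (quotient_limits_ex (m j))).
have cP j : c j != 0 /\ quotient_limits (m j) (c j).
  by rewrite /c; case: cid2.
exists (\prod_j (c j / b j ^ m j)).
  apply/prodf_neq0 => j _; have [c0 _] := cP j.
  by rewrite mulf_neq0 // invr_eq0 expfz_neq0.
move=> X X0 hX; split.
  have h : \prod_j (poch_inf (X * q ^ k%:Z * (b j * q ^ m j)) / poch_inf (X * q ^ k%:Z * b j))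
      @[k --> \oo] --> \prod_(j < n) (1 : K); last first.
    by apply: (cvg_seq_eq h) => //; rewrite big1.
  apply: (cvg_big (@mul_continuous K)) => j _.
  have Xb0 : X * b j != 0 by rewrite mulf_neq0.
  have [_ /(_ _ Xb0 (hX j))[h _]] := cP j.
  apply: (cvg_seq_eq h erefl) => k.
  by rewrite !mulrA (mulrAC X).
have h : \prod_j ((X * b j * q ^ (- k%:Z)) ^ m j *
       (poch_inf (X * b j * q ^ (- k%:Z) * q ^ m j) / poch_inf (X * b j * q ^ (- k%:Z)))
       / b j ^ m j) @[k --> \oo] --> \prod_j (c j / b j ^ m j).
  apply: (cvg_big (@mul_continuous K)) => j _.
  have Xb0 : X * b j != 0 by rewrite mulf_neq0.
  have [_ /(_ _ Xb0 (hX j))[_ h]] := cP j.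
  by apply: cvgM => //; exact: cvg_cst.
apply: (cvg_seq_eq h erefl) => k.
set B := X * q ^ (- k%:Z).
have B0 : B != 0 by rewrite mulf_neq0 // qpowz_neq0.
transitivity (\prod_j (B ^ m j) *
   \prod_j (poch_inf (B * (b j * q ^ m j)) / poch_inf (B * b j))).
  rewrite -big_split; apply: eq_bigr => j _ /=.
  have -> : X * b j * q ^ (- k%:Z) = B * b j by rewrite mulrAC.
  have bm0 : b j ^ m j != 0 by rewrite expfz_neq0.
  rewrite exprzMl ?unitfE // [B * (b j * _)]mulrA.
  by set Z := poch_inf _ / _; field.
by rewrite prod_exprz // m0 expr0z mul1r.
Qed.

Lemma power_over_product_bounded n (a : 'I_n -> K) X j :
  X != 0 -> (forall s, a s != 0) -> (forall s, nonqpower (X * a s)) -> (j <= n)%N ->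
  bounded_family (fun k : int => (X * q ^ k) ^+ j / \prod_s (1 - X * q ^ k * a s)).
Proof.
move=> X0; elim: n j a => [|n IH] [|j] a a0 ha jn //.
- by exists 1 => k; rewrite big_ord0 expr0 divr1 normr1.
- have := @bounded_family_prod K int 'I_n.+1 xpredT
    (fun s k => (1 - X * a s * q ^ k)^-1) (fun s _ =>
     inv_orbit_bounded q0 qX (mulf_neq0 X0 (a0 s)) (ha s)).
  move=> [B hB]; exists B => k; rewrite expr0 div1r -prodfV.
  rewrite (le_trans _ (hB k)) // le_eqVlt; apply/orP; left; apply/eqP; congr `|_|.
  by apply: eq_bigr => s _; rewrite mulrAC.
have b1 := orbit_ratio_bounded q0 qX (mulf_neq0 X0 (a0 ord0)) (ha ord0).
have b2 := IH j (fun s => a (lift ord0 s)) (fun s => a0 _) (fun s => ha _) jn.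
have [B hB] := bounded_familyM (bounded_familyM (bounded_family_cst int X) b1) b2.
exists B => k; rewrite (le_trans _ (hB k)) // le_eqVlt; apply/orP; left; apply/eqP; congr `|_|.
by rewrite big_ord_recl /= exprS invfM (mulrAC X (a ord0)) !mulrA; ring.
Qed.

(** Two of the denominators together with one power give a summable factor; the remaining [j - 1]
    powers are dominated by the remaining [r - 1] denominators. *)
Lemma power_over_product_summable r (a : 'I_r.+1 -> K) X j :
  X != 0 -> (forall s, a s != 0) -> (forall s, nonqpower (X * a s)) -> (0 < j <= r)%N ->
  norm_bounded (fun k : int => (X * q ^ k) ^+ j / \prod_s (1 - X * q ^ k * a s)).
Proof.
case: j => // j X0; case: r a => // r a a0 ha /= jr.
have b1 := orbit_summable q0 q1 qX (mulf_neq0 X0 (a0 ord0))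
  (mulf_neq0 X0 (a0 (lift ord0 ord0))) (ha ord0) (ha (lift ord0 ord0)).
have [B hB] := power_over_product_bounded (a := fun s => a (lift ord0 (lift ord0 s))) X0
  (fun s => a0 _) (fun s => ha _) jr.
apply: (norm_bounded_le (B := `|X| * B)) b1 => k.
rewrite !big_ord_recl exprS.
set P := \prod_(s < r) _; set d0 := 1 - X * a ord0 * _.
set d1 := 1 - X * a (lift ord0 ord0) * _.
have -> : 1 - X * q ^ k * a ord0 = d0 by rewrite /d0 mulrAC.
have -> : 1 - X * q ^ k * a (lift ord0 ord0) = d1 by rewrite /d1 mulrAC.
have -> : X * q ^ k * (X * q ^ k) ^+ j / (d0 * (d1 * P))
    = X * ((X * q ^ k) ^+ j / P) * (q ^ k / (d0 * d1)).
  by rewrite !invfM; ring.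
by rewrite normrM ler_wpM2r // normrM ler_wpM2l // hB.
Qed.

End Rows.

(** * The polynomials p_w *)

Section LinearProduct.
Variables (F : fieldType) (r : nat) (a : 'I_r -> F).
Hypothesis a0 : forall j, a j != 0.

Definition linprod : {poly F} := \prod_j (1 - a j *: 'X).

Lemma horner_linprod t : linprod.[t] = \prod_j (1 - t * a j).
Proof.
by rewrite horner_prod; apply: eq_bigr => j _; rewrite !hornerE mulrC.
Qed.

Lemma size_linear_factor (c : F) : c != 0 -> size (1 - c *: 'X) = 2%N.
Proof.
move=> c0; rewrite addrC size_polyDl size_polyN size_scale ?size_polyX //.
by rewrite size_poly1.
Qed.

Lemma size_linprod : size linprod = r.+1.
Proof.
rewrite /linprod size_prod => [|j _]; last first.
  by rewrite -size_poly_eq0 size_linear_factor.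
under eq_bigr => j _ do rewrite size_linear_factor //.
by rewrite sum_nat_const card_ord muln2 -addnn -addSn addnK.
Qed.

Lemma linprod_coef0 : linprod`_0 = 1.
Proof. by rewrite -horner_coef0 horner_linprod big1 // => j _; rewrite mul0r subr0. Qed.

Lemma linprod_top : linprod`_r = (-1) ^+ r * \prod_j a j.
Proof.
have <- : lead_coef linprod = linprod`_r by rewrite /lead_coef size_linprod.
rewrite lead_coef_prod -[X in (-1) ^+ X](card_ord r) -prodrN; apply: eq_bigr => j _.
by rewrite /lead_coef size_linear_factor //= coefB coef1 coefZ coefX mulr1 sub0r.
Qed.

End LinearProduct.

(** * The case n <> l *)

Section OffDiagonal.
Variables (K : numFieldType) (q : K).
Hypotheses (cK : summation_complete K) (q0 : q != 0) (q1 : `|q| < 1)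
  (qX : q ^+ n @[n --> \oo] --> (0 : K)).
Local Notation nonqpower := (avoids_qpowers q).
Local Notation poch_inf := (pochhammer_inf q).
Local Notation vdm := (altprod (fun u v => u - v)).

Variables (r : nat) (X b : 'I_r.+1 -> K) (m : 'I_r.+1 -> int) (eps : 'I_r.+1 -> bool).
Hypotheses (X0 : forall i, X i != 0) (b0 : forall i, b i != 0)
  (m_sum : \sum_j m j = 0) (m_neq0 : exists j, m j != 0)
  (gb : forall i j, i != j -> nonqpower (b i / b j))
  (gXb : forall i j, nonqpower (X i * b j)).

Let a j := b j * q ^ m j.
Let y i t := X i * q ^ flip (eps i) t.
(** [A] and [B] are p_w and p_v of the overview. *)
Let A := linprod a.
Let B := linprod b.

(* In both cases [A.[z] * row_weight i z] at the next lattice point equals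
   [B.[z] * row_weight i z] at the present one ([phi_succ]). *)
Definition row_weight i (z : K) :=
  if eps i then \prod_j (poch_inf (z * b j * q) / poch_inf (z * a j))
  else \prod_j (poch_inf (z * a j * q) / poch_inf (z * b j)).

Definition offdiag_term (v : {ffun 'I_r.+1 -> int}) : K :=
  (1 - \prod_j a j * \prod_i y i (v i)) * vdm (fun i => y i (v i))
  * \prod_i row_weight i (y i (v i)).

Let phi i t := A.[y i t] * row_weight i (y i t).

Let a0 j : a j != 0. Proof. by rewrite mulf_neq0 // qpowz_neq0. Qed.

Let gXa i j : nonqpower (X i * a j).
Proof. by rewrite /a mulrA; exact: nonqpowerM. Qed.

Let gy i t c : nonqpower (X i * c) -> nonqpower (y i t * c).
Proof. by move=> h; rewrite /y mulrAC; exact: nonqpowerM. Qed.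

Let Eyq i t c : nonqpower (X i * c) -> poch_inf (y i t * c * q) != 0.
Proof.
move=> h; apply: (poch_inf_neq0_generic cK q0 q1 qX).
exact: (nonqpowerM q0 1 (gy _ h)).
Qed.

Let Elin i t c : nonqpower (X i * c) -> 1 - y i t * c != 0.
Proof. by move=> h; rewrite subr_eq0 eq_sym; apply/nonqpower_neq1/gy. Qed.

Let EE := poch_infS cK q1 qX.

Let quot (z : K) := \prod_j (poch_inf (z * a j) / poch_inf (z * b j)).

(** In either direction [phi] is a balanced quotient of infinite products, inverted in a reversed
    row; its limits can therefore be read off. *)
Lemma phiE i t : phi i t = if eps i then (quot (y i t * q))^-1 else quot (y i t).
Proof.
rewrite /phi horner_linprod /row_weight /quot; case: (eps i).
  rewrite -prodfV -big_split; apply: eq_bigr => j _ /=.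
  rewrite (EE (y i t * a j)) !(mulrAC _ q).
  have := Elin t (gXa i j); have := Eyq t (gXa i j); have := Eyq t (gXb i j).
  by move=> h1 h2 h3; field; rewrite ?h1 ?h2 ?h3.
rewrite -big_split; apply: eq_bigr => j _ /=.
by rewrite (EE (y i t * a j)) -[RHS]mulrA.
Qed.

Lemma phi_succ i t : phi i (t + 1) = B.[y i t] * row_weight i (y i t).
Proof.
rewrite phiE horner_linprod /row_weight /quot /y /flip; case E: (eps i).
  have -> : X i * q ^ (- (t + 1)) * q = y i t.
    rewrite -mulrA -[X in _ * (_ * X)](expr1z q) -expfzDr // /y E /=.
    by congr (_ * q ^ _); ring.
  have -> : X i * q ^ (- t) = y i t by rewrite /y E.
  rewrite -prodfV -big_split; apply: eq_bigr => j _ /=.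
  by rewrite invf_div (EE (y i t * b j)) -[LHS]mulrA.
have -> : X i * q ^ (t + 1) = y i t * q by rewrite expfzDr // expr1z mulrA /y E.
have -> : X i * q ^ t = y i t by rewrite /y E.
rewrite -big_split; apply: eq_bigr => j _ /=.
rewrite (EE (y i t * b j)) !(mulrAC _ q).
have := Elin t (gXb i j); have := Eyq t (gXa i j); have := Eyq t (gXb i j).
by move=> h1 h2 h3; field; rewrite ?h1 ?h2 ?h3.
Qed.

(** A reversed row has its limits exchanged and inverted, so the backward limit is [c] times the
    forward one in every row. This gives the hypothesis [L_comm] of the telescoping argument. *)
Lemma phi_limits : exists2 c : K, c != 0 & forall i,
  (phi i n%:Z @[n --> \oo] --> (if eps i then c^-1 else 1 : K)) /\
  (phi i (- n%:Z) @[n --> \oo] --> (if eps i then 1 else c : K)).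
Proof.
have [c c0 H] := balanced_quotient_limits cK q0 q1 qX b0 m_sum.
exists c => // i; case E: (eps i).
  have gXq j : nonqpower (X i * q * b j).
    by rewrite mulrAC; exact: (nonqpowerM q0 1 (gXb i j)).
  have [h1 h2] := H _ (mulf_neq0 (X0 i) q0) gXq; split.
    apply: (cvg_seq_eq (cvgV c0 h2) erefl) => n.
    by rewrite /= phiE E /quot /y E /= !(mulrAC _ q).
  rewrite -[X in _ --> X]invr1.
  apply: (cvg_seq_eq (cvgV (oner_neq0 K) h1) erefl) => n.
  by rewrite /= phiE E /quot /y E /= opprK !(mulrAC _ q).
have [h1 h2] := H _ (X0 i) (gXb i); split.
  apply: (cvg_seq_eq h1 erefl) => n.
  by rewrite /= phiE E /quot /y E.
apply: (cvg_seq_eq h2 erefl) => n.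
by rewrite /= phiE E /quot /y E.
Qed.

Lemma phi_bounded : exists C, forall i t, `|phi i t| <= C.
Proof.
have [c c0 H] := phi_limits.
have h i : bounded_family (phi i).
  by have [h1 h2] := H i; exact: cvg_bounded_int h1 h2.
pose C i := projT1 (cid (h i)); have hC i := projT2 (cid (h i)).
exists (\sum_i C i) => i t; rewrite (le_trans (hC i t)) // (bigD1 i) //= lerDl.
by apply: sumr_ge0 => k _; rewrite (le_trans _ (hC k 0)).
Qed.

Let u (i j : 'I_r.+1) t :=
  (if j == ord0 then A.[y i t] else y i t ^+ j) * row_weight i (y i t).

Lemma u_summable i j : j != ord0 -> norm_bounded (u i j).
Proof.
move=> j0; have [C hC] := phi_bounded.
have jr : (0 < j <= r)%N by rewrite lt0n -ltnS ltn_ord andbT; exact: j0.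
have := norm_bounded_flip (eps i)
  (power_over_product_summable q0 q1 qX (X0 i) a0 (gXa i) jr).
apply: (norm_bounded_le (B := C)) => t /=.
have -> : u i j t = phi i t * (y i t ^+ j / \prod_s (1 - y i t * a s)).
  rewrite /u (negPf j0) /phi horner_linprod.
  have h : \prod_s (1 - y i t * a s) != 0 by apply/prodf_neq0 => s _; exact: Elin.
  by field.
by rewrite normrM ler_wpM2r.
Qed.

Lemma u0_bounded : exists C, forall i t, `|u i ord0 t| <= C.
Proof. by have [C hC] := phi_bounded; exists C => i t; rewrite /u eqxx; exact: hC. Qed.

(** [det_poly_col] is applied to [A], whose constant coefficient 1 and top coefficient
    [(-1)^(r+1) \prod a] produce the factor [1 - \prod a \prod y]; [e] is the sign between [vdm] and
    the determinant of powers. *)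
Lemma offdiag_termE : exists e : K, forall v, offdiag_term v = e * det_at u v.
Proof.
exists (\prod_(i < r.+1) \prod_(j < r.+1 | (i < j)%N) -1) => v.
rewrite /offdiag_term altprod_vandermonde.
have -> : det_at u v = \prod_i row_weight i (y i (v i)) *
    \det (\matrix_(i, j) if j == ord0 :> 'I_r.+1 then A.[y i (v i)] else y i (v i) ^+ j).
  rewrite -det_scale_rows; congr (\det _); apply/matrixP => i j.
  by rewrite !mxE /u mulrC.
rewrite det_poly_col ?size_linprod // linprod_coef0 linprod_top // exprS.
have s1 : (-1) ^+ r * (-1) ^+ r = 1 :> K by rewrite -expr2 sqrr_sign.
set P := \prod_j a j; set Y := \prod_i y i (v i).
have -> : (-1) ^+ r * (-1 * (-1) ^+ r * P) * Y = - (P * Y).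
  by rewrite mulN1r !mulrA mulrN s1 mulN1r mulNr.
ring.
Qed.

Lemma offdiag_bounded : norm_bounded (offdiag_term \o extend ord0).
Proof.
have [e E] := offdiag_termE; have [C hC] := u0_bounded.
have := norm_boundedZ e (det_at_bounded hC u_summable ord0).
by apply: (norm_bounded_le (B := 1)) => k; rewrite mul1r /= E.
Qed.

Let d (j : 'I_r.+1) := (B - A)`_j.

Lemma linprod_top_eq : B`_r.+1 = A`_r.+1.
Proof.
by rewrite !linprod_top // /a big_split /= prod_exprz // m_sum expr0z mulr1.
Qed.

(** The top coefficients agree, so otherwise [A = B] and [A] would vanish at [(b j)^-1] for some
    [m j != 0], although its roots are the [(b k * q ^ m k)^-1] and the [b k] lie on distinct
    orbits. *)
Lemma linprod_diff_neq0 : exists j, d j != 0.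
Proof.
apply: contrapT => nd.
have dz j : d j = 0 by apply/eqP; apply: contrapT => /negP h; apply: nd; exists j.
have AB : B = A.
  apply/polyP => k; apply/eqP; rewrite -subr_eq0 -coefB.
  have [kr|kr] := ltnP k r.+1; first exact/eqP/(dz (Ordinal kr)).
  move: kr; rewrite leq_eqVlt => /orP[/eqP <-|kr]; last first.
    by rewrite coefB !nth_default ?subrr // size_linprod.
  by rewrite coefB linprod_top_eq subrr.
have [j mj] := m_neq0.
have : A.[(b j)^-1] = 0.
  by rewrite -AB horner_linprod (bigD1 j) //= mulVf // subrr mul0r.
rewrite horner_linprod => /eqP; apply/negP; apply/prodf_neq0 => k _.
rewrite subr_eq0 eq_sym.
have [->|kj] := eqVneq k j.
  rewrite /a mulrA mulVf // mul1r; apply: contra_neq mj; exact: (qpow_eq1 q1).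
rewrite mulrC /a mulrAC; apply: (nonqpower_shift q0); exact: gb.
Qed.

(* The polynomial [B - A] has no constant and no top term, hence is a combination
   of [X, ..., X^r]; replacing one of these columns by it creates a telescoping
   column. *)
Lemma offdiag_sum : has_sum (offdiag_term \o extend ord0) 0.
Proof.
have [e E] := offdiag_termE; have [C hC] := u0_bounded.
have [j0 dj0] := linprod_diff_neq0.
have d0 : d ord0 = 0 by rewrite /d coefB !linprod_coef0 subrr.
have j00 : j0 != ord0 by apply: contra_neq dj0 => ->.
have [c c0 H] := phi_limits.
have diffE i t : phi i (t + 1) - phi i t = \sum_j d j * u i j t.
  rewrite phi_succ /phi -mulrBl -hornerN -hornerD.
  have sz : (size (B - A)%R <= r.+2)%N.
    by rewrite (leq_trans (size_polyD _ _)) // size_polyN !size_linprod // maxnn.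
  rewrite (horner_coef_wide _ sz) big_ord_recr /=.
  rewrite coefB linprod_top_eq subrr mul0r addr0 mulr_suml; apply: eq_bigr => j _; rewrite /u -/(d j).
  have [->|_] := eqVneq j ord0; first by rewrite d0 !mul0r.
  by rewrite mulrA.
pose u' i j t := if j == j0 then phi i (t + 1) - phi i t else u i j t.
have u'C i t : `|u' i ord0 t| <= C by rewrite /u' eq_sym (negPf j00).
have u'S i j : j != ord0 -> norm_bounded (u' i j).
  rewrite /u'; have [_ _|_ j_neq0] := eqVneq j j0; last exact: u_summable.
  rewrite (funext (diffE i)); apply: norm_bounded_sum => k.
  (* The non-summable column enters with the coefficient [d ord0 = 0]. *)
  have [->|k0] := eqVneq k ord0; last by apply: norm_boundedZ; exact: u_summable.
  by exists 0 => s _; rewrite big1 // => t _; rewrite d0 mul0r normr0.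
have u'0 i t : u' i ord0 t = phi i t.
  by rewrite /u' eq_sym (negPf j00) /u eqxx.
have u'D i t : u' i j0 t = u' i ord0 (t + 1) - u' i ord0 t.
  by rewrite !u'0 /u' eqxx.
have S0 : has_sum (det_at u' \o extend ord0) 0.
  apply: (has_sum_det_telescope cK u'C u'S j00 u'D
    (Lp := fun i => if eps i then c^-1 else 1) (Ln := fun i => if eps i then 1 else c)).
  - by move=> i; rewrite (funext (u'0 i)); have [] := H i.
  - by move=> i; rewrite (funext (u'0 i)); have [] := H i.
  - by move=> i k; case: (eps i); case: (eps k) => //; rewrite ?mulVf // !mul1r ?mulVf.
have -> : offdiag_term \o extend ord0 = fun k => (e / d j0) * (det_at u' \o extend ord0) k.
  apply/funext => k; rewrite /= E.
  suff -> : det_at u' (extend ord0 k) = d j0 * det_at u (extend ord0 k) by field.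
  apply: det_replace_col => [i j jj|i].
    by rewrite !mxE /u' (negPf jj).
  by rewrite mxE /u' eqxx diffE; apply: eq_bigr => j _; rewrite mxE.
by rewrite -(mulr0 (e / d j0)); exact: has_sumZ.
Qed.

End OffDiagonal.

(** * The matrices f and g *)

Section PairProducts.
Variable F : fieldType.

Lemma prod_pairs n (f : 'I_n -> 'I_n -> F) :
  \prod_i \prod_j f i j
  = (\prod_i f i i) * \prod_(i < n) \prod_(j < n | (i < j)%N) (f i j * f j i).
Proof.
transitivity (\prod_(i < n) (f i i * (\prod_(j < n | (i < j)%N) f i j
                                * \prod_(j < n | (j < i)%N) f i j))).
  apply: eq_bigr => i _; rewrite (bigD1 i) //=; congr (_ * _).
  rewrite (bigID (fun j : 'I_n => (i < j)%N)) /=; congr (_ * _); apply: eq_bigl => j.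
    by rewrite -val_eqE /= neq_ltn andbC; case: ltngtP.
  by rewrite -val_eqE /= neq_ltn -leqNgt andbC; case: ltngtP.
rewrite !big_split /=; congr (_ * _).
rewrite [X in _ * X](exchange_big_dep xpredT) //= -big_split; apply: eq_bigr => i _.
by rewrite -big_split.
Qed.

Lemma altprodM n (s s' : F -> F -> F) (x : 'I_n -> F) :
  altprod (fun u v => s u v * s' u v) x = altprod s x * altprod s' x.
Proof.
by rewrite -big_split; apply: eq_bigr => i _; rewrite -big_split.
Qed.

Lemma altprod_recl n (s : F -> F -> F) (x : 'I_n.+1 -> F) :
  altprod s x = \prod_j s (x ord0) (x (lift ord0 j)) * altprod s (fun j => x (lift ord0 j)).
Proof.
rewrite /altprod big_ord_recl; congr (_ * _).
  by rewrite big_mkcond big_ord_recl /= mul1r.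
apply: eq_bigr => i _; rewrite big_mkcond big_ord_recl /= mul1r [RHS]big_mkcond.
by apply: eq_bigr.
Qed.

(** There are [n (n - 1) / 2] pairs, and [n (n - 1) + n = n^2]. This compares the normalizing
    constants of the theta functions in numerator and denominator of the Cauchy product. *)
Lemma altprod_cst n (e : F) (x : 'I_n -> F) :
  altprod (fun _ _ => e) x ^+ 2 * e ^+ n = e ^+ (n * n).
Proof.
elim: n x => [|n IH] x; first by rewrite /altprod big_ord0 expr1n mul1r.
rewrite altprod_recl prodr_const card_ord exprMn exprS.
have -> : (n.+1 * n.+1 = n * n + (n * 2 + 1))%N by lia.
by rewrite exprD -(IH (fun j => x (lift ord0 j))) exprD exprM expr1 /= (exprS e n); ring.
Qed.

Lemma altprod_neq0 n (s : F -> F -> F) (x : 'I_n -> F) :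
  (forall i j, i != j -> s (x i) (x j) != 0) -> altprod s x != 0.
Proof.
move=> h; apply/prodf_neq0 => i _; apply/prodf_neq0 => j ij; apply: h.
by apply: contraTneq ij => ->; rewrite ltnn.
Qed.

Lemma eq_altprod n (s s' : F -> F -> F) (x x' : 'I_n -> F) :
  (forall i j, s (x i) (x j) = s' (x' i) (x' j)) -> altprod s x = altprod s' x'.
Proof. by move=> h; apply: eq_bigr => i _; apply: eq_bigr => j _. Qed.

End PairProducts.

(** The indices [00], [0S], [S0], [SS] refer to the pairs (0,0), (0,j), (i,0), (i,j) of the extended
    variables. Each group of shifted factorials of f and g is a rational factor [p] times a ratio
    [r] of infinite products; the factors [p] then complete the prefactor [P]. *)
Lemma assemble_terms (F : fieldType)
    (P F4 F5 F6 F7 U8 V8 a1 G1 G2 G3 G4 G5 U6 V6 G7 p00 p0S pS0 pSS r00 r0S rS0 rSS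
     k0 vX vW vw vy q1 q2 : F) :
  vX != 0 -> vW != 0 -> a1 != 0 ->
  P * (p00 * p0S * (pS0 * pSS)) = k0 * a1 * vX * vW ->
  F4 * F5 = vw / vW * q1 -> G2 * G3 = vy / vX * q2 ->
  F6 * G4 = p00 * r00 -> U8 * V6 = p0S * r0S -> U6 * V8 = pS0 * rS0 -> G5 * F7 = pSS * rSS ->
  P * F4 * F5 * F6 * F7 * (U8 * V8) * (G1 / a1 * G2 * G3 * G4 * G5 * (U6 * V6) * G7)
  = k0 * (q1 * q2 * G7) * vw * (vy * G1) * (r00 * r0S * (rS0 * rSS)).
Proof.
move=> vX0 vW0 a10 hP h45 h23 h64 h86 h68 h57.
transitivity (P * (F4 * F5) * (G2 * G3) * (F6 * G4) * (U8 * V6) * (U6 * V8) * (G5 * F7)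
  * G1 / a1 * G7); first by ring.
rewrite h45 h23 h64 h86 h68 h57.
transitivity (P * (p00 * p0S * (pS0 * pSS)) * (vw / vW * q1) * (vy / vX * q2)
  * (r00 * r0S * (rS0 * rSS)) * G1 / a1 * G7); first by ring.
by rewrite hP; field; rewrite vX0 vW0 a10.
Qed.

(** * The matrices f and g in the extended variables *)

Section ProductFormula.
Variables (R : realType) (r : nat) (q a b : R[i]) (c x : 'I_r -> R[i]).
Hypotheses (q_neq0 : q != 0) (q_lt1 : `|q| < 1).
Local Notation C := (Cprod c).
Local Notation E := (qpoch_inf q).
Local Notation qp := (qpoch q).
Local Notation K := (R[i]).

Let cK : summation_complete R[i] := @complex_summation_complete R.
Let qX : q ^+ n @[n --> \oo] --> (0 : R[i]^o) := cvg_expr0 q_lt1.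

Lemma pochhammer_infE z : pochhammer_inf q z = E z.
Proof. by []. Qed.

Lemma qpoch_infS z : E z = (1 - z) * E (z * q).
Proof. exact: (poch_infS cK q_lt1 qX). Qed.

Lemma qpoch_inf_neq0 z : not_qpow q z -> E z != 0.
Proof. exact: (poch_inf_neq0_generic cK q_neq0 q_lt1 qX). Qed.

Lemma qpoch_inf_q : E q != 0.
Proof. exact: (poch_inf_q_neq0 cK q_lt1 qX). Qed.

Hypotheses (a_neq0 : a != 0) (b_neq0 : b != 0)
  (c_neq0 : forall i, c i != 0) (x_neq0 : forall i, x i != 0)
  (ga : not_qpow q a) (gaC : not_qpow q (a / C))
  (gcx : forall i j, i != j -> not_qpow q (c j * x i / (c i * x j)))
  (gx : forall i j, i != j -> not_qpow q (x i / x j))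
  (gcxx : forall i j, not_qpow q (c j * x i / x j))
  (gaxbc : forall i, not_qpow q (a * x i / (b * c i)))
  (gCxb : forall i, not_qpow q (C * x i / b))
  (gaxb : forall i, not_qpow q (a * x i / b))
  (gbcCx : forall i, not_qpow q (b * c i / (C * x i))).
Local Notation vdm := (altprod (fun u v => u - v)).

Let C_neq0 : C != 0. Proof. by apply/prodf_neq0. Qed.

(* With these extra entries of index 0 every shifted factorial of [f] and [g] has
   an argument of the form [Xs i * Ws j], up to powers of [q]. *)
Definition Xs (i : 'I_r.+1) : K := if unlift ord0 i is Some j then x j else b / C.
Definition Ws (i : 'I_r.+1) : K := if unlift ord0 i is Some j then c j / x j else a / b.

Lemma Xs0 : Xs ord0 = b / C. Proof. by rewrite /Xs unlift_none. Qed.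
Lemma Ws0 : Ws ord0 = a / b. Proof. by rewrite /Ws unlift_none. Qed.
Lemma XsS j : Xs (lift ord0 j) = x j. Proof. by rewrite /Xs liftK. Qed.
Lemma WsS j : Ws (lift ord0 j) = c j / x j. Proof. by rewrite /Ws liftK. Qed.

Lemma Xs_neq0 i : Xs i != 0.
Proof. by rewrite /Xs; case: unlift => // *; rewrite mulf_neq0 // invr_eq0. Qed.

Lemma Ws_neq0 i : Ws i != 0.
Proof. by rewrite /Ws; case: unlift => // *; rewrite mulf_neq0 // invr_eq0. Qed.

Let gV z : not_qpow q z -> not_qpow q z^-1.
Proof. exact: nonqpowerV. Qed.

Lemma gXW i j : not_qpow q (Xs i * Ws j).
Proof.
have [i' ->|->] := unliftP ord0 i; have [j' ->|->] := unliftP ord0 j;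
  rewrite ?Xs0 ?Ws0 ?XsS ?WsS.
- by rewrite (_ : x i' * _ = c j' * x i' / x j'); [exact: gcxx | ring].
- by rewrite (_ : x i' * _ = a * x i' / b); [exact: gaxb | ring].
- rewrite (_ : b / C * _ = b * c j' / (C * x j')); first exact: gbcCx.
  by field; rewrite x_neq0 C_neq0.
- rewrite (_ : b / C * _ = a / C) //; by field; rewrite b_neq0 C_neq0.
Qed.

Lemma gX i j : i != j -> not_qpow q (Xs i / Xs j).
Proof.
have [i' ->|->] := unliftP ord0 i; have [j' ->|->] := unliftP ord0 j;
  rewrite ?Xs0 ?XsS => ij.
- by apply: gx; rewrite (inj_eq lift_inj) in ij.
- rewrite (_ : x i' / _ = C * x i' / b) //.
  by field; rewrite b_neq0 C_neq0.
- rewrite (_ : b / C / _ = (C * x j' / b)^-1); first exact: gV.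
  by field; rewrite x_neq0 b_neq0 C_neq0.
- by rewrite eqxx in ij.
Qed.

Lemma gW i j : i != j -> not_qpow q (Ws i / Ws j).
Proof.
have [i' ->|->] := unliftP ord0 i; have [j' ->|->] := unliftP ord0 j;
  rewrite ?Ws0 ?WsS => ij.
- have ji : j' != i' by rewrite (inj_eq lift_inj) eq_sym in ij.
  rewrite (_ : _ / _ = c i' * x j' / (c j' * x i')); first exact: gcx.
  by field; rewrite !c_neq0 !x_neq0.
- rewrite (_ : _ / (a / b) = (a * x i' / (b * c i'))^-1); first exact: gV.
  by field; rewrite a_neq0 b_neq0 c_neq0 x_neq0.
- rewrite (_ : a / b / _ = a * x j' / (b * c j')) //.
  by field; rewrite b_neq0 c_neq0 x_neq0.
- by rewrite eqxx in ij.
Qed.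

Let vX : vdm Xs != 0.
Proof.
apply: altprod_neq0 => i j /gX /nonqpower_neq1; rewrite subr_eq0.
by apply: contra_neq => ->; rewrite divff // Xs_neq0.
Qed.

Let vW : vdm Ws != 0.
Proof.
apply: altprod_neq0 => i j /gW /nonqpower_neq1; rewrite subr_eq0.
by apply: contra_neq => ->; rewrite divff // Ws_neq0.
Qed.

Lemma prod_XW : \prod_i Xs i * \prod_j Ws j = a.
Proof.
rewrite !big_ord_recl Xs0 Ws0.
under eq_bigr do rewrite XsS; under [X in _ * (_ * X)]eq_bigr do rewrite WsS.
rewrite big_split prodfV -/C /=.
have P0 : \prod_j x j != 0 by apply/prodf_neq0.
by field; rewrite C_neq0 b_neq0 P0.
Qed.

(** Theta without its factor [1 - z] and its normalization; invariant under inversion of [z]. *)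
Let t1 z := E (q * z) * E (q / z).

Let t1_sym u v : t1 (u / v) = t1 (v / u).
Proof. by rewrite /t1 !invf_div mulrC. Qed.

Let t1_neq0 z : not_qpow q z -> t1 z != 0.
Proof.
move=> gz; rewrite mulf_neq0 //; apply: qpoch_inf_neq0; rewrite mulrC.
  exact: (nonqpowerM q_neq0 1 gz).
exact: (nonqpowerM q_neq0 1 (gV gz)).
Qed.

Let e := (E q ^+ 2)^-1.
Let e_neq0 : e != 0. Proof. by rewrite invr_eq0 expf_neq0 // qpoch_inf_q. Qed.

Let theta_t1 z : z != 0 -> theta q z = (1 - z) * t1 z * e.
Proof. by move=> z0; rewrite (thetaE cK q_lt1 qX z0) mulrA. Qed.

Let T n (u : 'I_n -> K) := altprod (fun u v => t1 (u / v)) u.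

Lemma altprod_skew n (u : 'I_n -> K) : (forall i, u i != 0) ->
  altprod (skew (theta q)) u = vdm u * T u * altprod (fun _ _ => e) u.
Proof.
move=> u0; rewrite -!altprodM; apply: eq_altprod => i j.
rewrite /skew theta_t1; last by rewrite mulf_neq0 ?invr_eq0.
by rewrite t1_sym !mulrA mulrBr mulr1 (mulrC (u i)) divfK.
Qed.

(** The reciprocal of the sum found in [cauchy_term_sum]; it is hidden in the infinite products in
    front of f. *)
Definition K0 := \prod_i \prod_j theta q (Xs i * Ws j)
  / (theta q (\prod_i Xs i * \prod_j Ws j) * altprod (skew (theta q)) Xs * altprod (skew (theta q)) Ws).

Let prefactor :=
  (E (a * q / C) * E (C * q / a)) / (E (a * q) * E (q / a))
  * (\prod_(i < r) \prod_(j < r)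
       ((E (q * c j * x i / x j) * E (q * x i / (c i * x j)))
        / (E (q * c j * x i / (c i * x j)) * E (q * x i / x j))))
  * (\prod_(i < r)
       ((E (a * x i * q / b) * E (b * q / (a * x i))
         * E (b * c i * q / (C * x i)) * E (C * x i * q / (b * c i)))
        / (E (a * x i * q / (b * c i)) * E (b * c i * q / (a * x i))
           * E (C * x i * q / b) * E (b * q / (C * x i))))).

(** The infinite products of f pair up into values of [t1] at the [X_i W_j], at the quotients
    [X_i / X_j] and [W_i / W_j], and at [a = \prod X \prod W]. Passing from [t1] to theta leaves the
    displayed rational factors and powers of [e], which cancel. *)
Lemma prefactorE : prefactor * \prod_i \prod_j (1 - Xs i * Ws j)
  = K0 * (1 - a) * vdm Xs * vdm Ws.
Proof.
pose w j := c j / x j.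
have wE j : w j = Ws (lift ord0 j) by rewrite WsS.
pose P := \prod_i \prod_j t1 (Xs i * Ws j).
have TX : T Xs != 0 by apply: altprod_neq0 => i j /gX /t1_neq0.
have TW : T Ws != 0 by apply: altprod_neq0 => i j /gW /t1_neq0.
have ta : t1 a != 0 by exact: t1_neq0.
have a1 : 1 - a != 0 by rewrite subr_eq0 eq_sym; exact: nonqpower_neq1 ga.
have Eq := qpoch_inf_q.
have preE : prefactor = P * e ^+ r / (t1 a * T Xs * T Ws).
  have -> : T Xs = \prod_j t1 (Xs ord0 / x j) * T x.
    rewrite /T altprod_recl; congr (_ * _).
      by apply: eq_bigr => j _; rewrite XsS.
    by apply: eq_altprod => i j; rewrite !XsS.
  have -> : T Ws = \prod_j t1 (Ws ord0 / w j) * T w.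
    rewrite /T altprod_recl; congr (_ * _).
      by apply: eq_bigr => j _; rewrite WsS.
    by apply: eq_altprod => i j; rewrite !WsS.
  have -> : P = t1 (Xs ord0 * Ws ord0) * (\prod_j t1 (Xs ord0 * w j))
      * ((\prod_i t1 (x i * Ws ord0)) * \prod_i \prod_j t1 (x i * w j)).
    rewrite /P !big_ord_recl -big_split; congr (_ * _ * _).
      by apply: eq_bigr => j _; rewrite WsS.
    apply: eq_bigr => i _; rewrite big_ord_recl XsS; congr (_ * _).
    by apply: eq_bigr => j _; rewrite WsS.
  have EW : \prod_i \prod_j E (q * c j * x i / (c i * x j)) = E q ^+ r * T w.
    rewrite prod_pairs; congr (_ * _).
      rewrite (eq_bigr (fun=> E q)) ?prodr_const ?card_ord // => i _; congr E.
      by field; rewrite c_neq0 x_neq0.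
    apply: eq_bigr => i _; apply: eq_bigr => j _; rewrite /t1 mulrC; congr (E _ * E _);
      by rewrite /w; field; rewrite !c_neq0 !x_neq0.
  have EX : \prod_i \prod_j E (q * x i / x j) = E q ^+ r * T x.
    rewrite prod_pairs; congr (_ * _).
      rewrite (eq_bigr (fun=> E q)) ?prodr_const ?card_ord // => i _; congr E.
      by field; rewrite x_neq0.
    apply: eq_bigr => i _; apply: eq_bigr => j _; rewrite /t1; congr (E _ * E _);
      by field; rewrite !x_neq0.
  have EXW : \prod_i \prod_j E (q * c j * x i / x j) * \prod_i \prod_j E (q * x i / (c i * x j))
      = \prod_i \prod_j t1 (x i * w j).
    rewrite [X in _ * X]exchange_big -big_split; apply: eq_bigr => i _.
    rewrite -big_split; apply: eq_bigr => j _; rewrite /t1 /w /=; congr (E _ * E _);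
      by field; rewrite ?c_neq0 !x_neq0.
  have F1 : (E (a * q / C) * E (C * q / a)) / (E (a * q) * E (q / a))
     = t1 (Xs ord0 * Ws ord0) / t1 a.
    rewrite /t1 Xs0 Ws0 (mulrC a q); congr (E _ * E _ / _);
      by field; rewrite ?a_neq0 ?b_neq0 ?C_neq0.
  have F2 : \prod_(i < r) \prod_(j < r)
       ((E (q * c j * x i / x j) * E (q * x i / (c i * x j)))
        / (E (q * c j * x i / (c i * x j)) * E (q * x i / x j)))
      = \prod_i \prod_j t1 (x i * w j) / ((E q ^+ r * T w) * (E q ^+ r * T x)).
    rewrite -EXW -EW -EX -!big_split -prodfV -big_split /=; apply: eq_bigr => i _.
    by rewrite -!big_split -prodfV -big_split /=.
  have F3 : \prod_(i < r)
       ((E (a * x i * q / b) * E (b * q / (a * x i))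
         * E (b * c i * q / (C * x i)) * E (C * x i * q / (b * c i)))
        / (E (a * x i * q / (b * c i)) * E (b * c i * q / (a * x i))
           * E (C * x i * q / b) * E (b * q / (C * x i))))
     = (\prod_i t1 (x i * Ws ord0) * \prod_j t1 (Xs ord0 * w j))
       / (\prod_j t1 (Ws ord0 / w j) * \prod_j t1 (Xs ord0 / x j)).
    rewrite -!big_split -prodfV -big_split; apply: eq_bigr => i _ /=.
    rewrite (t1_sym (Xs ord0)) /t1 Xs0 Ws0 /w !mulrA.
    congr (E _ * E _ * E _ * E _ / (E _ * E _ * E _ * E _));
      by field; rewrite ?a_neq0 ?b_neq0 ?C_neq0 ?c_neq0 ?x_neq0.
  rewrite /prefactor F1 F2 F3 /e exprVn -exprM mulnC exprM expr2.
  have q0r : E q ^+ r != 0 by rewrite expf_neq0.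
  have n1 : T x != 0 by apply: altprod_neq0 => i j /gx /t1_neq0.
  have n2 : T w != 0.
    apply: altprod_neq0 => i j ij; rewrite !wE; apply/t1_neq0/gW.
    by rewrite (inj_eq lift_inj).
  have n3 : \prod_j t1 (Ws ord0 / w j) != 0.
    by apply/prodf_neq0 => j _; rewrite wE; apply/t1_neq0/gW.
  have n4 : \prod_j t1 (Xs ord0 / x j) != 0.
    by apply/prodf_neq0 => j _; rewrite -XsS; apply/t1_neq0/gX.
  by field; rewrite q0r n1 n2 n3 n4 ta.
have XW0 i j : Xs i * Ws j != 0 by rewrite mulf_neq0 ?Xs_neq0 ?Ws_neq0.
have thE : \prod_i \prod_j theta q (Xs i * Ws j)
   = \prod_i \prod_j (1 - Xs i * Ws j) * P
     * (altprod (fun _ _ => e) Xs * altprod (fun _ _ => e) Ws * e ^+ r.+1).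
  have -> : altprod (fun _ _ => e) Ws = altprod (fun _ _ => e) Xs by exact: eq_altprod.
  have cst : e ^+ (r.+1 * r.+1) = \prod_(i < r.+1) \prod_(j < r.+1) e.
    by rewrite !prodr_const card_ord exprM.
  rewrite -expr2 altprod_cst cst -!big_split; apply: eq_bigr => i _.
  by rewrite /= -!big_split; apply: eq_bigr => j _; exact: theta_t1.
have z0 n (u : 'I_n -> K) : altprod (fun _ _ => e) u != 0 by apply: altprod_neq0.
rewrite /K0 preE thE prod_XW theta_t1 // !altprod_skew; [|exact: Ws_neq0|exact: Xs_neq0].
rewrite exprS; field.
by rewrite vX vW TX TW ta a1 !z0 e_neq0.
Qed.

Implicit Types (n k l : zvec r).

Definition ys k (i : 'I_r.+1) : K := Xs i * q ^ flip (i == ord0) (extend ord0 k i).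
Definition ws n (j : 'I_r.+1) : K := Ws j * q ^ flip false (extend ord0 n j).

Lemma ys0 k : ys k ord0 = b / C * q ^ zabs k.
Proof. by rewrite /ys Xs0 eqxx extend_at /flip opprK. Qed.
Lemma ysS k i : ys k (lift ord0 i) = x i * q ^ k i.
Proof. by rewrite /ys XsS extend_lift eq_sym (negPf (neq_lift _ _)). Qed.
Lemma ws0 n : ws n ord0 = a / b * q ^ (- zabs n).
Proof. by rewrite /ws Ws0 extend_at. Qed.
Lemma wsS n j : ws n (lift ord0 j) = c j / x j * q ^ n j.
Proof. by rewrite /ws WsS extend_lift. Qed.

Lemma ys_neq0 k i : ys k i != 0.
Proof. by rewrite mulf_neq0 ?Xs_neq0 ?qpowz_neq0. Qed.
Lemma ws_neq0 n i : ws n i != 0.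
Proof. by rewrite mulf_neq0 ?Ws_neq0 ?qpowz_neq0. Qed.

Let qz_neq0 (m : int) : q ^ m != 0. Proof. exact: qpowz_neq0. Qed.

Lemma qp_ratio z m m' : not_qpow q z ->
  qp z m * (qp (z * q) m')^-1 = (1 - z) * (E (z * q ^ m' * q) / E (z * q ^ m)).
Proof.
move=> gz; rewrite /qpoch (qpoch_infS z) (mulrAC z q).
have n1 : E (z * q) != 0 by apply: qpoch_inf_neq0; exact: (nonqpowerM q_neq0 1 gz).
have n2 : E (z * q ^ m' * q) != 0.
  by apply: qpoch_inf_neq0; exact: (nonqpowerM q_neq0 1 (nonqpowerM q_neq0 m' gz)).
have n3 : E (z * q ^ m) != 0 by apply: qpoch_inf_neq0; exact: nonqpowerM.
by field; rewrite n1 n2 n3.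
Qed.

(** The factors [1 - b c_i q^(n_i + |n|) / (a x_i)] of f are those of the Vandermonde product that
    involve index 0, up to [q^|n|] each. *)
Lemma vdm_ws n : (\prod_(i < r) \prod_(j < r | (i < j)%N)
       ((c i * q ^ (n i) / x i - c j * q ^ (n j) / x j) / (c i / x i - c j / x j)))
  * (\prod_(i < r)
       ((1 - b * c i * q ^ (n i + zabs n) / (a * x i)) / (1 - b * c i / (a * x i))))
  = vdm (ws n) / vdm Ws * q ^ (r%:Z * zabs n).
Proof.
have d1 j : Ws ord0 - Ws (lift ord0 j) != 0.
  rewrite subr_eq0; have := nonqpower_neq1 (gW (neq_lift ord0 j)).
  by apply: contra_neq => ->; rewrite divff // Ws_neq0.
rewrite (altprod_recl _ (ws n)) (altprod_recl _ Ws).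
have -> : q ^ (r%:Z * zabs n) = \prod_(i < r) q ^ zabs n.
  by rewrite prod_exprz // sumr_const card_ord -mulr_natl natz.
rewrite mulrC.
have -> : \prod_(i < r) \prod_(j < r | (i < j)%N)
    ((c i * q ^ n i / x i - c j * q ^ n j / x j) / (c i / x i - c j / x j))
  = altprod (fun u v => u - v) (fun j => ws n (lift ord0 j))
    / altprod (fun u v => u - v) (fun j => Ws (lift ord0 j)).
  rewrite -prodfV -big_split; apply: eq_bigr => i _; rewrite -prodfV -big_split.
  by apply: eq_bigr => j _; rewrite /= !wsS !WsS !(mulrAC _ (q ^ _)).
set V := altprod _ _; set V' := altprod _ _.
have -> : \prod_(i < r)
       ((1 - b * c i * q ^ (n i + zabs n) / (a * x i)) / (1 - b * c i / (a * x i)))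
  = \prod_j (ws n ord0 - ws n (lift ord0 j)) / \prod_j (Ws ord0 - Ws (lift ord0 j))
    * \prod_(i < r) q ^ zabs n.
  rewrite -prodfV -!big_split; apply: eq_bigr => i _ /=.
  have D := d1 i; rewrite Ws0 WsS in D; rewrite ws0 wsS Ws0 WsS expfzDr // -invr_expz.
  have D2 : a * x i - b * c i != 0.
    apply: contra_neq D => D.
    have -> : a / b - c i / x i = (a * x i - b * c i) / (b * x i).
      by field; rewrite b_neq0 x_neq0.
    by rewrite D mul0r.
  by field; rewrite mulNr (mulrC (c i)) D2 a_neq0 b_neq0 x_neq0 qz_neq0.
by rewrite invfM; ring.
Qed.

Lemma vdm_ys k : (\prod_(i < r) \prod_(j < r | (i < j)%N)
       ((x i * q ^ (k i) - x j * q ^ (k j)) / (x i - x j)))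
  * (\prod_(i < r)
       ((1 - b * q ^ (zabs k - k i) / (C * x i)) / (1 - b / (C * x i))))
  = vdm (ys k) / vdm Xs * q ^ (- zabs k).
Proof.
have d1 j : Xs ord0 - Xs (lift ord0 j) != 0.
  rewrite subr_eq0; have := nonqpower_neq1 (gX (neq_lift ord0 j)).
  by apply: contra_neq => ->; rewrite divff // Xs_neq0.
rewrite (altprod_recl _ (ys k)) (altprod_recl _ Xs).
have -> : q ^ (- zabs k) = \prod_(i < r) q ^ (- k i).
  by rewrite prod_exprz // sumrN.
rewrite mulrC.
have -> : \prod_(i < r) \prod_(j < r | (i < j)%N)
       ((x i * q ^ (k i) - x j * q ^ (k j)) / (x i - x j))
  = altprod (fun u v => u - v) (fun j => ys k (lift ord0 j))
    / altprod (fun u v => u - v) (fun j => Xs (lift ord0 j)).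
  rewrite -prodfV -big_split; apply: eq_bigr => i _; rewrite -prodfV -big_split.
  by apply: eq_bigr => j _; rewrite /= !ysS !XsS.
set V := altprod _ _; set V' := altprod _ _.
have -> : \prod_(i < r)
       ((1 - b * q ^ (zabs k - k i) / (C * x i)) / (1 - b / (C * x i)))
  = \prod_j (ys k ord0 - ys k (lift ord0 j)) / \prod_j (Xs ord0 - Xs (lift ord0 j))
    * \prod_(i < r) q ^ (- k i).
  rewrite -prodfV -!big_split; apply: eq_bigr => i _ /=.
  have D := d1 i; rewrite Xs0 XsS in D; rewrite ys0 ysS Xs0 XsS expfzDr // -invr_expz.
  have D2 : b - C * x i != 0.
    apply: contra_neq D => D.
    have -> : b / C - x i = (b - C * x i) / C by field.
    by rewrite D mul0r.
  have D3 : C * x i - b != 0 by rewrite -opprB oppr_eq0.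
  by field; rewrite mulNr (mulrC (x i)) D2 D3 x_neq0 qz_neq0 C_neq0.
by rewrite invfM; ring.
Qed.

(** In f the shifted factorials containing [X_0] stand in the numerator and all others in the
    denominator, in g conversely; hence the exchanged roles in row 0. *)
Definition row_ratio (z z' v w : 'I_r.+1 -> K) :=
  \prod_j (E (z ord0 * v j * q) / E (z' ord0 * w j))
  * \prod_(i < r) \prod_j (E (z' (lift ord0 i) * w j * q) / E (z (lift ord0 i) * v j)).

(** With [k'] and [k] kept apart one formula serves both products: f g is the case [k' = k], and g f
    the case [n = l], where this common index is the one summed over. *)
Lemma fcoef_gcoef n k' k l :
  fcoef q a b c x n k' * gcoef q a b c x k l
  = K0 * q ^ (r%:Z * (zabs n - zabs l)) * vdm (ws n)
    * (vdm (ys k) * (1 - a * q ^ (2 * zabs k))) * row_ratio (ys k) (ys k') (ws l) (ws n).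
Proof.
have yw k1 n1 i j : ys k1 i * ws n1 j = Xs i * Ws j
    * q ^ (flip (i == ord0) (extend ord0 k1 i) + flip false (extend ord0 n1 j)).
  by rewrite /ys /ws mulrACA -expfzDr.
have ratio z i j n1 k1 l1 m1 (m m' : int) z' :
   z = Xs i * Ws j -> z' = z * q ->
   m = flip (i == ord0) (extend ord0 k1 i) + flip false (extend ord0 n1 j) ->
   m' = flip (i == ord0) (extend ord0 l1 i) + flip false (extend ord0 m1 j) ->
   qp z m * (qp z' m')^-1 = (1 - Xs i * Ws j)
     * (E (ys l1 i * ws m1 j * q) / E (ys k1 i * ws n1 j)).
  move=> zE -> -> ->; rewrite qp_ratio ?zE ?yw //; exact: gXW.
have fl0 k1 : flip (ord0 == ord0 :> 'I_r.+1) (extend ord0 k1 ord0) = zabs k1.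
  by rewrite eqxx extend_at /flip opprK.
have flS k1 i : flip (lift ord0 i == ord0 :> 'I_r.+1) (extend ord0 k1 (lift ord0 i)) = k1 i.
  by rewrite extend_lift eq_sym (negPf (neq_lift _ _)).
have fn0 n1 : flip false (extend ord0 n1 ord0 : int) = - zabs n1 by rewrite extend_at.
have fnS n1 j : flip false (extend ord0 n1 (lift ord0 j) : int) = n1 j by rewrite extend_lift.
have R00 : qp (a / C) (zabs k' - zabs n) * (qp (a * q / C) (zabs k - zabs l))^-1
   = (1 - Xs ord0 * Ws ord0) * (E (ys k ord0 * ws l ord0 * q) / E (ys k' ord0 * ws n ord0)).
  apply: ratio; rewrite ?fl0 ?fn0 ?Xs0 ?Ws0 //; last by ring.
  by field; rewrite C_neq0 b_neq0.
have R0S : \prod_(j < r) qp (b * c j / (C * x j)) (n j + zabs k')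
     * \prod_(j < r) (qp (b * c j * q / (C * x j)) (zabs k + l j))^-1
   = \prod_(j < r) (1 - Xs ord0 * Ws (lift ord0 j))
     * \prod_(j < r) (E (ys k ord0 * ws l (lift ord0 j) * q) / E (ys k' ord0 * ws n (lift ord0 j))).
  rewrite -!big_split; apply: eq_bigr => j _.
  apply: ratio; rewrite ?fl0 ?fnS ?Xs0 ?WsS //; [|by ring|by rewrite addrC].
  by field; rewrite C_neq0 x_neq0.
have RS0 : \prod_(i < r) qp (a * x i / b) (k i - zabs l)
     * \prod_(i < r) (qp (a * x i * q / b) (k' i - zabs n))^-1
   = \prod_(i < r) (1 - Xs (lift ord0 i) * Ws ord0)
     * \prod_(i < r) (E (ys k' (lift ord0 i) * ws n ord0 * q) / E (ys k (lift ord0 i) * ws l ord0)).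
  rewrite -!big_split; apply: eq_bigr => i _.
  by apply: ratio; rewrite ?flS ?fn0 ?XsS ?Ws0 //; ring.
have RSS : \prod_(i < r) \prod_(j < r) qp (c j * x i / x j) (k i + l j)
     * \prod_(i < r) \prod_(j < r) (qp (q * c j * x i / x j) (n j + k' i))^-1
   = \prod_(i < r) \prod_(j < r) (1 - Xs (lift ord0 i) * Ws (lift ord0 j))
     * \prod_(i < r) \prod_(j < r) (E (ys k' (lift ord0 i) * ws n (lift ord0 j) * q)
                              / E (ys k (lift ord0 i) * ws l (lift ord0 j))).
  rewrite -!big_split; apply: eq_bigr => i _; rewrite -!big_split; apply: eq_bigr => j _.
  by apply: ratio; rewrite ?flS ?fnS ?XsS ?WsS //; [ring | ring | rewrite addrC].
have PXW : \prod_i \prod_j (1 - Xs i * Ws j) =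
   (1 - Xs ord0 * Ws ord0) * \prod_(j < r) (1 - Xs ord0 * Ws (lift ord0 j))
   * (\prod_(i < r) (1 - Xs (lift ord0 i) * Ws ord0)
      * \prod_(i < r) \prod_(j < r) (1 - Xs (lift ord0 i) * Ws (lift ord0 j))).
  rewrite !big_ord_recl -big_split; congr (_ * _ * _); apply: eq_bigr => i _.
  by rewrite big_ord_recl.
have RR : row_ratio (ys k) (ys k') (ws l) (ws n) =
   (E (ys k ord0 * ws l ord0 * q) / E (ys k' ord0 * ws n ord0))
   * \prod_(j < r) (E (ys k ord0 * ws l (lift ord0 j) * q) / E (ys k' ord0 * ws n (lift ord0 j)))
   * (\prod_(i < r) (E (ys k' (lift ord0 i) * ws n ord0 * q) / E (ys k (lift ord0 i) * ws l ord0))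
      * \prod_(i < r) \prod_(j < r) (E (ys k' (lift ord0 i) * ws n (lift ord0 j) * q)
                              / E (ys k (lift ord0 i) * ws l (lift ord0 j)))).
  rewrite /row_ratio big_ord_recl -big_split; congr (_ * _ * _); apply: eq_bigr => i _.
  by rewrite big_ord_recl.
have PE := prefactorE; rewrite PXW in PE.
have Vw := vdm_ws n; have Vy := vdm_ys k.
have a1 : 1 - a != 0 by rewrite subr_eq0 eq_sym; exact: nonqpower_neq1 ga.
have qE : q ^ (r%:Z * (zabs n - zabs l))
   = q ^ (r%:Z * zabs n) * q ^ (- zabs k) * q ^ (zabs k - r%:Z * zabs l).
  by rewrite -!expfzDr //; congr (q ^ _); ring.
rewrite qE RR /fcoef /gcoef -/(prefactor).
rewrite [X in _ * X * (_ / _ * _ * _ * _ * _ * _ * _)]big_split.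
rewrite [X in _ * (_ * X * _)]big_split /=.
have A := assemble_terms (1 - a * q ^ (2 * zabs k)) (q ^ (zabs k - r%:Z * zabs l))
  vX vW a1 PE Vw Vy R00 R0S RS0 RSS.
exact: A.
Qed.

Lemma prod_ys_ws k n : \prod_i ys k i * \prod_j ws n j = a * q ^ (2 * zabs k).
Proof.
rewrite -prod_XW !big_split /=.
rewrite !prod_exprz // sum_extend expr0z mulr1 mulrAC; congr (_ * q ^ _).
have -> : 2 * zabs k = zabs k + zabs k by ring.
rewrite big_ord_recl eqxx extend_at /flip opprK; congr (_ + _).
by apply: eq_bigr => i _; rewrite extend_lift.
Qed.

Let yw_nonqpow k n i j : not_qpow q (ys k i * ws n j).
Proof. by rewrite /ys /ws mulrACA -expfzDr //; apply: nonqpowerM => //; exact: gXW. Qed.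

Let E_ywq k n i j : E (ys k i * ws n j * q) != 0.
Proof. exact/qpoch_inf_neq0/(nonqpowerM q_neq0 1)/yw_nonqpow. Qed.

Lemma row_ratio_diag k n :
  row_ratio (ys k) (ys k) (ws n) (ws n) = (\prod_i \prod_j (1 - ys k i * ws n j))^-1.
Proof.
have h i j : E (ys k i * ws n j * q) / E (ys k i * ws n j) = (1 - ys k i * ws n j)^-1.
  rewrite (qpoch_infS (ys k i * ws n j)); have := E_ywq k n i j.
  have : 1 - ys k i * ws n j != 0.
    by rewrite subr_eq0 eq_sym; exact/nonqpower_neq1/yw_nonqpow.
  by move=> h1 h2; field; rewrite h1 h2.
rewrite /row_ratio [X in _ = X^-1]big_ord_recl invfM -!prodfV; congr (_ * _).
  by apply: eq_bigr => j _.
by apply: eq_bigr => i _; rewrite -prodfV; apply: eq_bigr.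
Qed.

Lemma K0_neq0 : K0 != 0.
Proof.
have th0 z : not_qpow q z -> theta q z != 0 by exact: (theta_neq0 cK q_neq0 q_lt1 qX).
have sk N (u : 'I_N -> K) : (forall i, u i != 0) ->
    (forall i j, i != j -> not_qpow q (u i / u j)) -> altprod (skew (theta q)) u != 0.
  move=> u0 gu; apply: altprod_neq0 => i j ij; rewrite mulf_neq0 // th0 //.
  by rewrite -invf_div; exact/gV/gu.
have A1 := sk _ _ Xs_neq0 gX; have A2 := sk _ _ Ws_neq0 gW; have A3 := th0 _ ga.
have A4 : \prod_i \prod_j theta q (Xs i * Ws j) != 0.
  by apply/prodf_neq0 => i _; apply/prodf_neq0 => j _; exact/th0/gXW.
rewrite /K0 prod_XW; apply: mulf_neq0 => //; rewrite invr_eq0.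
exact: (mulf_neq0 (mulf_neq0 A3 A1) A2).
Qed.

(** * The four sums *)

Lemma zsum_scaled (F : zvec r -> K) (G : {ffun 'I_r.+1 -> int} -> K) d S :
  (forall k, F k = d * G (extend ord0 k)) ->
  norm_bounded (G \o extend ord0) -> has_sum (G \o extend ord0) S -> zsum_eq F (d * S).
Proof.
by move=> /funext -> hb hs; apply: zsum_of_has_sum; [exact: norm_boundedZ | exact: has_sumZ].
Qed.

Lemma zsum_fg_diag n :
  zsum_eq (fun k => fcoef q a b c x n k * gcoef q a b c x k n) 1.
Proof.
have <- : K0 * K0^-1 = 1 by rewrite divff // K0_neq0.
apply: (zsum_scaled (G := cauchy_term q Xs Ws (fun i => i == ord0) (extend ord0 n))).
- move=> k; rewrite fcoef_gcoef row_ratio_diag subrr mulr0 expr0z mulr1.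
  have -> : cauchy_term q Xs Ws (fun i => i == ord0) (extend ord0 n) (extend ord0 k)
    = (1 - \prod_i ys k i * \prod_j ws n j) * vdm (ys k) * vdm (ws n)
      / \prod_i \prod_j (1 - ys k i * ws n j) by [].
  by rewrite prod_ys_ws; ring.
- exact: (cauchy_term_bounded q_neq0 q_lt1 qX _ _ Xs_neq0 Ws_neq0 gX gXW).
- rewrite /K0 invf_div; exact: (cauchy_term_sum cK q_neq0 q_lt1 qX _ _ Xs_neq0 Ws_neq0 gX gXW).
Qed.

Lemma zsum_gf_diag n :
  zsum_eq (fun k => gcoef q a b c x n k * fcoef q a b c x k n) 1.
Proof.
have <- : K0 * K0^-1 = 1 by rewrite divff // K0_neq0.
(* Now [w] varies and [y] is fixed, so the reversal at index 0 moves from the rows into the fixed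
   shifts. *)
pose s i := flip (i == ord0 :> 'I_r.+1) (extend ord0 n i).
have gWX i j : not_qpow q (Ws i * Xs j) by rewrite mulrC; exact: gXW.
apply: (zsum_scaled (G := cauchy_term q Ws Xs (fun=> false) s)).
- move=> k; rewrite mulrC fcoef_gcoef row_ratio_diag subrr mulr0 expr0z mulr1.
  have -> : cauchy_term q Ws Xs (fun=> false) s (extend ord0 k)
    = (1 - \prod_i ws k i * \prod_j ys n j) * vdm (ws k) * vdm (ys n)
      / \prod_i \prod_j (1 - ws k i * ys n j) by [].
  rewrite [\prod_i ws k i * _]mulrC prod_ys_ws.
  have -> : \prod_i \prod_j (1 - ws k i * ys n j) = \prod_i \prod_j (1 - ys n i * ws k j).
    by rewrite exchange_big; do 2![apply: eq_bigr => ? _]; rewrite mulrC.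
  ring.
- exact: (cauchy_term_bounded q_neq0 q_lt1 qX _ _ Ws_neq0 Xs_neq0 gW gWX).
- have -> : K0^-1 = theta q (\prod_i Ws i * \prod_j Xs j) * altprod (skew (theta q)) Ws
      * altprod (skew (theta q)) Xs / \prod_i \prod_j theta q (Ws i * Xs j).
    exact: (etrans (invf_div _ _) (cauchy_product_sym (theta q) Xs Ws)).
  exact: (cauchy_term_sum cK q_neq0 q_lt1 qX _ _ Ws_neq0 Xs_neq0 gW gWX).
Qed.

Lemma zabs_extend_neq n l : n != l -> exists j, extend ord0 n j - extend ord0 l j != 0.
Proof.
move=> nl; apply: contrapT => H; case/eqP: nl; apply: (@extend_inj r ord0).
apply/ffunP => j; apply/eqP; rewrite -subr_eq0; apply: contrapT => /negP h.
by apply: H; exists j.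
Qed.

Lemma zsum_fg_offdiag n l : n != l ->
  zsum_eq (fun k => fcoef q a b c x n k * gcoef q a b c x k l) 0.
Proof.
move=> nl; pose m j := extend ord0 n j - extend ord0 l j.
have wE : (fun j => ws l j * q ^ m j) = ws n.
  by apply/funext => j; rewrite /ws -mulrA -expfzDr // /m /flip addrCA subrr addr0.
have m0 : \sum_j m j = 0 by rewrite sumrB !sum_extend subrr.
have gwl i j : i != j -> not_qpow q (ws l i / ws l j).
  move=> ij; rewrite /ws invfM mulrACA invr_expz -expfzDr //.
  by apply: nonqpowerM => //; exact: gW.
have gXw i j : not_qpow q (Xs i * ws l j).
  by rewrite mulrA; apply: nonqpowerM => //; exact: gXW.
pose d := K0 * q ^ (r%:Z * (zabs n - zabs l)) * vdm (ws n).
rewrite -(mulr0 d).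
pose eps i := i == ord0 :> 'I_r.+1.
apply: (zsum_scaled (G := offdiag_term q Xs (ws l) m eps)).
- move=> k; rewrite fcoef_gcoef -mulrA -/d; congr (_ * _).
  have -> : offdiag_term q Xs (ws l) m eps (extend ord0 k)
    = (1 - \prod_j (ws l j * q ^ m j) * \prod_i ys k i) * vdm (ys k)
      * \prod_i row_weight q (ws l) m eps i (ys k i) by [].
  have wE' j : ws l j * q ^ m j = ws n j by rewrite -wE.
  under [\prod_j (ws l j * _)]eq_bigr do rewrite wE'.
  rewrite [\prod_j ws n j * _]mulrC prod_ys_ws.
  have rw0 z : row_weight q (ws l) m eps ord0 z = \prod_j (E (z * ws l j * q) / E (z * ws n j)).
    rewrite /row_weight /eps eqxx; apply: eq_bigr => j _.
    by rewrite !pochhammer_infE wE'.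
  have rwS i z : row_weight q (ws l) m eps (lift ord0 i) z
      = \prod_j (E (z * ws n j * q) / E (z * ws l j)).
    rewrite /row_weight /eps eq_sym (negPf (neq_lift _ _)); apply: eq_bigr => j _.
    by rewrite !pochhammer_infE wE'.
  have -> : \prod_i row_weight q (ws l) m eps i (ys k i)
      = row_ratio (ys k) (ys k) (ws l) (ws n).
    rewrite big_ord_recl rw0.
    have hS : \prod_(i < r) row_weight q (ws l) m eps (lift ord0 i) (ys k (lift ord0 i))
      = \prod_(i < r) \prod_j (E (ys k (lift ord0 i) * ws n j * q) / E (ys k (lift ord0 i) * ws l j)).
      by apply: eq_bigr => i _; exact: rwS.
    by rewrite hS.
  by rewrite [vdm _ * _]mulrC.
- exact: (offdiag_bounded cK q_neq0 q_lt1 qX eps Xs_neq0 (ws_neq0 l) m0 gXw).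
- exact: (offdiag_sum cK q_neq0 q_lt1 qX eps Xs_neq0 (ws_neq0 l) m0 (zabs_extend_neq nl) gwl gXw).
Qed.

(** With [w] as the summation variable all rows run in the same direction, but [row_ratio] exchanges
    [n] and [l] at index 0. The two parameter families are therefore mixed: one takes [y_0] from [l]
    and the other [y_i] from [n], the second conversely. *)
Lemma zsum_gf_offdiag n l : n != l ->
  zsum_eq (fun k => gcoef q a b c x n k * fcoef q a b c x k l) 0.
Proof.
move=> nl.
pose mix k k' (i : 'I_r.+1) := if i == ord0 then ys k i else ys k' i.
pose m (i : 'I_r.+1) : int := extend ord0 l i - extend ord0 n i.
have bE i : mix l n i * q ^ m i = mix n l i.
  have h k1 k2 : ys k1 i * q ^ (flip (i == ord0) (extend ord0 k2 i - extend ord0 k1 i)) = ys k2 i.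
    by rewrite /ys -mulrA -expfzDr //; congr (_ * q ^ _); case: (i == ord0); rewrite /flip; ring.
  rewrite /mix; case: ifP => i0.
    by rewrite -(h l n) i0 /flip /m opprB.
  by rewrite -(h n l) i0.
have m0 : \sum_j m j = 0 by rewrite sumrB !sum_extend subrr.
have mixX k k' i : exists t, mix k k' i = Xs i * q ^ t.
  by rewrite /mix; case: ifP => _; eexists; reflexivity.
have mix0 i : mix l n i != 0 by rewrite /mix; case: ifP => _; exact: ys_neq0.
have gmix i j : i != j -> not_qpow q (mix l n i / mix l n j).
  move=> ij; have [t ->] := mixX l n i; have [t' ->] := mixX l n j.
  rewrite invfM mulrACA invr_expz -expfzDr //.
  by apply: nonqpowerM => //; exact: gX.
have gWmix i j : not_qpow q (Ws i * mix l n j).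
  have [t ->] := mixX l n j; rewrite mulrA (mulrC (Ws i)).
  apply: nonqpowerM => //; exact: gXW.
(* [y_0] comes from [n] and the other [y_i] from [l], so each index contributes once to the
   exponent. *)
have mprod : \prod_j mix n l j * \prod_i Ws i = a * q ^ (zabs n + zabs l).
  rewrite -prod_XW !big_ord_recl /mix /= ys0 Xs0.
  under eq_bigr do rewrite ysS.
  under [X in _ = _ * X * _ * _]eq_bigr do rewrite XsS.
  rewrite big_split prod_exprz // -/(zabs l) expfzDr //=; ring.
have wsprod k : \prod_i ws k i = \prod_i Ws i.
  rewrite big_split /=.
  by rewrite prod_exprz // sum_extend expr0z mulr1.
have a1 : 1 - a * q ^ (zabs n + zabs l) != 0.
  by rewrite subr_eq0 eq_sym; exact: nonqpower_shift.
pose d := K0 * vdm (ys n) * (1 - a * q ^ (2 * zabs n)) / (1 - a * q ^ (zabs n + zabs l)).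
rewrite -(mulr0 d).
apply: (zsum_scaled (G := offdiag_term q Ws (mix l n) m (fun=> false))).
- move=> k; rewrite mulrC fcoef_gcoef subrr mulr0 expr0z mulr1.
  have -> : offdiag_term q Ws (mix l n) m (fun=> false) (extend ord0 k)
    = (1 - \prod_j (mix l n j * q ^ m j) * \prod_i ws k i) * vdm (ws k)
      * \prod_i row_weight q (mix l n) m (fun=> false) i (ws k i) by [].
  under [\prod_j (mix l n j * _)]eq_bigr do rewrite bE.
  rewrite wsprod mprod.
  have -> : \prod_i row_weight q (mix l n) m (fun=> false) i (ws k i)
     = row_ratio (ys n) (ys l) (ws k) (ws k).
    transitivity (\prod_j \prod_i (E (mix n l i * ws k j * q) / E (mix l n i * ws k j))).
      apply: eq_bigr => j _; rewrite /row_weight; apply: eq_bigr => i _.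
      by rewrite !pochhammer_infE bE !(mulrC (ws k j)).
    rewrite exchange_big big_ord_recl; congr (_ * _).
  by rewrite /d; field.
- exact: (offdiag_bounded cK q_neq0 q_lt1 qX (fun=> false) Ws_neq0 mix0 m0 gWmix).
- apply: (offdiag_sum cK q_neq0 q_lt1 qX (fun=> false) Ws_neq0 mix0 m0 _ gmix gWmix).
  by apply: zabs_extend_neq; rewrite eq_sym.
Qed.

End ProductFormula.

Theorem theorem3p2 (R : realType) (r : nat) (q a b : R[i])
    (c x : 'I_r -> R[i]) :
  (0 < r)%N ->
  0 < `|q| -> `|q| < 1 ->
  (* generic parameters: nonzero, and none of the relevant monomials
     is an integral power of q (so that no denominator vanishes) *)
  a != 0 -> b != 0 -> (forall i, c i != 0) -> (forall i, x i != 0) ->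
  not_qpow q a ->
  not_qpow q (a / Cprod c) ->
  (forall i j, i != j -> not_qpow q (c j * x i / (c i * x j))) ->
  (forall i j, i != j -> not_qpow q (x i / x j)) ->
  (forall i j, not_qpow q (c j * x i / x j)) ->
  (forall i, not_qpow q (a * x i / (b * c i))) ->
  (forall i, not_qpow q (Cprod c * x i / b)) ->
  (forall i, not_qpow q (a * x i / b)) ->
  (forall i, not_qpow q (b * c i / (Cprod c * x i))) ->
  forall n l : zvec r,
    zsum_eq (fun k => fcoef q a b c x n k * gcoef q a b c x k l) (kdelta R n l)
    /\
    zsum_eq (fun k => gcoef q a b c x n k * fcoef q a b c x k l) (kdelta R n l).
Proof.
move=> _ q_gt0 q_lt1 a0 b0 c0 x0 ga gaC gcx gx gcxx gaxbc gCxb gaxb gbcCx n l.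
have q_neq0 : q != 0 by rewrite -normr_gt0.
rewrite /kdelta; have [<-|nl] := eqVneq n l; split.
- exact: zsum_fg_diag.
- exact: zsum_gf_diag.
- exact: zsum_fg_offdiag.
- exact: zsum_gf_offdiag.
Qed.
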